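(* Let $m\geq 3$. There does not exist any non-Hopf real hypersurface $M$ in $\mathbb{C}P^m$ such that the tensor field $R_{\xi_T}^{(k)}$ is skew symmetric, i.e. $R_{\xi_T}^{(k)}(X,Y)=-R_{\xi_T}^{(k)}(Y,X)$ for all $X,Y$ tangent to $M$, for any nonzero real number $k$ satisfying $k\,g(A\xi,\xi)\neq 1$ on $M$ (i.e. at every point of $M$).
   Context: $\mathbb{C}P^m$ is complex projective space with complex structure $J$ and Fubini-Study metric $g$ of constant holomorphic sectional curvature $4$. A real hypersurface $M$ of $\mathbb{C}P^m$ is a connected $C^\infty$ real hypersurface without boundary, with induced metric $g$, Levi-Civita connection $\nabla$, and (locally defined) unit normal vector field $N$; $A$ is the shape operator associated to $N$. All vector fields etc. are $C^\infty$. The structure (Reeb) vector field is $\xi=-JN$. For $X$ tangent to $M$ write $JX=\phi X+\eta(X)N$ with $\phi X$ tangent to $M$ and $\eta(X)=g(X,\xi)$; then $\nabla_X\xi=\phi AX$. $M$ is called Hopf if $A\xi=\alpha\xi$ for some function $\alpha$ on $M$, and non-Hopf if it is not Hopf. The structure Jacobi operator is $R_\xi X=R(X,\xi)\xi$, where $R$ is the curvature tensor of $M$; by the Gauss equation, $R_\xi X=X-\eta(X)\xi+g(A\xi,\xi)AX-g(A\xi,X)A\xi$. For a nonzero real number $k$ and $X$ tangent to $M$, the $k$-th Cho operator is $F^{(k)}_XY=g(\phi AX,Y)\xi-\eta(Y)\phi AX-k\eta(X)\phi Y$; the $k$-th generalized Tanaka-Webster connection on $M$ is $\hat\nabla^{(k)}_XY=\nabla_XY+F^{(k)}_XY$,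 and its torsion is $T^{(k)}(X,Y)=F^{(k)}_XY-F^{(k)}_YX$. The torsion operator associated to $X$ is $T^{(k)}_XY=T^{(k)}(X,Y)$. The tensor field $R_{\xi_T}^{(k)}$ of type $(1,2)$ on $M$ is defined by $R_{\xi_T}^{(k)}(X,Y)=[T^{(k)}_X,R_\xi]Y=T^{(k)}_XR_\xi Y-R_\xi T^{(k)}_XY$ for $X,Y$ tangent to $M$. *)

(* Defs.v *)
From HB Require Import structures.
From mathcomp Require Import all_boot all_order all_algebra.
From mathcomp Require Import spectral complex.
From mathcomp Require Import all_classical all_reals all_analysis.

Set Implicit Arguments.
Unset Strict Implicit.
Unset Printing Implicit Defensive.

Import Order.TTheory GRing.Theory Num.Theory.
Import numFieldNormedType.Exports.
Import sesquilinear.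

Local Open Scope classical_set_scope.
Local Open Scope ring_scope.
Local Open Scope complex_scope.
Local Open Scope sesquilinear_scope.

(** Complex projective space. A line of C^(m+1) is represented by the Hermitian
    projector onto it, so that CP^m is a submanifold of the Euclidean space of
    Hermitian matrices. If z is a unit vector of the line P = z z^*, the tangent
    vector of CP^m at P given by v in the orthogonal of z is the matrix
    X = v z^* + z v^*. Then i v corresponds to i (X P - P X), and
    tr (X Y) / 2 = Re <v, w> for Y = w z^* + z w^*: the Hopf map from the unit
    sphere is a Riemannian submersion, i.e. this is the Fubini-Study metric of
    constant holomorphic sectional curvature 4. *)

Section ComplexProjectiveSpace.
Context {R : realType} {m : nat}.
Implicit Types P X Y Z : 'M[R[i]]_m.+1.

Definition CP : set 'M[R[i]]_m.+1 :=
  [set P | [/\ P ^t* = P, P *m P = P & \tr P = 1]].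

Definition tangentCP P : set 'M[R[i]]_m.+1 :=
  [set X | X ^t* = X /\ X *m P + P *m X = X].

Definition Jcp P X : 'M[R[i]]_m.+1 := (0 +i* 1) *: (X *m P - P *m X).

Definition gFS X Y : R := complex.Re (\tr (X *m Y)) / 2.

(* On Hermitian matrices, the orthogonal projection onto tangentCP P. *)
Definition projCP P Z : 'M[R[i]]_m.+1 :=
  P *m Z + Z *m P - 2 *: (P *m Z *m P).

End ComplexProjectiveSpace.

Section Calculus.
Context {R : realType} {n : nat}.

Definition partial (i : 'I_n) (h : 'rV[R]_n -> R) (u : 'rV[R]_n) : R :=
  'D_(delta_mx 0 i) h u.

Definition smooth_on (D : set 'rV[R]_n) (h : 'rV[R]_n -> R) : Prop :=
  forall (s : seq 'I_n) (u : 'rV[R]_n), D u ->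
    {for u, continuous (foldr partial h s)} /\
    forall i, derivable (foldr partial h s) u (delta_mx 0 i).

Definition smooth_mx_on p (D : set 'rV[R]_n) (F : 'rV[R]_n -> 'M[R[i]]_p) :=
  forall a b, smooth_on D (fun u => complex.Re (F u a b)) /\
              smooth_on D (fun u => complex.Im (F u a b)).

Definition partial_mx p (i : 'I_n) (F : 'rV[R]_n -> 'M[R[i]]_p)
    (u : 'rV[R]_n) : 'M[R[i]]_p :=
  \matrix_(a, b) (partial i (fun v => complex.Re (F v a b)) u +i*
                  partial i (fun v => complex.Im (F v a b)) u).

(* The derivative of F at u in the direction X. *)
Definition diff_mx p (F : 'rV[R]_n -> 'M[R[i]]_p) (u X : 'rV[R]_n) :
    'M[R[i]]_p :=
  \sum_(i < n) (X 0 i)%:C *: partial_mx i F u.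

End Calculus.

(** Geometry of a parametrized hypersurface F of CP^m with unit normal N along F.
    The tangent space at F u is identified with 'rV_n by means of the coordinate
    vectors, so that X : 'rV_n stands for the tangent vector diff_mx F u X. *)

Section LocalGeometry.
Context {R : realType} {m n : nat}.
Variables F N : 'rV[R]_n -> 'M[R[i]]_m.+1.
Implicit Types (u X Y Z : 'rV[R]_n) (i j l : 'I_n).

Definition gram u : 'M[R]_n :=
  \matrix_(i, j) gFS (partial_mx i F u) (partial_mx j F u).

Definition metric u X Y : R := (X *m gram u *m Y^T) 0 0.

(* Coordinates of the part of Z tangent to the hypersurface, Z being given in
   the tangent space of CP^m. *)
Definition tangent_coord u (Z : 'M[R[i]]_m.+1) : 'rV[R]_n :=
  (\row_i gFS Z (partial_mx i F u)) *m invmx (gram u).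

Definition christoffel i j u : 'rV[R]_n :=
  (\row_l ((partial i (fun v => gram v j l) u
          + partial j (fun v => gram v i l) u
          - partial l (fun v => gram v i j) u) / 2)) *m invmx (gram u).

(* The Levi-Civita covariant derivative, along the i-th coordinate field, of the
   vector field V. *)
Definition cov i (V : 'rV[R]_n -> 'rV[R]_n) u : 'rV[R]_n :=
  \row_l partial i (fun v => V v 0 l) u
  + \sum_(j < n) V u 0 j *: christoffel i j u.

(* Convention: R(X, Y) Z = nabla_X nabla_Y Z - nabla_Y nabla_X Z
   - nabla_[X, Y] Z; the bracket of coordinate fields vanishes. *)
Definition curv u X Y Z : 'rV[R]_n :=
  \sum_(i < n) \sum_(j < n) \sum_(l < n) (X 0 i * Y 0 j * Z 0 l) *:
    (cov i (christoffel j l) u - cov j (christoffel i l) u).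

(* The Levi-Civita connection of CP^m is the tangential part of the derivative
   in the space of Hermitian matrices. *)
Definition nablaCP u X (V : 'rV[R]_n -> 'M[R[i]]_m.+1) : 'M[R[i]]_m.+1 :=
  projCP (F u) (diff_mx V u X).

Definition shape u X : 'rV[R]_n := tangent_coord u (- nablaCP u X N).

Definition xi u : 'rV[R]_n := tangent_coord u (- Jcp (F u) (N u)).

Definition eta u X : R := metric u X (xi u).

Definition phi u X : 'rV[R]_n := tangent_coord u (Jcp (F u) (diff_mx F u X)).

Definition structure_jacobi u X : 'rV[R]_n := curv u X (xi u) (xi u).

Definition cho (k : R) u X Y : 'rV[R]_n :=
  metric u (phi u (shape u X)) Y *: xi u - eta u Y *: phi u (shape u X)
  - (k * eta u X) *: phi u Y.

Definition torsion (k : R) u X Y : 'rV[R]_n := cho k u X Y - cho k u Y X.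

Definition RxiT (k : R) u X Y : 'rV[R]_n :=
  torsion k u X (structure_jacobi u Y) - structure_jacobi u (torsion k u X Y).

End LocalGeometry.

(** An (immersed) real hypersurface of CP^m is a manifold M of dimension 2m - 1
    with a map f to CP^m that is an immersion in local charts; embedded
    hypersurfaces are the case where f is the inclusion of a subspace. Charts
    need no compatibility condition: the requirement that f be an immersion in
    each of them makes the transition maps smooth. Each chart of the atlas comes
    with a unit normal field on its domain; no agreement between the normal
    fields on overlaps is required, since M may be one-sided. *)

Definition hdim (m : nat) : nat := m.*2.-1.

Record hchart (R : realType) (m : nat) (M : Type) := HChart {
  dom : set 'rV[R]_(hdim m);
  par : 'rV[R]_(hdim m) -> M;
  nrm : 'rV[R]_(hdim m) -> 'M[R[i]]_m.+1 }.

Section RealHypersurface.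
Context {R : realType} {m : nat} {M : topologicalType}.
Variable f : M -> 'M[R[i]]_m.+1.
Implicit Types (c : hchart R m M) (atlas : set (hchart R m M)).

Definition is_chart c : Prop :=
  [/\ open (dom c),
      {in dom c &, injective (par c)},
      {in dom c, continuous (par c)} &
      forall B, open B -> B `<=` dom c -> open (par c @` B)].

Definition is_immersion c : Prop :=
  [/\ smooth_mx_on (dom c) (f \o par c),
      forall u, dom c u -> CP (f (par c u)) &
      forall u X, dom c u -> diff_mx (f \o par c) u X = 0 -> X = 0].

Definition is_unit_normal c : Prop :=
  smooth_mx_on (dom c) (nrm c) /\
  forall u, dom c u ->
    [/\ tangentCP (f (par c u)) (nrm c u),
        gFS (nrm c u) (nrm c u) = 1 &
        forall X, gFS (nrm c u) (diff_mx (f \o par c) u X) = 0].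

Definition real_hypersurface atlas : Prop :=
  [/\ hausdorff_space M, @second_countable M, connected [set: M],
      forall c, atlas c -> [/\ is_chart c, is_immersion c & is_unit_normal c] &
      forall p : M, exists2 c, atlas c & (par c @` dom c) p].

Definition chart_xi c : 'rV[R]_(hdim m) -> 'rV[R]_(hdim m) :=
  xi (f \o par c) (nrm c).

Definition chart_shape c :
    'rV[R]_(hdim m) -> 'rV[R]_(hdim m) -> 'rV[R]_(hdim m) :=
  shape (f \o par c) (nrm c).

Definition hopf atlas : Prop :=
  forall c u, atlas c -> dom c u ->
    exists a : R, chart_shape c u (chart_xi c u) = a *: chart_xi c u.

(* g (A xi, xi) *)
Definition chart_alpha c (u : 'rV[R]_(hdim m)) : R :=
  metric (f \o par c) u (chart_shape c u (chart_xi c u)) (chart_xi c u).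

Definition RxiT_skew (k : R) atlas : Prop :=
  forall c u X Y, atlas c -> dom c u ->
    RxiT (f \o par c) (nrm c) k u X Y = - RxiT (f \o par c) (nrm c) k u Y X.

End RealHypersurface.

(* Main.v *)
Require Import Defs.
From mathcomp Require Import all_boot all_order all_algebra.
From mathcomp Require Import complex ring lra zify.
From mathcomp Require Import all_classical all_reals all_analysis.

(** Why there is no such hypersurface. Write A xi = alpha xi + beta U with U a
    unit vector orthogonal to xi; non-Hopf means that beta is nonzero at some
    point, hence on an open set, and the contradiction is local.

    The pointwise part. Since the torsion T is antisymmetric, skew symmetry of
    [T_X, R_xi] Y in X and Y reduces to T(X, R_xi Y) + T(Y, R_xi X) = 0
    (torsion_Rxi). Where beta is nonzero and k alpha differs from 1, linear
    algebra turns this into strong information on the shape operator: alpha is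
    nonzero, A phi U = -(1/alpha) phi U, and
    A U = beta xi + ((beta^2 - 1)/alpha) U, so that R_xi vanishes on xi, U and
    phi U; moreover A = k both on the image of R_xi and on its image under phi
    (shape_Rxi, shape_phi_Rxi).

    The differential part uses the Codazzi equation. Let X be a field orthogonal
    to xi, U and phi U such that X and phi X are eigenvectors of A for one
    eigenvalue mu. Codazzi for X and xi, beta U, beta phi U gives relations
    between mu and <nabla_X (beta U), phi X> (eigen_xi, eigen_wvec, eigen_pvec).
    With mu = k they show that R_xi = 0 (Rxi_eq0). Then mu = -1/alpha on the
    whole orthogonal complement of xi, U and phi U, which is nonzero as m >= 3,
    and the relations give alpha^2 = 1 (alpha_sqr). Codazzi for the vectors xi, U
    and phi U now determines the derivative of beta^2: it vanishes along xi and
    U, but not along phi U, although [xi, beta U] is a nonzero multiple of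
    phi U (no_skew_non_hopf).

    The geometric input comes from the embedding of CP^m as the rank-one
    projectors P among the Hermitian matrices. There, tangent vectors
    anticommute with 2 P - 1 and vectors normal to CP^m commute with it, and the
    second fundamental form is explicit (sigmaCP), with the curvature of constant
    holomorphic sectional curvature 4 (curvature_identity). A dimension count
    (tangentCP_complete) shows that the coordinate vectors and the normal span
    the tangent space of CP^m, and symmetry of second derivatives (partialC)
    identifies the connection given by Christoffel symbols with the tangential
    part of the derivative of matrices (nabP). Codazzi, Gauss and the rules for
    nabla xi and nabla phi follow by differentiating relations between matrices.
    The pointwise and differential parts are stated for an abstract structure
    with these rules (shape_structure, hypersurface_calculus). *)

Set Implicit Arguments.
Unset Strict Implicit.
Unset Printing Implicit Defensive.

Import Order.TTheory GRing.Theory Num.Theory.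
Import numFieldNormedType.Exports.
Import sesquilinear.

Local Open Scope ring_scope.
Local Open Scope complex_scope.
Local Open Scope sesquilinear_scope.

(** * Smooth functions and mixed partial derivatives *)

Section SmoothFunctions.
Local Open Scope classical_set_scope.
Context {R : realType} {n : nat}.
Variable D : set 'rV[R]_n.
Hypothesis oD : open D.
Implicit Types (f g h : 'rV[R]_n -> R) (u : 'rV[R]_n) (i j : 'I_n).

Lemma smooth_partial i h : smooth_on D h -> smooth_on D (partial i h).
Proof.
move=> sh s u Du.
by have := sh (rcons s i) u Du; rewrite !foldr_rcons.
Qed.

Lemma smooth_derivable i h u :
  smooth_on D h -> D u -> derivable h u (delta_mx 0 i).
Proof. by move=> sh Du; have [_] := sh [::] u Du; exact. Qed.

Lemma smooth_continuous h u : smooth_on D h -> D u -> {for u, continuous h}.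
Proof. by move=> sh Du; have [] := sh [::] u Du. Qed.

Lemma near_open u (P : set 'rV[R]_n) :
  D u -> (forall v, D v -> P v) -> \forall v \near u, P v.
Proof.
move=> Du DP; apply: filterS (open_nbhs_nbhs (conj oD Du)); exact: DP.
Qed.

Lemma eq_partial i f g u : f =1 g -> partial i f u = partial i g u.
Proof. by move=> /funext ->. Qed.

Lemma partial_ext i f g u :
  (forall v, D v -> f v = g v) -> D u -> partial i f u = partial i g u.
Proof. by move=> fg Du; apply: near_eq_derive; exact: near_open Du fg. Qed.

Lemma smooth_cst (c : R) : smooth_on D (fun=> c).
Proof.
move=> s u Du.
have -> : foldr partial (fun=> c) s = fun=> (s == [::])%:R * c.
  elim: s => /= [|j s ->]; first by apply/funext => v; rewrite mul1r.
  by apply/funext => v; rewrite mul0r /partial derive_cst.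
by split; [exact: cst_continuous| move=> j; exact: derivable_cst].
Qed.

(** As smooth_on quantifies over all iterated partial derivatives, its closure
    properties are hard to prove one at a time. This family contains the smooth
    functions and is stable under each single partial derivative, by the product
    and quotient rules; so all its members have continuous derivatives of every
    order. *)
Inductive smooth_alg : ('rV[R]_n -> R) -> Prop :=
| SmoothBase h of smooth_on D h : smooth_alg h
| SmoothExt f g of smooth_alg f & (forall u, D u -> f u = g u) : smooth_alg g
| SmoothAdd f g of smooth_alg f & smooth_alg g :
    smooth_alg (fun u => f u + g u)
| SmoothMul f g of smooth_alg f & smooth_alg g :
    smooth_alg (fun u => f u * g u)
| SmoothInv f of smooth_alg f & (forall u, D u -> f u != 0) :
    smooth_alg (fun u => (f u)^-1).

Lemma smooth_alg1 h : smooth_alg h ->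
  forall u, D u -> {for u, continuous h} /\
                   forall i, derivable h u (delta_mx 0 i).
Proof.
elim=> {h}.
- by move=> h sh u Du; have [] := sh [::] u Du.
- move=> f g _ IH fg u Du; have [cf df] := IH u Du; split.
    rewrite /prop_for /continuous_at -(fg u Du); apply: cvg_trans cf.
    by apply: (near_eq_cvg (F := nbhs u)); apply: (near_open Du) => v Dv; rewrite fg.
  by move=> i; apply: near_eq_derivable (df i); apply: (near_open Du) => v Dv; rewrite fg.
- move=> f g _ IHf _ IHg u Du; have [cf df] := IHf u Du.
  have [cg dg] := IHg u Du; split; first exact: continuousD.
  by move=> i; exact: derivableD.
- move=> f g _ IHf _ IHg u Du; have [cf df] := IHf u Du.
  have [cg dg] := IHg u Du; split; first exact: continuousM.
  by move=> i; exact: derivableM.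
- move=> f _ IHf f0 u Du; have [cf df] := IHf u Du; split.
    by apply: continuousV => //; exact: f0.
  by move=> i; apply: derivableV => //; exact: f0.
Qed.

Lemma partialD_at i f g u : derivable f u (delta_mx 0 i) ->
  derivable g u (delta_mx 0 i) ->
  partial i (fun v => f v + g v) u = partial i f u + partial i g u.
Proof. by move=> df dg; exact: (deriveD df dg). Qed.

Lemma partialM_at i f g u : derivable f u (delta_mx 0 i) ->
  derivable g u (delta_mx 0 i) ->
  partial i (fun v => f v * g v) u = partial i f u * g u + f u * partial i g u.
Proof.
by move=> df dg; rewrite [LHS](deriveM df dg) [LHS]addrC; congr (_ + _); exact: mulrC.
Qed.

Lemma smooth_alg_partial h i : smooth_alg h -> smooth_alg (partial i h).
Proof.
elim=> {h}.
- by move=> h sh; apply/SmoothBase/smooth_partial.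
- by move=> f g _ sf fg; apply: SmoothExt sf _ => u; exact: partial_ext.
- move=> f g Af sf Ag sg; apply: (SmoothExt (SmoothAdd sf sg)) => u Du.
  by rewrite partialD_at //; [exact: (smooth_alg1 Af Du).2|
     exact: (smooth_alg1 Ag Du).2].
- move=> f g Af sf Ag sg.
  apply: (SmoothExt (SmoothAdd (SmoothMul sf Ag) (SmoothMul Af sg))) => u Du.
  by rewrite partialM_at //; [exact: (smooth_alg1 Af Du).2|
     exact: (smooth_alg1 Ag Du).2].
- move=> f Af sf f0; have Vf := SmoothInv Af f0.
  have sN := SmoothBase (smooth_cst (-1)).
  apply: (SmoothExt (SmoothMul sN (SmoothMul (SmoothMul Vf Vf) sf))) => u Du.
  rewrite /= [RHS]deriveV; [|exact: f0|exact: (smooth_alg1 Af Du).2].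
  by rewrite mulN1r -mulNr -exprVn expr2.
Qed.

Lemma smooth_algP h : smooth_alg h <-> smooth_on D h.
Proof.
split; last exact: SmoothBase.
move=> Ah s; apply: smooth_alg1.
by elim: s => //= i s IH; exact: smooth_alg_partial.
Qed.

Lemma smooth_ext f g :
  (forall u, D u -> f u = g u) -> smooth_on D f -> smooth_on D g.
Proof. by move=> fg /SmoothBase sf; apply/smooth_algP; exact: SmoothExt fg. Qed.

Lemma smoothD f g : smooth_on D f -> smooth_on D g ->
  smooth_on D (fun u => f u + g u).
Proof.
by move=> /SmoothBase sf /SmoothBase sg; apply/smooth_algP; exact: SmoothAdd.
Qed.

Lemma smoothM f g : smooth_on D f -> smooth_on D g ->
  smooth_on D (fun u => f u * g u).
Proof.
by move=> /SmoothBase sf /SmoothBase sg; apply/smooth_algP; exact: SmoothMul.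
Qed.

Lemma smoothV f : smooth_on D f -> (forall u, D u -> f u != 0) ->
  smooth_on D (fun u => (f u)^-1).
Proof. by move=> /SmoothBase sf f0; apply/smooth_algP; exact: SmoothInv. Qed.

Lemma smoothN f : smooth_on D f -> smooth_on D (fun u => - f u).
Proof.
move=> sf; apply: (smooth_ext _ (smoothM (smooth_cst (-1)) sf)) => u _.
by rewrite mulN1r.
Qed.

Lemma smoothB f g : smooth_on D f -> smooth_on D g ->
  smooth_on D (fun u => f u - g u).
Proof. by move=> sf sg; exact: smoothD sf (smoothN sg). Qed.

Lemma smooth_sum (I : Type) (r : seq I) (P : pred I) (F : I -> 'rV[R]_n -> R) :
  (forall k, P k -> smooth_on D (F k)) ->
  smooth_on D (fun u => \sum_(k <- r | P k) F k u).
Proof.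
move=> sF; elim: r => [|k r IH].
  by apply: smooth_ext (smooth_cst 0) => u _; rewrite big_nil.
have [Pk|nPk] := boolP (P k); last first.
  by apply: smooth_ext IH => u _; rewrite big_cons (negbTE nPk).
by apply: smooth_ext (smoothD (sF k Pk) IH) => u _; rewrite big_cons Pk.
Qed.

Lemma smooth_prod (I : Type) (r : seq I) (P : pred I) (F : I -> 'rV[R]_n -> R) :
  (forall k, P k -> smooth_on D (F k)) ->
  smooth_on D (fun u => \prod_(k <- r | P k) F k u).
Proof.
move=> sF; elim: r => [|k r IH].
  by apply: smooth_ext (smooth_cst 1) => u _; rewrite big_nil.
have [Pk|nPk] := boolP (P k); last first.
  by apply: smooth_ext IH => u _; rewrite big_cons (negbTE nPk).
by apply: smooth_ext (smoothM (sF k Pk) IH) => u _; rewrite big_cons Pk.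
Qed.

Lemma partialD i f g u : smooth_on D f -> smooth_on D g -> D u ->
  partial i (fun v => f v + g v) u = partial i f u + partial i g u.
Proof. by move=> sf sg Du; apply: partialD_at; exact: smooth_derivable. Qed.

Lemma partialM i f g u : smooth_on D f -> smooth_on D g -> D u ->
  partial i (fun v => f v * g v) u = partial i f u * g u + f u * partial i g u.
Proof. by move=> sf sg Du; apply: partialM_at; exact: smooth_derivable. Qed.

Lemma partial_cst i (c : R) u : partial i (fun=> c) u = 0.
Proof. exact: derive_cst. Qed.

Lemma partialN i f u : smooth_on D f -> D u ->
  partial i (fun v => - f v) u = - partial i f u.
Proof. by move=> sf Du; apply: deriveN; exact: smooth_derivable. Qed.

Lemma partialB i f g u : smooth_on D f -> smooth_on D g -> D u ->
  partial i (fun v => f v - g v) u = partial i f u - partial i g u.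
Proof.
by move=> sf sg Du; rewrite (partialD _ sf (smoothN sg) Du) (partialN _ sg Du).
Qed.

Lemma partial_sum i (I : Type) (r : seq I) (P : pred I)
    (F : I -> 'rV[R]_n -> R) u : (forall k, smooth_on D (F k)) -> D u ->
  partial i (fun v => \sum_(k <- r | P k) F k v) u =
  \sum_(k <- r | P k) partial i (F k) u.
Proof.
move=> sF Du; elim: r => [|k r IH].
  rewrite big_nil -[RHS](partial_cst i 0 u).
  by apply: eq_partial => v; rewrite big_nil.
rewrite big_cons -IH; case: ifPn => Pk.
  rewrite -(partialD _ (sF k) (smooth_sum _ (fun l _ => sF l)) Du).
  by apply: eq_partial => v; rewrite big_cons Pk.
by apply: eq_partial => v; rewrite big_cons (negbTE Pk).
Qed.

End SmoothFunctions.

Lemma smooth_sub {R : realType} {n : nat} (D E : set 'rV[R]_n) h :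
  (D `<=` E)%classic -> smooth_on E h -> smooth_on D h.
Proof. by move=> DE sh s u Du; exact/sh/DE. Qed.

Section MixedPartials.
Local Open Scope classical_set_scope.
Context {R : realType} {n : nat}.
Implicit Types (h : 'rV[R]_n -> R) (u v : 'rV[R]_n) (i j : 'I_n).

Lemma is_derive_line h x v (s : R) : derivable h (s *: v + x) v ->
  is_derive s 1 (fun t : R => h (t *: v + x)) ('D_v h (s *: v + x)).
Proof.
move=> dh.
have E : (fun k : R => k^-1 *: (((fun t : R => h (t *: v + x)) \o shift s)
    (k *: 1) - h (s *: v + x)))
  = (fun k : R => k^-1 *: ((h \o shift (s *: v + x)) (k *: v) - h (s *: v + x))).
  apply/funext => k /=; congr (_ *: (h _ - _)).
  by rewrite [k *: 1]mulr1 scalerDl addrA.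
by split; rewrite /derivable /derive E.
Qed.

Lemma MVT_line h x v (t : R) : 0 < t ->
  (forall s, 0 <= s <= t -> derivable h (s *: v + x) v) ->
  exists2 s, 0 < s < t & h (t *: v + x) - h x = 'D_v h (s *: v + x) * t.
Proof.
move=> t0 dh.
have [s|s|s] := @MVT R (fun s => h (s *: v + x)) (fun s => 'D_v h (s *: v + x))
   0 t t0.
- rewrite in_itv /= => /andP[s0 st]; apply: is_derive_line; apply: dh.
  by rewrite !ltW.
- apply: (@derivable_within_continuous _ _ (fun s => h (s *: v + x))).
  move=> z; rewrite in_itv /= => zt.
  by have [] := is_derive_line (dh z zt).
by rewrite in_itv /= scale0r add0r subr0; exists s.
Qed.

Variable D : set 'rV[R]_n.
Hypothesis oD : open D.

(** The left-hand side is symmetric in i and j, but the mean value theorem, used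
    along i and then along j, expresses it by the mixed derivative in that
    order. Exchanging i and j gives a value of the other mixed derivative. *)
Lemma second_difference h i j u (t : R) : smooth_on D h -> 0 < t ->
  (forall a b : R, 0 <= a <= t -> 0 <= b <= t ->
     D (a *: delta_mx 0 i + (b *: delta_mx 0 j + u))) ->
  exists a b, [/\ 0 <= a <= t, 0 <= b <= t &
    h (t *: delta_mx 0 i + (t *: delta_mx 0 j + u)) - h (t *: delta_mx 0 i + u)
    - (h (t *: delta_mx 0 j + u) - h u) =
    partial j (partial i h) (a *: delta_mx 0 i + (b *: delta_mx 0 j + u)) * t * t].
Proof.
set ei := delta_mx 0 i; set ej := delta_mx 0 j => sh t0 box.
have t00 : (0 : R) <= 0 <= t by apply/andP; split; rewrite // ltW.
pose k := fun v => h (v + t *: ej) - h v.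
have shiftE (a b : R) : a *: ei + (b *: ej + u) = (a *: ei + u) + b *: ej.
  by rewrite addrCA addrC.
have boxt (a : R) : 0 <= a <= t -> D (a *: ei + u + t *: ej).
  by move=> at_; rewrite -shiftE; apply: box; rewrite // (ltW t0) /=.
have box0 (a : R) : 0 <= a <= t -> D (a *: ei + u).
  by move=> at_; have := box a 0 at_ t00; rewrite scale0r add0r.
have dk (a : R) : 0 <= a <= t -> is_derive (a *: ei + u) ei k
   (partial i h (a *: ei + u + t *: ej) - partial i h (a *: ei + u)).
  move=> at_; apply: is_deriveB; last first.
    by apply: derivableP; apply: smooth_derivable sh _; exact: box0.
  have := smooth_derivable (i := i) sh (boxt a at_).
  have E : (fun k : R => k^-1 *: (((fun v => h (v + t *: ej)) \o
      shift (a *: ei + u)) (k *: ei) - h (a *: ei + u + t *: ej)))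
    = (fun k : R => k^-1 *: ((h \o shift (a *: ei + u + t *: ej)) (k *: ei)
         - h (a *: ei + u + t *: ej))).
    by apply/funext => r /=; congr (_ *: (h _ - _)); rewrite !addrA.
  by move=> dh; split; rewrite /derivable /partial /derive E.
have [a at_] := @MVT_line k u ei t t0 (fun a at_ => @ex_derive _ _ _ _ _ _ _ (dk a at_)).
have {}at_ : 0 <= a <= t by case/andP: at_ => a0 ta; rewrite !ltW.
rewrite (@derive_val _ _ _ _ _ _ _ (dk a at_)).
have [|b bt] := @MVT_line (partial i h) (a *: ei + u) ej t t0.
  move=> b bt; apply: smooth_derivable (smooth_partial i sh) _.
  by rewrite addrCA; exact: box.
have {}bt : 0 <= b <= t by case/andP: bt => b0 tb; rewrite !ltW.
move=> Eb Ek; exists a, b; split; [exact: at_|exact: bt|].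
have -> : a *: ei + (b *: ej + u) = b *: ej + (a *: ei + u) by rewrite addrCA.
have -> : partial j (partial i h) (b *: ej + (a *: ei + u)) * t =
    partial i h (a *: ei + u + t *: ej) - partial i h (a *: ei + u).
  by rewrite [_ + t *: ej]addrC Eb.
by rewrite -Ek /k shiftE [u + _]addrC.
Qed.

(** Schwarz: both mixed derivatives take a common value in every small square at
    u (up to moving the point inside the square), and both are continuous at u. *)
Lemma partialC h i j u : smooth_on D h -> D u ->
  partial i (partial j h) u = partial j (partial i h) u.
Proof.
move=> sh Du; pose ei : 'rV[R]_n := delta_mx 0 i; pose ej : 'rV[R]_n := delta_mx 0 j.
apply/eqP; rewrite -subr_eq0 -normr_le0; apply/ler_addgt0Pr => e e0.
rewrite add0r.
have sij := smooth_partial i (smooth_partial j sh).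
have sji := smooth_partial j (smooth_partial i sh).
have e20 : 0 < e / 2 by rewrite divr_gt0.
have /cvgrPdist_lt/(_ _ e20) Nij := smooth_continuous sij Du.
have /cvgrPdist_lt/(_ _ e20) Nji := smooth_continuous sji Du.
have ND : nbhs u D by apply: open_nbhs_nbhs.
have [d /= d0 dP] := (nbhs_ballP _ _).1 (filterI ND (filterI Nij Nji)).
pose M := `|ei| + `|ej| + 1.
have M0 : 0 < M by rewrite ltr_wpDl// addr_ge0.
(* This side length keeps the square inside the ball of radius d around u. *)
pose t := d / M / 2.
have t0 : 0 < t by rewrite !divr_gt0.
have box (a b : R) : 0 <= a <= t -> 0 <= b <= t -> ball u d (a *: ei + (b *: ej + u)).
  move=> /andP[a0 ta] /andP[b0 tb].
  rewrite -ball_normE /ball_ /= addrA opprD addrA addrAC subrr add0r normrN.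
  apply: le_lt_trans (ler_normD _ _) _; rewrite !normrZ !ger0_norm //.
  have -> : d = t * M + t * M by rewrite /t; field; rewrite gt_eqF.
  have tM0 : 0 < t * M by rewrite mulr_gt0.
  rewrite -[X in X < _]addr0; apply: ler_ltD => //.
  rewrite /M !mulrDr mulr1 -[X in X <= _]addr0; apply: lerD; last exact: ltW.
  by apply: lerD; apply: ler_wpM2r.
have [|a [b [at_ bt E1]]] := @second_difference h i j u t sh t0.
  by move=> a b at_ bt; have [] := dP _ (box a b at_ bt).
have [|b' [a' [bt' at' E2]]] := @second_difference h j i u t sh t0.
  by move=> b' a' bt' at'; have [] := dP _ (box a' b' at' bt'); rewrite [a' *: _ + _]addrCA.
have E : partial j (partial i h) (a *: ei + (b *: ej + u)) =
         partial i (partial j h) (a' *: ei + (b' *: ej + u)).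
  have tn0 : t != 0 by rewrite gt_eqF.
  apply: (mulIf tn0); apply: (mulIf tn0).
  have swap (A B B' Z : R) : A - B - (B' - Z) = A - B' - (B - Z) by ring.
  rewrite [a' *: ei + _]addrCA; apply: (etrans (esym E1)); apply: etrans E2.
  by rewrite swap [t *: delta_mx 0 i + (t *: delta_mx 0 j + u)]addrCA.
have [_ [_ /= P1]] := dP _ (box a b at_ bt).
have [_ [/= P2 _]] := dP _ (box a' b' at' bt').
have telescope (A B X Y : R) : X = Y -> A - B = (A - Y) - (B - X).
  by move=> ->; ring.
rewrite (telescope _ _ _ _ E).
apply: le_trans (ler_normB _ _) _.
have eE : e / 2 + e / 2 = e by rewrite -splitr.
by move: (lerD (ltW P2) (ltW P1)); rewrite eE.
Qed.

End MixedPartials.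

(** * Hermitian matrices and the tangent spaces of the projective space *)

Section ComplexParts.
Context {R : realType}.
Implicit Types x y : R[i].

Lemma Re_add x y : complex.Re (x + y) = complex.Re x + complex.Re y.
Proof. by case: x y => [? ?] [? ?]. Qed.
Lemma Re_opp x : complex.Re (- x) = - complex.Re x.
Proof. by case: x. Qed.
Lemma Im_add x y : complex.Im (x + y) = complex.Im x + complex.Im y.
Proof. by case: x y => [? ?] [? ?]. Qed.
Lemma Re_mul x y : complex.Re (x * y) =
  complex.Re x * complex.Re y - complex.Im x * complex.Im y.
Proof. by case: x y => [? ?] [? ?]. Qed.
Lemma Im_mul x y : complex.Im (x * y) =
  complex.Re x * complex.Im y + complex.Im x * complex.Re y.
Proof. by case: x y => [? ?] [? ?]. Qed.
Lemma Re_adj x : complex.Re (x^* )%R = complex.Re x.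
Proof. by case: x. Qed.
Lemma Im_adj x : complex.Im (x^* )%R = - complex.Im x.
Proof. by case: x. Qed.
Lemma Re_sum (I : Type) (r : seq I) (P : pred I) (F : I -> R[i]) :
  complex.Re (\sum_(i <- r | P i) F i) = \sum_(i <- r | P i) complex.Re (F i).
Proof. by elim/big_rec2: _ => // i x y _ <-; rewrite Re_add. Qed.
Lemma Im_sum (I : Type) (r : seq I) (P : pred I) (F : I -> R[i]) :
  complex.Im (\sum_(i <- r | P i) F i) = \sum_(i <- r | P i) complex.Im (F i).
Proof. by elim/big_rec2: _ => // i x y _ <-; rewrite Im_add. Qed.
Lemma complex_ext x y :
  complex.Re x = complex.Re y -> complex.Im x = complex.Im y -> x = y.
Proof. by case: x y => [? ?] [? ?] /= -> ->. Qed.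

Lemma two_complex : 2 = (2 : R)%:C :> R[i].
Proof. by rewrite (rmorph_nat (real_complex R) 2). Qed.

Lemma conj_real (a : R) : ((a%:C)^* )%R = a%:C :> R[i].
Proof. by apply: complex_ext; rewrite /= ?oppr0. Qed.

End ComplexParts.

Section Adjoint.
Context {R : realType}.
Local Notation C := R[i].

Lemma adjointM p q r (A : 'M[C]_(p, q)) (B : 'M[C]_(q, r)) :
  (A *m B) ^t* = B ^t* *m A ^t*.
Proof. by rewrite trmx_mul map_mxM. Qed.
Lemma adjointD p q (A B : 'M[C]_(p, q)) : (A + B) ^t* = A ^t* + B ^t*.
Proof. by rewrite linearD /= map_mxD. Qed.
Lemma adjointN p q (A : 'M[C]_(p, q)) : (- A) ^t* = - A ^t*.
Proof. by rewrite linearN /= map_mxN. Qed.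
Lemma adjointZ p q (a : C) (A : 'M[C]_(p, q)) : (a *: A) ^t* = (a^* )%R *: A ^t*.
Proof. by rewrite linearZ /= map_mxZ. Qed.

Definition hdot p (v w : 'cV[C]_p) : C := (v ^t* *m w) 0 0.

(** Products of rank-one matrices are computed by replacing each inner factor, a
    1 x 1 matrix, by this scalar. *)
Lemma hdotE p (v w : 'cV[C]_p) : v ^t* *m w = (hdot v w)%:M.
Proof. exact: mx11_scalar. Qed.

Lemma hdotC p (v w : 'cV[C]_p) : hdot w v = ((hdot v w)^* )%R.
Proof.
rewrite /hdot; have <- : (v ^t* *m w) ^t* = w ^t* *m v by rewrite adjointM trmxCK.
by rewrite !mxE.
Qed.

Lemma hdotZl p (a : C) (v w : 'cV[C]_p) : hdot (a *: v) w = (a^* )%R * hdot v w.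
Proof. by rewrite /hdot adjointZ -scalemxAl mxE. Qed.

Lemma hdotZr p (a : C) (v w : 'cV[C]_p) : hdot v (a *: w) = a * hdot v w.
Proof. by rewrite /hdot -scalemxAr mxE. Qed.

Lemma rank1M p q r (v : 'cV[C]_p) (w a : 'cV[C]_q) (b : 'rV[C]_r) :
  v *m w ^t* *m (a *m b) = hdot w a *: (v *m b).
Proof.
by rewrite mulmxA -[v *m _ *m a]mulmxA hdotE mul_mx_scalar -scalemxAl.
Qed.

Lemma rank1V p q (v : 'cV[C]_p) (w a : 'cV[C]_q) :
  v *m w ^t* *m a = hdot w a *: v.
Proof. by rewrite -mulmxA hdotE mul_mx_scalar. Qed.

Lemma hdotDr p (v w a : 'cV[C]_p) : hdot v (w + a) = hdot v w + hdot v a.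
Proof. by rewrite /hdot mulmxDr mxE. Qed.

Lemma hdotBr p (v w a : 'cV[C]_p) : hdot v (w - a) = hdot v w - hdot v a.
Proof. by rewrite /hdot mulmxBr !mxE. Qed.

Lemma mxtrace_rankl p (v w : 'cV[C]_p) (M : 'M[C]_p) :
  \tr (v *m w ^t* *m M) = hdot w (M *m v).
Proof.
by rewrite -mulmxA mxtrace_mulC -mulmxA hdotE mxtrace_scalar mulr1n.
Qed.

Lemma mxtrace_rank1 p (v w a b : 'cV[C]_p) :
  \tr (v *m w ^t* *m (a *m b ^t*)) = hdot w a * hdot b v.
Proof.
by rewrite rank1M mxtraceZ mxtrace_mulC hdotE mxtrace_scalar mulr1n.
Qed.

End Adjoint.

Section GFS.
Context {R : realType} {m : nat}.
Implicit Types X Y Z P : 'M[R[i]]_m.+1.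

Lemma gFSC X Y : gFS X Y = gFS Y X.
Proof. by rewrite /gFS mxtrace_mulC. Qed.
Lemma gFSDl X Y Z : gFS (X + Y) Z = gFS X Z + gFS Y Z.
Proof. by rewrite /gFS mulmxDl mxtraceD Re_add mulrDl. Qed.
Lemma gFSNl X Y : gFS (- X) Y = - gFS X Y.
Proof. by rewrite /gFS mulNmx raddfN Re_opp mulNr. Qed.
Lemma gFSBl X Y Z : gFS (X - Y) Z = gFS X Z - gFS Y Z.
Proof. by rewrite gFSDl gFSNl. Qed.
Lemma gFSZl (a : R) X Y : gFS (a%:C *: X) Y = a * gFS X Y.
Proof.
by rewrite /gFS -scalemxAl mxtraceZ Re_mul /= mul0r subr0 mulrA.
Qed.
Lemma gFS0l X : gFS 0 X = 0.
Proof. by rewrite /gFS mul0mx mxtrace0 mul0r. Qed.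
Lemma gFSDr X Y Z : gFS X (Y + Z) = gFS X Y + gFS X Z.
Proof. by rewrite gFSC gFSDl !(gFSC X). Qed.
Lemma gFSNr X Y : gFS X (- Y) = - gFS X Y.
Proof. by rewrite gFSC gFSNl gFSC. Qed.
Lemma gFSBr X Y Z : gFS X (Y - Z) = gFS X Y - gFS X Z.
Proof. by rewrite gFSDr gFSNr. Qed.
Lemma gFSZr (a : R) X Y : gFS X (a%:C *: Y) = a * gFS X Y.
Proof. by rewrite gFSC gFSZl gFSC. Qed.
Lemma gFS0r X : gFS X 0 = 0.
Proof. by rewrite gFSC gFS0l. Qed.
Lemma gFS_suml (I : Type) (r : seq I) (Q : pred I) (F : I -> 'M[R[i]]_m.+1) Y :
  gFS (\sum_(i <- r | Q i) F i) Y = \sum_(i <- r | Q i) gFS (F i) Y.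
Proof. exact: (big_morph (gFS^~ Y) (fun X Z => gFSDl X Z Y) (gFS0l Y)). Qed.
Lemma gFS_sumr (I : Type) (r : seq I) (Q : pred I) (F : I -> 'M[R[i]]_m.+1) Y :
  gFS Y (\sum_(i <- r | Q i) F i) = \sum_(i <- r | Q i) gFS Y (F i).
Proof. by rewrite gFSC gFS_suml; apply: eq_bigr => i _; rewrite gFSC. Qed.

(** Positivity fails for general matrices; for Hermitian X the factor X j i is
    the conjugate of X i j, which makes tr (X X) a sum of squared moduli. *)
Lemma gFS_herm X : X ^t* = X ->
  gFS X X = (\sum_i \sum_j
    (complex.Re (X i j) ^+ 2 + complex.Im (X i j) ^+ 2)) / 2.
Proof.
move=> hX; rewrite /gFS -[X in X *m _]trmxK -[X in X^T *m _]trmxK.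
rewrite /mxtrace Re_sum; congr (_ / 2); apply: eq_bigr => i _.
rewrite mxE Re_sum; apply: eq_bigr => j _.
have -> : X j i = ((X i j)^* )%R by rewrite -[in LHS]hX !mxE.
rewrite !trmxK Re_mul Re_adj Im_adj; ring.
Qed.

Lemma gFS_ge0 X : X ^t* = X -> 0 <= gFS X X.
Proof.
move=> /gFS_herm ->; rewrite divr_ge0// sumr_ge0// => i _.
by rewrite sumr_ge0// => j _; rewrite addr_ge0// sqr_ge0.
Qed.

Lemma gFS_eq0 X : X ^t* = X -> gFS X X = 0 -> X = 0.
Proof.
move=> hX; rewrite gFS_herm // => /eqP; rewrite mulf_eq0 invr_eq0 pnatr_eq0 orbF.
have sq0 i j : 0 <= complex.Re (X i j) ^+ 2 + complex.Im (X i j) ^+ 2.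
  by rewrite addr_ge0// sqr_ge0.
rewrite psumr_eq0 => [|i _]; last by rewrite sumr_ge0// => j _.
move=> /allP X0; apply/matrixP => i j; rewrite mxE.
have /implyP/(_ isT) := X0 i (mem_index_enum _).
rewrite psumr_eq0 // => /allP/(_ j (mem_index_enum _))/implyP/(_ isT).
rewrite paddr_eq0 ?sqr_ge0 // !sqrf_eq0 => /andP[/eqP r0 /eqP i0].
exact: complex_ext.
Qed.

End GFS.

Section Grading.
Context {R : realType} {m : nat}.
Variable P : 'M[R[i]]_m.+1.
Implicit Types X Y Z : 'M[R[i]]_m.+1.

(** Tangent vectors of CP^m at P anticommute with the involution 2 P - 1, and
    vectors normal to CP^m commute with it. Every orthogonality between tangent
    and normal parts used below comes from this grading: odd times even is odd,
    and odd matrices have trace zero. *)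
Definition oddCP X := X *m P + P *m X = X.
Definition evenCP X := X *m P = P *m X.

Hypothesis PP : P *m P = P.

Lemma oddPXP X : oddCP X -> P *m X *m P = 0.
Proof.
move=> oX; have := congr1 (fun Y => P *m Y *m P) oX.
rewrite mulmxDr mulmxDl !mulmxA -[P *m X *m P *m P]mulmxA PP => /eqP.
by rewrite -subr_eq0 addrK => /eqP.
Qed.

Lemma odd_mxtrace X : oddCP X -> \tr X = 0.
Proof.
move=> oX; have tr0 : \tr (P *m X) = 0.
  by rewrite -PP -mulmxA mxtrace_mulC oddPXP // mxtrace0.
by rewrite -oX mxtraceD [\tr (X *m P)]mxtrace_mulC tr0 addr0.
Qed.

Lemma oddM_even X Y : oddCP X -> oddCP Y -> evenCP (X *m Y).
Proof.
move=> oX oY; rewrite /evenCP.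
have E1 : X *m Y = X *m Y *m P + X *m P *m Y.
  by rewrite -[in LHS]oY mulmxDr !mulmxA.
have E2 : X *m Y = X *m P *m Y + P *m X *m Y.
  by rewrite -[in LHS]oX mulmxDl.
by apply: (addIr (X *m P *m Y)); rewrite -E1 mulmxA addrC.
Qed.

Lemma evenM_odd X Y : evenCP X -> oddCP Y -> oddCP (X *m Y).
Proof.
by move=> eX oY; rewrite /oddCP mulmxA -eX -!mulmxA -mulmxDr oY.
Qed.

Lemma evenCPD X Y : evenCP X -> evenCP Y -> evenCP (X + Y).
Proof. by rewrite /evenCP mulmxDl mulmxDr => -> ->. Qed.
Lemma evenCPN X : evenCP X -> evenCP (- X).
Proof. by rewrite /evenCP mulNmx mulmxN => ->. Qed.
Lemma evenCPZ (a : R[i]) X : evenCP X -> evenCP (a *: X).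
Proof. by rewrite /evenCP -scalemxAl -scalemxAr => ->. Qed.
Lemma oddCPD X Y : oddCP X -> oddCP Y -> oddCP (X + Y).
Proof. by rewrite /oddCP mulmxDl mulmxDr addrACA => -> ->. Qed.
Lemma oddCPN X : oddCP X -> oddCP (- X).
Proof. by rewrite /oddCP mulNmx mulmxN -opprD => ->. Qed.
Lemma oddCPZ (a : R[i]) X : oddCP X -> oddCP (a *: X).
Proof. by rewrite /oddCP -scalemxAl -scalemxAr -scalerDr => ->. Qed.
Lemma oddCP0 : oddCP 0.
Proof. by rewrite /oddCP mul0mx mulmx0 addr0. Qed.

Lemma gFS_even_odd X Y : evenCP X -> oddCP Y -> gFS X Y = 0.
Proof.
by move=> eX oY; rewrite /gFS odd_mxtrace ?mul0r //; exact: evenM_odd.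
Qed.

Lemma evenPZP Z : evenCP (P *m Z *m P).
Proof. by rewrite /evenCP -mulmxA PP !mulmxA PP. Qed.

Lemma gFS_projCP Z Y : oddCP Y -> gFS (projCP P Z) Y = gFS Z Y.
Proof.
move=> oY; rewrite /projCP two_complex.
rewrite gFSBl gFSZl (gFS_even_odd (evenPZP Z) oY) mulr0 subr0 gFSDl.
rewrite /gFS -mulrDl -Re_add -[P *m Z *m Y]mulmxA [\tr (P *m _)]mxtrace_mulC.
by rewrite -!mulmxA -mxtraceD -mulmxDr oY.
Qed.

(** The second fundamental form of CP^m in the Euclidean space of Hermitian
    matrices. *)
Definition sigmaCP X Y : 'M[R[i]]_m.+1 :=
  X *m Y + Y *m X - 2 *: (P *m (X *m Y + Y *m X) *m P).

Lemma sigma_even X Y : oddCP X -> oddCP Y -> evenCP (sigmaCP X Y).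
Proof.
move=> oX oY; apply: evenCPD; last exact: (evenCPN (evenCPZ _ (evenPZP _))).
exact: (evenCPD (oddM_even oX oY) (oddM_even oY oX)).
Qed.

Lemma Jcp_odd X : oddCP X -> oddCP (Jcp P X).
Proof.
move=> oX; apply: oddCPZ; rewrite /oddCP mulmxBl mulmxBr -mulmxA PP !mulmxA.
by rewrite PP oddPXP // sub0r subr0 addrC.
Qed.

Lemma Jcp_herm X : P ^t* = P -> X ^t* = X -> (Jcp P X) ^t* = Jcp P X.
Proof.
move=> hP hX; rewrite /Jcp adjointZ adjointD adjointN !adjointM hP hX.
have -> : ((0 +i* 1 : R[i])^* )%R = - (0 +i* 1).
  by apply: complex_ext; rewrite /= ?oppr0.
by rewrite scaleNr -scalerN opprB.
Qed.

Lemma Jcp_even X : evenCP X -> Jcp P X = 0.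
Proof. by rewrite /evenCP /Jcp => ->; rewrite subrr scaler0. Qed.

Lemma JcpD X Y : Jcp P (X + Y) = Jcp P X + Jcp P Y.
Proof. by rewrite /Jcp mulmxDl mulmxDr -scalerDr opprD addrACA. Qed.
Lemma JcpN X : Jcp P (- X) = - Jcp P X.
Proof. by rewrite /Jcp mulNmx mulmxN -scalerN opprB opprK addrC. Qed.
Lemma JcpZ (a : R[i]) X : Jcp P (a *: X) = a *: Jcp P X.
Proof. by rewrite /Jcp -scalemxAl -scalemxAr -scalerBr !scalerA mulrC. Qed.

End Grading.

Lemma gFS_JcpC (R : realType) m (P Y Z : 'M[R[i]]_m.+1) :
  gFS (Jcp P Y) Z = - gFS Y (Jcp P Z).
Proof.
rewrite /gFS /Jcp -scalemxAl -scalemxAr !mxtraceZ.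
have -> : \tr ((Y *m P - P *m Y) *m Z) = - \tr (Y *m (Z *m P - P *m Z)).
  have trB (U V : 'M[R[i]]_m.+1) : \tr (U - V) = \tr U - \tr V by exact: raddfB.
  rewrite mulmxBl mulmxBr !trB !mulmxA opprB; congr (_ - _).
  by rewrite [LHS]mxtrace_mulC mulmxA [LHS]mxtrace_mulC mulmxA.
by rewrite mulrN Re_opp mulNr.
Qed.

Lemma sigmaCP_herm (R : realType) m (P X Y : 'M[R[i]]_m.+1) :
  P ^t* = P -> X ^t* = X -> Y ^t* = Y -> (sigmaCP P X Y) ^t* = sigmaCP P X Y.
Proof.
move=> hP hX hY; have hE : (X *m Y + Y *m X) ^t* = X *m Y + Y *m X.
  by rewrite adjointD !adjointM hX hY addrC.
rewrite /sigmaCP two_complex adjointD adjointN adjointZ conj_real.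
by rewrite !adjointM hE hP mulmxA.
Qed.

(** When E = X T + T X comes from differentiating T P + P T = T, the subtracted
    term is sigmaCP P X T: the derivative of a tangent field is tangent up to
    the second fundamental form. *)
Lemma odd_sub_even (R : realType) m (P Z E : 'M[R[i]]_m.+1) :
  P *m P = P -> evenCP P E -> Z *m P + P *m Z + E = Z ->
  oddCP P (Z - (E - 2 *: (P *m E *m P))).
Proof.
move=> PP EE ZE; have EP : E *m P = P *m E by exact: EE.
set c := P *m E *m P; have cP : c *m P = c by rewrite /c -mulmxA PP.
have Pc : P *m c = c by rewrite /c !mulmxA PP.
have PE : P *m E = c by rewrite /c -mulmxA EP mulmxA PP.
have cc : c - 2 *: c = - c by rewrite scaler_nat mulr2n opprD addrA subrr sub0r.
rewrite /oddCP !mulmxBl !mulmxBr -scalemxAl -scalemxAr cP Pc EP PE cc !opprK.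
rewrite -[in RHS]ZE; move: (Z *m P) (P *m Z) => a b.
by rewrite addrACA scaler_nat mulr2n opprB -[RHS]addrA [E + _]addrC subrK.
Qed.

Section ComplexLine.
Context {R : realType} {m : nat}.
Local Notation C := R[i].
Implicit Types (P X Y Z W : 'M[C]_m.+1) (v w z : 'cV[C]_m.+1).

(** A nonzero column of P is fixed by P. Once it is normalized, the difference Q
    of P and the projector onto it is a Hermitian idempotent of trace 0, so that
    the norm of Q, which is the trace of Q Q = Q, vanishes. *)
Lemma CP_unit P : CP P -> exists z, P = z *m z ^t* /\ hdot z z = 1.
Proof.
case=> hP PP trP.
have [j Pj] : exists j, P j j != 0.
  apply/existsP; apply: contraT; rewrite negb_exists => /forallP P0.
  have : \tr P = 0 by apply: big1 => j _; have := P0 j; rewrite negbK => /eqP.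
  by rewrite trP => /eqP; rewrite oner_eq0.
pose v := col j P; pose p := hdot v v.
have pE : p = P j j.
  rewrite /p /hdot /v -[in RHS]PP !mxE; apply: eq_bigr => k _; rewrite !mxE.
  by congr (_ * _); rewrite -[in RHS]hP !mxE.
have p0 : 0 <= p.
  by rewrite /p /hdot mxE sumr_ge0 // => k _; rewrite !mxE mulrC mul_conjC_ge0.
pose s := sqrtC p.
have s2 : s * s = p by rewrite -expr2 sqrtCK.
have sn0 : s != 0 by rewrite sqrtC_eq0 pE.
have sVr : ((s^-1)^* )%R = s^-1 by rewrite geC0_conj // invr_ge0 sqrtC_ge0.
pose z := s^-1 *: v.
have zz : hdot z z = 1.
  by rewrite hdotZl hdotZr -/p -s2 sVr; field.
have Pz : P *m z = z by rewrite /z -scalemxAr /v colE mulmxA PP.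
have zP : z ^t* *m P = z ^t* by rewrite -[in LHS]hP -adjointM Pz.
exists z; split=> //.
pose Q := P - z *m z ^t*.
have hQ : Q ^t* = Q by rewrite adjointD adjointN adjointM trmxCK hP.
have QQ : Q *m Q = Q.
  rewrite /Q mulmxBl !mulmxBr PP mulmxA Pz -[z *m _ *m P]mulmxA zP.
  by rewrite -[z *m _ *m _]mulmxA [z ^t* *m _]mulmxA hdotE zz mul_scalar_mx
       scale1r subrr subr0.
have trQ : \tr Q = 0.
  by rewrite raddfB /= trP mxtrace_mulC hdotE zz mxtrace_scalar mulr1n subrr.
have /eqP : Q = 0 by apply: gFS_eq0 => //; rewrite /gFS QQ trQ mul0r.
by rewrite subr_eq0 => /eqP.
Qed.

Variables (P : 'M[C]_m.+1) (z : 'cV[C]_m.+1).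
Hypothesis PE : P = z *m z ^t*.
Hypothesis zz : hdot z z = 1.

Let zz1 : z ^t* *m z = 1%:M. Proof. by rewrite hdotE zz. Qed.

Let Pz : P *m z = z. Proof. by rewrite PE -mulmxA zz1 mulmx1. Qed.
Let PP : P *m P = P. Proof. by rewrite {2}PE mulmxA Pz -PE. Qed.

Lemma tangent_hdot0 X : tangentCP P X -> hdot z (X *m z) = 0.
Proof.
case=> hX oX; have := congr1 (fun Y => (z ^t* *m Y *m z) 0 0) (oddPXP PP oX).
rewrite /hdot {1 2}PE !mulmxA zz1 mul1mx -!mulmxA zz1 mulmx1 => ->.
by rewrite mul0mx mulmx0 mxE.
Qed.

Lemma tangent_hdot0' X : tangentCP P X -> hdot (X *m z) z = 0.
Proof. by move=> tX; rewrite hdotC tangent_hdot0 // rmorph0. Qed.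

(** With v = X z, tangent vectors become v z^* + z v^*. The metric becomes Re
    <v, w> and J becomes multiplication by i, so that identities between tangent
    vectors reduce to identities between complex numbers. *)
Lemma tangentE X : tangentCP P X ->
  X = X *m z *m z ^t* + z *m (X *m z) ^t*.
Proof.
case=> hX oX; rewrite adjointM hX -{1}oX.
by rewrite {1 2}PE !mulmxA.
Qed.

Lemma gFS_hdot X Y : tangentCP P X -> tangentCP P Y ->
  gFS X Y = complex.Re (hdot (X *m z) (Y *m z)).
Proof.
move=> tX tY; rewrite /gFS {1}(tangentE tX) {1}(tangentE tY).
move: (tangent_hdot0 tX) (tangent_hdot0 tY) (tangent_hdot0' tX) (tangent_hdot0' tY).
move: (X *m z) (Y *m z) => v w zv zw vz wz.
rewrite mulmxDl !mulmxDr !mxtraceD !mxtrace_rank1 zv zw vz wz zz.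
rewrite !mul0r !mul1r !mulr1 add0r addr0 [hdot w v]hdotC.
by rewrite Re_add Re_adj; field.
Qed.

Lemma Jcp_vec X : tangentCP P X -> Jcp P X *m z = 'i *: (X *m z).
Proof.
move=> tX; rewrite /Jcp -scalemxAl mulmxBl -mulmxA Pz -mulmxA PE -mulmxA.
by rewrite [z ^t* *m _]hdotE (tangent_hdot0 tX) mul_mx_scalar scale0r subr0.
Qed.

Lemma sigmaE X Y : tangentCP P X -> tangentCP P Y ->
  let v := X *m z in let w := Y *m z in
  sigmaCP P X Y = v *m w ^t* + w *m v ^t*
    - (hdot v w + hdot w v) *: (z *m z ^t*).
Proof.
move=> tX tY v w.
have prod (A B : 'M[C]_m.+1) : tangentCP P A -> tangentCP P B ->
    A *m B = A *m z *m (B *m z) ^t* + hdot (A *m z) (B *m z) *: P.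
  move=> tA tB; rewrite {1}(tangentE tA) {1}(tangentE tB).
  set a := A *m z; set b := B *m z.
  rewrite mulmxDl !mulmxDr !rank1M zz (tangent_hdot0 tB) (tangent_hdot0' tA).
  by rewrite !scale0r scale1r add0r addr0 -PE.
have PPP (a b : 'cV[C]_m.+1) : hdot z a = 0 -> P *m (a *m b ^t*) = 0.
  by move=> za; rewrite PE rank1M za scale0r.
have zv : hdot z v = 0 := tangent_hdot0 tX.
have zw : hdot z w = 0 := tangent_hdot0 tY.
rewrite /sigmaCP (prod _ _ tX tY) (prod _ _ tY tX) -/v -/w.
clearbody v w; move: (hdot v w) (hdot w v) => s t.
have P1 : P *m (v *m w ^t*) = 0 := PPP v w zv.
have P2 : P *m (w *m v ^t*) = 0 := PPP w v zw.
have -> : P *m (v *m w ^t* + s *: P + (w *m v ^t* + t *: P)) *m P = (s + t) *: P.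
  rewrite !mulmxDr P1 P2 !add0r -!scalemxAr PP mulmxDl -!scalemxAl PP.
  by rewrite scalerDl.
by rewrite -PE addrACA -scalerDl scaler_nat mulr2n opprD addrA addrK.
Qed.

Lemma gFS_sigma X Y Z W : tangentCP P X -> tangentCP P Y ->
  tangentCP P Z -> tangentCP P W ->
  let v := X *m z in let w := Y *m z in
  let a := Z *m z in let b := W *m z in
  gFS (sigmaCP P X Y) (sigmaCP P Z W) =
  complex.Re (hdot w a * hdot b v + hdot w b * hdot a v
     + hdot v a * hdot b w + hdot v b * hdot a w
     + (hdot v w + hdot w v) * (hdot a b + hdot b a)) / 2.
Proof.
move=> tX tY tZ tW v w a b; rewrite /gFS !sigmaE //= -/v -/w -/a -/b.
congr (complex.Re _ / 2).
move: (tangent_hdot0 tX) (tangent_hdot0 tY) (tangent_hdot0' tZ)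
  (tangent_hdot0' tW) (tangent_hdot0 tZ) (tangent_hdot0 tW).
rewrite -/v -/w -/a -/b; clearbody v w a b => zv zw az bz za zb.
move: (hdot v w + hdot w v) (hdot a b + hdot b a) => s t.
set M := a *m b ^t* + b *m a ^t* - t *: (z *m z ^t*).
have trM x y : \tr (x *m y ^t* *m M) =
    hdot b x * hdot y a + hdot a x * hdot y b - t * hdot z x * hdot y z.
  by rewrite mxtrace_rankl mulmxBl mulmxDl -scalemxAl !rank1V scalerA
       hdotBr hdotDr !hdotZr.
rewrite mulmxBl mulmxDl -scalemxAl raddfB /= mxtraceD mxtraceZ !trM.
by rewrite zv zw az bz za zb zz; ring.
Qed.

(** The left-hand side is the curvature tensor of CP^m by the Gauss equation of
    CP^m in the Hermitian matrices, and the right-hand side that of constant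
    holomorphic sectional curvature 4. By gFS_sigma both sides are polynomials
    in the six Hermitian products of the vectors X z, Y z, Z z and W z. *)
Lemma curvature_identity X Y Z W : tangentCP P X -> tangentCP P Y ->
  tangentCP P Z -> tangentCP P W ->
  gFS (sigmaCP P Y Z) (sigmaCP P X W) - gFS (sigmaCP P X Z) (sigmaCP P Y W) =
  gFS Y Z * gFS X W - gFS X Z * gFS Y W
  + gFS (Jcp P Y) Z * gFS (Jcp P X) W - gFS (Jcp P X) Z * gFS (Jcp P Y) W
  - 2 * gFS (Jcp P X) Y * gFS (Jcp P Z) W.
Proof.
move=> tX tY tZ tW.
have hP : P ^t* = P by rewrite PE adjointM trmxCK.
have tJ A : tangentCP P A -> tangentCP P (Jcp P A).
  by case=> hA oA; split; [exact: Jcp_herm|exact: Jcp_odd].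
have gJ A B : tangentCP P A -> tangentCP P B ->
    gFS (Jcp P A) B = complex.Im (hdot (A *m z) (B *m z)).
  move=> tA tB; rewrite (gFS_hdot (tJ _ tA) tB) (Jcp_vec tA) hdotZl conjCi.
  by rewrite -complexiE mulNr Re_opp Re_mul /= mul0r mul1r sub0r opprK.
apply: (etrans (congr2 (fun x y : R => x - y) (gFS_sigma tY tZ tX tW)
  (gFS_sigma tX tZ tY tW))) => /=.
rewrite (gJ _ _ tY tZ) (gJ _ _ tX tW) (gJ _ _ tX tZ) (gJ _ _ tY tW).
rewrite (gJ _ _ tX tY) (gJ _ _ tZ tW).
rewrite (gFS_hdot tY tZ) (gFS_hdot tX tW) (gFS_hdot tX tZ) (gFS_hdot tY tW).
move: (X *m z) (Y *m z) (Z *m z) (W *m z) => v w a b.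
rewrite (hdotC v w) (hdotC v a) (hdotC v b) (hdotC w a) (hdotC w b) (hdotC a b).
move: (hdot v w) (hdot v a) (hdot v b) (hdot w a) (hdot w b) (hdot a b).
move=> c1 c2 c3 c4 c5 c6; rewrite !(Re_add, Re_mul, Im_add, Im_mul, Re_adj, Im_adj).
move: (complex.Re c1) (complex.Re c2) (complex.Re c3) (complex.Re c4)
  (complex.Re c5) (complex.Re c6) (complex.Im c1) (complex.Im c2)
  (complex.Im c3) (complex.Im c4) (complex.Im c5) (complex.Im c6) => *.
by field.
Qed.

End ComplexLine.

Lemma curvature_identity_CP (R : realType) m (P X Y Z W : 'M[R[i]]_m.+1) :
  CP P -> tangentCP P X -> tangentCP P Y -> tangentCP P Z -> tangentCP P W ->
  gFS (sigmaCP P Y Z) (sigmaCP P X W) - gFS (sigmaCP P X Z) (sigmaCP P Y W) =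
  gFS Y Z * gFS X W - gFS X Z * gFS Y W
  + gFS (Jcp P Y) Z * gFS (Jcp P X) W - gFS (Jcp P X) Z * gFS (Jcp P Y) W
  - 2 * gFS (Jcp P X) Y * gFS (Jcp P Z) W.
Proof.
by move=> /CP_unit[z [PE zz]] tX tY tZ tW; exact: (curvature_identity PE zz tX tY tZ tW).
Qed.

Section Completeness.
Context {R : realType} {m : nat}.
Local Notation C := R[i].
Implicit Types (P X Y : 'M[C]_m.+1).

Definition realify p (v : 'cV[C]_p) : 'rV[R]_(p + p) :=
  row_mx (map_mx (@complex.Re R) v)^T (map_mx (@complex.Im R) v)^T.

Lemma realify_dot p (v w : 'cV[C]_p) :
  (realify v *m (realify w)^T) 0 0 = complex.Re (hdot v w).
Proof.
rewrite /realify /hdot tr_row_mx mul_row_col !mxE Re_sum -big_split /=.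
by apply: eq_bigr => k _; rewrite !mxE Re_mul Re_adj Im_adj; ring.
Qed.

Lemma realify_inj p (v : 'cV[C]_p) : realify v = 0 -> v = 0.
Proof.
rewrite /realify -row_mx0 => /eq_row_mx[/rowP r0 /rowP i0].
apply/colP => k; have := r0 k; have := i0 k; rewrite !mxE => ii rr.
exact: complex_ext.
Qed.

Lemma realifyD p (v w : 'cV[C]_p) : realify (v + w) = realify v + realify w.
Proof.
rewrite /realify add_row_mx; congr row_mx; apply/rowP => k;
by rewrite !mxE ?Re_add ?Im_add.
Qed.

Lemma realifyZ p (a : R) (v : 'cV[C]_p) : realify (a%:C *: v) = a *: realify v.
Proof.
rewrite /realify scale_row_mx; congr row_mx; apply/rowP => k;
by rewrite !mxE ?Re_mul ?Im_mul /= mul0r ?subr0 ?addr0.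
Qed.

Lemma realify0 p : realify (0 : 'cV[C]_p) = 0.
Proof.
rewrite /realify -row_mx0; congr row_mx; apply/rowP => k; by rewrite !mxE.
Qed.

Lemma realify_sum p n (v : 'I_n -> 'cV[C]_p) :
  realify (\sum_i v i) = \sum_i realify (v i).
Proof. exact: (big_morph (@realify p) (@realifyD p) (@realify0 p)). Qed.

Lemma tangentCP_sum P n (c : 'I_n -> R) (T : 'I_n -> 'M[C]_m.+1) :
  P *m P = P -> (forall k, tangentCP P (T k)) ->
  tangentCP P (\sum_k (c k)%:C *: T k).
Proof.
move=> PP tT; elim/big_rec: _ => [|k X _ [hX oX]].
  by split; [rewrite trmx0 map_mx0|exact: oddCP0].
have [hT oT] := tT k; split; last exact: (oddCPD (oddCPZ (c k)%:C oT) oX).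
rewrite adjointD adjointZ hX hT; congr (_ *: _ + _).
by apply: complex_ext; rewrite /= ?oppr0.
Qed.

(** Dimension count. The vectors T k z, z and i z give 2 m + 2 independent rows
    in R^(2 m + 2); the vector X z is orthogonal to all of them, hence zero, and
    X is determined by X z. *)
Lemma tangentCP_complete P n (T : 'I_n -> 'M[C]_m.+1) X :
  CP P -> n = m.*2 -> (forall k, tangentCP P (T k)) ->
  (forall c : 'I_n -> R, \sum_k (c k)%:C *: T k = 0 -> forall k, c k = 0) ->
  tangentCP P X -> (forall k, gFS (T k) X = 0) -> X = 0.
Proof.
move=> cP nE tT freeT tX TX0.
have PP : P *m P = P by case: cP.
have [z [PE zz]] := CP_unit cP.
pose iz := 'i *: z.
pose M := col_mx (\matrix_(k < n) realify (T k *m z))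
                 (col_mx (realify z) (realify iz)).
have M_dot (w : 'cV[C]_m.+1) : hdot z w = 0 ->
    (forall k, complex.Re (hdot (T k *m z) w) = 0) -> M *m (realify w)^T = 0.
  move=> zw Tw; rewrite /M !mul_col_mx.
  have -> : (\matrix_(k < n) realify (T k *m z)) *m (realify w)^T = 0.
    apply/colP => k; rewrite [RHS]mxE -(Tw k) -realify_dot !mxE.
    by apply: eq_bigr => l _; rewrite !mxE.
  rewrite [realify z *m _]mx11_scalar realify_dot zw.
  rewrite [realify iz *m _]mx11_scalar realify_dot hdotZl zw mulr0 /=.
  by rewrite !raddf0 !col_mx0.
have hdot0 (w : 'cV[C]_m.+1) : hdot w 0 = 0 by rewrite /hdot mulmx0 mxE.
have indepM (a : 'rV[R]_n) (b1 b2 : 'rV[R]_1) :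
    row_mx a (row_mx b1 b2) *m M = 0 -> row_mx a (row_mx b1 b2) = 0.
  move=> cM.
  have combo : (\sum_k (a 0 k)%:C *: T k) *m z + (b1 0 0)%:C *: z
      + (b2 0 0)%:C *: iz = 0.
    apply: realify_inj; rewrite !realifyD !realifyZ mulmx_suml realify_sum.
    rewrite -[RHS]cM /M !mul_row_col -addrA; congr (_ + (_ + _)).
    - rewrite mulmx_sum_row; apply: eq_bigr => k _.
      by rewrite -scalemxAl realifyZ rowK.
    - by rewrite [b1]mx11_scalar mul_scalar_mx !mxE.
    - by rewrite [b2]mx11_scalar mul_scalar_mx !mxE.
  have tS := tangentCP_sum (fun k => a 0 k) PP tT.
  have := congr1 (hdot z) combo; rewrite !hdotDr !hdotZr zz hdot0.
  rewrite (tangent_hdot0 PE zz tS) add0r !mulr1 -complexiE => b0.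
  have b10 : b1 0 0 = 0.
    have := congr1 (@complex.Re R) b0.
    by rewrite Re_add Re_mul /= !mul0r mulr0 !(subr0, addr0).
  have b20 : b2 0 0 = 0.
    have := congr1 (@complex.Im R) b0.
    by rewrite Im_add Im_mul /= mul0r mulr1 !(add0r, addr0).
  have S0 : \sum_k (a 0 k)%:C *: T k = 0.
    move: combo; rewrite b10 b20 !scale0r !addr0 => Sz.
    by rewrite (tangentE PE tS) Sz trmx0 map_mx0 mul0mx mulmx0 addr0.
  have a0 : a = 0 by apply/rowP => k; rewrite mxE (freeT _ S0).
  rewrite a0 [b1]mx11_scalar [b2]mx11_scalar b10 b20.
  by rewrite !raddf0 !row_mx0.
have freeM : kermx M == 0.
  apply/eqP/row_matrixP => r; rewrite row0.
  have := sub_kermxP (row_sub r (kermx M)).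
  rewrite -[row r _]hsubmxK -[rsubmx _]hsubmxK; exact: indepM.
have fullM : row_full M.
  rewrite /row_full; have := freeM; rewrite kermx_eq0 /row_free => /eqP ->.
  by apply/eqP; rewrite nE -addnn; lia.
have [B BM] := row_fullP fullM.
have Xz : X *m z = 0.
  apply: realify_inj; apply: trmx_inj.
  rewrite -[LHS]mul1mx -BM -mulmxA M_dot ?mulmx0 ?trmx0 //.
    exact: tangent_hdot0 PE zz _ tX.
  by move=> k; rewrite -(gFS_hdot PE zz (tT k) tX) TX0.
by rewrite (tangentE PE tX) Xz trmx0 map_mx0 mul0mx mulmx0 addr0.
Qed.

End Completeness.

(** * Calculus of matrix-valued functions *)

Section ComplexCalculus.
Context {R : realType} {n : nat}.
Variable D : set 'rV[R]_n.
Hypothesis oD : open D.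
Implicit Types (f g : 'rV[R]_n -> R[i]) (u : 'rV[R]_n) (i j : 'I_n).

Definition csmooth f :=
  smooth_on D (fun v => complex.Re (f v)) /\
  smooth_on D (fun v => complex.Im (f v)).

Definition cpartial i f u : R[i] :=
  partial i (fun v => complex.Re (f v)) u +i*
  partial i (fun v => complex.Im (f v)) u.

Lemma csmoothD f g : csmooth f -> csmooth g -> csmooth (fun v => f v + g v).
Proof.
move=> [fr fi] [gr gi]; split.
  by apply: (smooth_ext oD _ (smoothD oD fr gr)) => v _; rewrite Re_add.
by apply: (smooth_ext oD _ (smoothD oD fi gi)) => v _; rewrite Im_add.
Qed.

Lemma csmoothM f g : csmooth f -> csmooth g -> csmooth (fun v => f v * g v).
Proof.
move=> [fr fi] [gr gi]; split.
  apply: (smooth_ext oD _ (smoothB oD (smoothM oD fr gr) (smoothM oD fi gi))).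
  by move=> v _; rewrite Re_mul.
apply: (smooth_ext oD _ (smoothD oD (smoothM oD fr gi) (smoothM oD fi gr))).
by move=> v _; rewrite Im_mul.
Qed.

Lemma csmooth_cst (c : R[i]) : csmooth (fun=> c).
Proof. by split; exact: smooth_cst. Qed.

Lemma csmooth_real (h : 'rV[R]_n -> R) :
  smooth_on D h -> csmooth (fun v => (h v)%:C).
Proof. by move=> sh; split; [exact: sh|exact: smooth_cst]. Qed.

Lemma csmooth_sum (I : Type) (r : seq I) (P : pred I)
    (f : I -> 'rV[R]_n -> R[i]) :
  (forall k, csmooth (f k)) -> csmooth (fun v => \sum_(k <- r | P k) f k v).
Proof.
move=> sf; split.
  have s1 := smooth_sum oD r (fun k (_ : P k) => (sf k).1).
  by apply: (smooth_ext oD _ s1) => v _; rewrite Re_sum.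
have s2 := smooth_sum oD r (fun k (_ : P k) => (sf k).2).
by apply: (smooth_ext oD _ s2) => v _; rewrite Im_sum.
Qed.

Lemma csmooth_partial i f : csmooth f -> csmooth (cpartial i f).
Proof. by case=> fr fi; split; exact: smooth_partial. Qed.

Lemma eq_cpartial i f g u : f =1 g -> cpartial i f u = cpartial i g u.
Proof. by move=> /funext ->. Qed.

Lemma cpartial_ext i f g u :
  (forall v, D v -> f v = g v) -> D u -> cpartial i f u = cpartial i g u.
Proof.
move=> fg Du; congr (_ +i* _).
  by apply: (partial_ext oD) => // v Dv; rewrite fg.
by apply: (partial_ext oD) => // v Dv; rewrite fg.
Qed.

Lemma cpartialD i f g u : csmooth f -> csmooth g -> D u ->
  cpartial i (fun v => f v + g v) u = cpartial i f u + cpartial i g u.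
Proof.
move=> [fr fi] [gr gi] Du; apply: complex_ext; rewrite ?Re_add ?Im_add /=.
  rewrite -(partialD _ fr gr Du); apply: eq_partial => v; exact: Re_add.
rewrite -(partialD _ fi gi Du); apply: eq_partial => v; exact: Im_add.
Qed.

Lemma cpartialM i f g u : csmooth f -> csmooth g -> D u ->
  cpartial i (fun v => f v * g v) u = cpartial i f u * g u + f u * cpartial i g u.
Proof.
move=> [fr fi] [gr gi] Du.
apply: complex_ext; rewrite ?(Re_add, Im_add) ?(Re_mul, Im_mul) /=.
  rewrite (eq_partial _ _ (fun v => Re_mul (f v) (g v))).
  rewrite (partialB oD _ (smoothM oD fr gr) (smoothM oD fi gi) Du).
  rewrite (partialM _ fr gr Du) (partialM _ fi gi Du); ring.
rewrite (eq_partial _ _ (fun v => Im_mul (f v) (g v))).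
rewrite (partialD _ (smoothM oD fr gi) (smoothM oD fi gr) Du).
rewrite (partialM _ fr gi Du) (partialM _ fi gr Du); ring.
Qed.

Lemma cpartial_cst i (c : R[i]) u : cpartial i (fun=> c) u = 0.
Proof. by apply: complex_ext; rewrite /= partial_cst. Qed.

Lemma cpartial_conj i f u : csmooth f -> D u ->
  cpartial i (fun v => ((f v)^* )%R) u = ((cpartial i f u)^* )%R.
Proof.
move=> [fr fi] Du; apply: complex_ext; rewrite ?Re_adj ?Im_adj /=.
  by apply: eq_partial => v; rewrite Re_adj.
rewrite -(partialN _ fi Du); apply: eq_partial => v; exact: Im_adj.
Qed.

Lemma cpartial_sum i (I : Type) (r : seq I) (f : I -> 'rV[R]_n -> R[i]) u :
  (forall k, csmooth (f k)) -> D u ->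
  cpartial i (fun v => \sum_(k <- r) f k v) u = \sum_(k <- r) cpartial i (f k) u.
Proof.
move=> sf Du; apply: complex_ext; rewrite ?(Re_sum, Im_sum) /=.
  rewrite (eq_partial _ _ (fun v => Re_sum r _ (fun k => f k v))).
  exact: (partial_sum oD _ r _ (fun k => (sf k).1) Du).
rewrite (eq_partial _ _ (fun v => Im_sum r _ (fun k => f k v))).
exact: (partial_sum oD _ r _ (fun k => (sf k).2) Du).
Qed.

Lemma cpartialC i j f u : csmooth f -> D u ->
  cpartial i (cpartial j f) u = cpartial j (cpartial i f) u.
Proof.
move=> [fr fi] Du; apply: complex_ext => /=.
  exact: (partialC oD _ _ fr Du).
exact: (partialC oD _ _ fi Du).
Qed.

End ComplexCalculus.

Section MatrixCalculus.
Context {R : realType} {n p : nat}.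
Variable D : set 'rV[R]_n.
Hypothesis oD : open D.
Local Notation mxfun := ('rV[R]_n -> 'M[R[i]]_p).
Implicit Types (F G : mxfun) (u : 'rV[R]_n) (i j : 'I_n).

Lemma partial_mxE i F u a b :
  partial_mx i F u a b = cpartial i (fun v => F v a b) u.
Proof. by rewrite mxE. Qed.

Lemma smooth_mx_partial i F : smooth_mx_on D F -> smooth_mx_on D (partial_mx i F).
Proof.
move=> sF a b; have [fr fi] := csmooth_partial i (sF a b).
by split; [apply: (smooth_ext oD _ fr)|apply: (smooth_ext oD _ fi)] => v _;
  rewrite mxE.
Qed.

Lemma smooth_mx_ext F G : (forall v, D v -> F v = G v) ->
  smooth_mx_on D F -> smooth_mx_on D G.
Proof.
move=> FG sF a b; have [fr fi] := sF a b.
by split; [apply: (smooth_ext oD _ fr)|apply: (smooth_ext oD _ fi)] => v Dv;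
  rewrite FG.
Qed.

Lemma smooth_mxD F G : smooth_mx_on D F -> smooth_mx_on D G ->
  smooth_mx_on D (fun v => F v + G v).
Proof.
move=> sF sG a b; have [fr fi] := csmoothD oD (sF a b) (sG a b).
by split; [apply: (smooth_ext oD _ fr)|apply: (smooth_ext oD _ fi)] => v _;
  rewrite mxE.
Qed.

Lemma smooth_mxM F G : smooth_mx_on D F -> smooth_mx_on D G ->
  smooth_mx_on D (fun v => F v *m G v).
Proof.
move=> sF sG a b.
have [fr fi] := csmooth_sum oD (index_enum _) xpredT
  (fun k => csmoothM oD (sF a k) (sG k b)).
by split; [apply: (smooth_ext oD _ fr)|apply: (smooth_ext oD _ fi)] => v _;
  rewrite mxE.
Qed.

Lemma smooth_mxZ (h : 'rV[R]_n -> R) F : smooth_on D h -> smooth_mx_on D F ->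
  smooth_mx_on D (fun v => (h v)%:C *: F v).
Proof.
move=> sh sF a b; have [fr fi] := csmoothM oD (csmooth_real sh) (sF a b).
by split; [apply: (smooth_ext oD _ fr)|apply: (smooth_ext oD _ fi)] => v _;
  rewrite mxE.
Qed.

Lemma smooth_mxcZ (c : R[i]) F : smooth_mx_on D F ->
  smooth_mx_on D (fun v => c *: F v).
Proof.
move=> sF a b; have [fr fi] := csmoothM oD (csmooth_cst D c) (sF a b).
by split; [apply: (smooth_ext oD _ fr)|apply: (smooth_ext oD _ fi)] => v _;
  rewrite mxE.
Qed.

Lemma smooth_mxN F : smooth_mx_on D F -> smooth_mx_on D (fun v => - F v).
Proof.
by move=> /(smooth_mxcZ (-1)); apply: smooth_mx_ext => v _; rewrite scaleN1r.
Qed.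

Lemma smooth_mxB F G : smooth_mx_on D F -> smooth_mx_on D G ->
  smooth_mx_on D (fun v => F v - G v).
Proof. by move=> sF sG; exact: smooth_mxD sF (smooth_mxN sG). Qed.

Lemma smooth_mx_sum (I : Type) (r : seq I) (F : I -> mxfun) :
  (forall k, smooth_mx_on D (F k)) ->
  smooth_mx_on D (fun v => \sum_(k <- r) F k v).
Proof.
move=> sF a b.
have [fr fi] := csmooth_sum oD r xpredT (fun k => sF k a b).
by split; [apply: (smooth_ext oD _ fr)|apply: (smooth_ext oD _ fi)] => v _;
  rewrite summxE.
Qed.

Lemma partial_mx_ext i F G u :
  (forall v, D v -> F v = G v) -> D u -> partial_mx i F u = partial_mx i G u.
Proof.
move=> FG Du; apply/matrixP => a b; rewrite !partial_mxE.
by apply: (cpartial_ext oD) => // v Dv; rewrite FG.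
Qed.

Lemma eq_partial_mx i F G u : F =1 G -> partial_mx i F u = partial_mx i G u.
Proof. by move=> /funext ->. Qed.

Lemma partial_mxD i F G u : smooth_mx_on D F -> smooth_mx_on D G -> D u ->
  partial_mx i (fun v => F v + G v) u = partial_mx i F u + partial_mx i G u.
Proof.
move=> sF sG Du; apply/matrixP => a b; rewrite [RHS]mxE !partial_mxE.
rewrite -(cpartialD _ (sF a b) (sG a b) Du).
by apply: eq_cpartial => v; rewrite mxE.
Qed.

Lemma partial_mxM i F G u : smooth_mx_on D F -> smooth_mx_on D G -> D u ->
  partial_mx i (fun v => F v *m G v) u =
  partial_mx i F u *m G u + F u *m partial_mx i G u.
Proof.
move=> sF sG Du; apply/matrixP => a b; rewrite [RHS]mxE !mxE -big_split /=.
rewrite -[LHS](_ : cpartial i (fun v => \sum_k F v a k * G v k b) u = _); last first.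
  by apply: eq_cpartial => v; rewrite mxE.
rewrite (cpartial_sum oD _ _ (fun k => csmoothM oD (sF a k) (sG k b)) Du).
apply: eq_bigr => k _.
by rewrite (cpartialM oD _ (sF a k) (sG k b) Du) !partial_mxE.
Qed.

Lemma partial_mxZ i (h : 'rV[R]_n -> R) F u :
  smooth_on D h -> smooth_mx_on D F -> D u ->
  partial_mx i (fun v => (h v)%:C *: F v) u =
  (partial i h u)%:C *: F u + (h u)%:C *: partial_mx i F u.
Proof.
move=> sh sF Du; apply/matrixP => a b; rewrite ![in RHS]mxE !partial_mxE.
have -> : (partial i h u)%:C = cpartial i (fun v => (h v)%:C) u.
  by apply: complex_ext; rewrite //= partial_cst.
rewrite -[RHS](cpartialM oD _ (csmooth_real sh) (sF a b) Du).
by apply: eq_cpartial => v; rewrite mxE.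
Qed.

Lemma partial_mxcZ i (c : R[i]) F u : smooth_mx_on D F -> D u ->
  partial_mx i (fun v => c *: F v) u = c *: partial_mx i F u.
Proof.
move=> sF Du; apply/matrixP => a b; rewrite [in RHS]mxE !partial_mxE.
rewrite -[RHS]add0r -[X in X + _](mul0r (F u a b)) -(cpartial_cst i c u).
rewrite -(cpartialM oD _ (csmooth_cst D c) (sF a b) Du).
by apply: eq_cpartial => v; rewrite mxE.
Qed.

Lemma partial_mxN i F u : smooth_mx_on D F -> D u ->
  partial_mx i (fun v => - F v) u = - partial_mx i F u.
Proof.
move=> sF Du; rewrite -scaleN1r -(partial_mxcZ _ _ sF Du).
by apply: eq_partial_mx => v; rewrite scaleN1r.
Qed.

Lemma partial_mx_sum i (I : Type) (r : seq I) (F : I -> mxfun) u :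
  (forall k, smooth_mx_on D (F k)) -> D u ->
  partial_mx i (fun v => \sum_(k <- r) F k v) u =
  \sum_(k <- r) partial_mx i (F k) u.
Proof.
move=> sF Du; apply/matrixP => a b; rewrite summxE partial_mxE.
transitivity (cpartial i (fun v => \sum_(k <- r) F k v a b) u).
  by apply: eq_cpartial => v; rewrite summxE.
rewrite (cpartial_sum oD _ _ (fun k => sF k a b) Du).
by apply: eq_bigr => k _; rewrite partial_mxE.
Qed.

Lemma partial_mx_adjoint i F u : smooth_mx_on D F -> D u ->
  (partial_mx i F u) ^t* = partial_mx i (fun v => (F v) ^t*) u.
Proof.
move=> sF Du; apply/matrixP => a b; rewrite !mxE.
rewrite -[LHS](cpartial_conj _ (sF b a) Du).
by apply: eq_cpartial => v; rewrite !mxE.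
Qed.

Lemma partial_mxC i j F u : smooth_mx_on D F -> D u ->
  partial_mx i (partial_mx j F) u = partial_mx j (partial_mx i F) u.
Proof.
move=> sF Du; apply/matrixP => a b; rewrite [LHS]partial_mxE [RHS]partial_mxE.
transitivity (cpartial i (cpartial j (fun v => F v a b)) u).
  by apply: eq_cpartial => v; rewrite mxE.
rewrite (cpartialC oD _ _ (sF a b) Du).
by apply: eq_cpartial => v; rewrite mxE.
Qed.

End MatrixCalculus.

Section Directional.
Context {R : realType} {n m : nat}.
Variable D : set 'rV[R]_n.
Hypothesis oD : open D.
Local Notation mxfun := ('rV[R]_n -> 'M[R[i]]_m.+1).
Implicit Types (F G : mxfun) (u X : 'rV[R]_n) (i j : 'I_n).
Implicit Types (f g h : 'rV[R]_n -> R).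

Definition dir X h u : R := \sum_i X 0 i * partial i h u.

Lemma smooth_gFS F G : smooth_mx_on D F -> smooth_mx_on D G ->
  smooth_on D (fun v => gFS (F v) (G v)).
Proof.
move=> sF sG; have sP := smooth_mxM oD sF sG.
have s1 : smooth_on D (fun v => \sum_k complex.Re ((F v *m G v) k k)).
  by apply: (smooth_sum oD) => k _; exact: (sP k k).1.
have s2 := smoothM oD s1 (@smooth_cst R n D (2^-1 : R)).
by apply: (smooth_ext oD _ s2) => v _; rewrite /gFS /mxtrace Re_sum.
Qed.

Lemma partial_gFS i F G u : smooth_mx_on D F -> smooth_mx_on D G -> D u ->
  partial i (fun v => gFS (F v) (G v)) u =
  gFS (partial_mx i F u) (G u) + gFS (F u) (partial_mx i G u).
Proof.
move=> sF sG Du.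
have sP := smooth_mxM oD sF sG.
have s1 : smooth_on D (fun v => \sum_k complex.Re ((F v *m G v) k k)).
  by apply: (smooth_sum oD) => k _; exact: (sP k k).1.
have E v : gFS (F v) (G v) = (\sum_k complex.Re ((F v *m G v) k k)) * 2^-1.
  by rewrite /gFS /mxtrace Re_sum.
rewrite (eq_partial i u E) (partialM _ s1 (@smooth_cst R n D (2^-1 : R)) Du).
rewrite partial_cst mulr0 addr0.
rewrite (partial_sum oD _ _ _ (fun k => (sP k k).1) Du).
rewrite /gFS -mulrDl -Re_add -mxtraceD -(partial_mxM oD _ sF sG Du).
rewrite /mxtrace Re_sum; congr (_ * _); apply: eq_bigr => k _.
by rewrite partial_mxE.
Qed.

Lemma dirD X f g u : smooth_on D f -> smooth_on D g -> D u ->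
  dir X (fun v => f v + g v) u = dir X f u + dir X g u.
Proof.
move=> sf sg Du; rewrite /dir -big_split; apply: eq_bigr => i _ /=.
by rewrite (partialD _ sf sg Du) mulrDr.
Qed.

Lemma dirM X f g u : smooth_on D f -> smooth_on D g -> D u ->
  dir X (fun v => f v * g v) u = dir X f u * g u + f u * dir X g u.
Proof.
move=> sf sg Du; rewrite /dir mulr_suml mulr_sumr -big_split.
by apply: eq_bigr => i _ /=; rewrite (partialM _ sf sg Du); ring.
Qed.

Lemma dir_cst X (c : R) u : dir X (fun=> c) u = 0.
Proof. by apply: big1 => i _; rewrite partial_cst mulr0. Qed.

Lemma dir_ext X f g u :
  (forall v, D v -> f v = g v) -> D u -> dir X f u = dir X g u.
Proof.
by move=> fg Du; apply: eq_bigr => i _; rewrite (partial_ext oD i fg Du).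
Qed.

Lemma dir_gFS X F G u : smooth_mx_on D F -> smooth_mx_on D G -> D u ->
  dir X (fun v => gFS (F v) (G v)) u =
  gFS (diff_mx F u X) (G u) + gFS (F u) (diff_mx G u X).
Proof.
move=> sF sG Du; rewrite /dir /diff_mx gFS_suml gFS_sumr -big_split.
by apply: eq_bigr => i _ /=; rewrite gFSZl gFSZr (partial_gFS _ sF sG Du) mulrDr.
Qed.

Lemma diff_mxD F G u X : smooth_mx_on D F -> smooth_mx_on D G -> D u ->
  diff_mx (fun v => F v + G v) u X = diff_mx F u X + diff_mx G u X.
Proof.
move=> sF sG Du; rewrite /diff_mx -big_split; apply: eq_bigr => i _ /=.
by rewrite (partial_mxD _ sF sG Du) scalerDr.
Qed.

Lemma diff_mxN F u X : smooth_mx_on D F -> D u ->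
  diff_mx (fun v => - F v) u X = - diff_mx F u X.
Proof.
move=> sF Du; rewrite /diff_mx -sumrN; apply: eq_bigr => i _ /=.
by rewrite (partial_mxN oD _ sF Du) scalerN.
Qed.

Lemma diff_mxB F G u X : smooth_mx_on D F -> smooth_mx_on D G -> D u ->
  diff_mx (fun v => F v - G v) u X = diff_mx F u X - diff_mx G u X.
Proof.
move=> sF sG Du.
by rewrite (diff_mxD _ sF (smooth_mxN oD sG) Du) (diff_mxN _ sG Du).
Qed.

Lemma diff_mxM F G u X : smooth_mx_on D F -> smooth_mx_on D G -> D u ->
  diff_mx (fun v => F v *m G v) u X = diff_mx F u X *m G u + F u *m diff_mx G u X.
Proof.
move=> sF sG Du; rewrite /diff_mx mulmx_suml mulmx_sumr -big_split.
apply: eq_bigr => i _ /=.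
by rewrite (partial_mxM oD _ sF sG Du) scalerDr -scalemxAl -scalemxAr.
Qed.

Lemma diff_mxZ h F u X : smooth_on D h -> smooth_mx_on D F -> D u ->
  diff_mx (fun v => (h v)%:C *: F v) u X =
  (dir X h u)%:C *: F u + (h u)%:C *: diff_mx F u X.
Proof.
move=> sh sF Du; rewrite /diff_mx /dir rmorph_sum scaler_suml scaler_sumr.
rewrite -big_split; apply: eq_bigr => i _ /=.
rewrite (partial_mxZ oD _ sh sF Du) scalerDr !scalerA -!rmorphM.
by rewrite [X 0 i * h u]mulrC.
Qed.

Lemma diff_mxcZ (c : R[i]) F u X : smooth_mx_on D F -> D u ->
  diff_mx (fun v => c *: F v) u X = c *: diff_mx F u X.
Proof.
move=> sF Du; rewrite /diff_mx scaler_sumr; apply: eq_bigr => i _ /=.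
by rewrite (partial_mxcZ oD _ _ sF Du) !scalerA mulrC.
Qed.

Lemma diff_mx_ext F G u X :
  (forall v, D v -> F v = G v) -> D u -> diff_mx F u X = diff_mx G u X.
Proof.
by move=> FG Du; apply: eq_bigr => i _; rewrite (partial_mx_ext oD i FG Du).
Qed.

Lemma diff_mx_adjoint F u X : smooth_mx_on D F -> D u ->
  (forall v, D v -> (F v) ^t* = F v) -> (diff_mx F u X) ^t* = diff_mx F u X.
Proof.
move=> sF Du hF; rewrite /diff_mx.
rewrite (big_morph (fun A : 'M[R[i]]_m.+1 => A ^t*) (id1 := 0) (op1 := +%R));
  [|exact: adjointD|by rewrite trmx0 map_mx0].
apply: eq_bigr => i _; rewrite adjointZ (partial_mx_adjoint _ sF Du).
rewrite (partial_mx_ext oD i hF Du); congr (_ *: _).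
by apply: complex_ext; rewrite /= ?oppr0.
Qed.

Lemma diff_mx_linear F u a X Y :
  diff_mx F u (a *: X + Y) = a%:C *: diff_mx F u X + diff_mx F u Y.
Proof.
rewrite /diff_mx scaler_sumr -big_split; apply: eq_bigr => i _ /=.
by rewrite !mxE rmorphD rmorphM scalerDl scalerA.
Qed.

Lemma diff_mxDr F u X Y : diff_mx F u (X + Y) = diff_mx F u X + diff_mx F u Y.
Proof. by have := diff_mx_linear F u 1 X Y; rewrite !scale1r. Qed.

Lemma diff_mx0r F u : diff_mx F u 0 = 0.
Proof. by apply: big1 => i _; rewrite mxE scale0r. Qed.

Lemma diff_mxZr F u a X : diff_mx F u (a *: X) = a%:C *: diff_mx F u X.
Proof. by have := diff_mx_linear F u a X 0; rewrite addr0 diff_mx0r addr0. Qed.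

Lemma diff_mxNr F u X : diff_mx F u (- X) = - diff_mx F u X.
Proof. by rewrite -scaleN1r diff_mxZr rmorphN rmorph1 scaleN1r. Qed.

Lemma diff_mxBr F u X Y : diff_mx F u (X - Y) = diff_mx F u X - diff_mx F u Y.
Proof. by rewrite diff_mxDr diff_mxNr. Qed.

Lemma diff_mx_delta F u i : diff_mx F u (delta_mx 0 i) = partial_mx i F u.
Proof.
rewrite /diff_mx (bigD1 i) //= big1 ?addr0 => [|j ji].
  by rewrite mxE !eqxx scale1r.
by rewrite mxE eqxx (negbTE ji) scale0r.
Qed.

Definition smooth_vec (V : 'rV[R]_n -> 'rV[R]_n) :=
  forall l, smooth_on D (fun v => V v 0 l).

Lemma smooth_mx_diff F V : smooth_mx_on D F -> smooth_vec V ->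
  smooth_mx_on D (fun v => diff_mx F v (V v)).
Proof.
move=> sF sV; apply: (smooth_mx_sum oD) => i.
exact: (smooth_mxZ oD (sV i) (smooth_mx_partial oD i sF)).
Qed.

Definition dvec X (V : 'rV[R]_n -> 'rV[R]_n) u : 'rV[R]_n :=
  \row_l dir X (fun v => V v 0 l) u.

(** The second part is symmetric in X and V u, so that it disappears from the
    bracket of two fields. *)
Lemma diff_mx_diff F V u X : smooth_mx_on D F -> smooth_vec V -> D u ->
  diff_mx (fun v => diff_mx F v (V v)) u X =
  diff_mx F u (dvec X V u) +
  \sum_i \sum_j (X 0 i * V u 0 j)%:C *: partial_mx i (partial_mx j F) u.
Proof.
move=> sF sV Du; rewrite {1}/diff_mx.
have sZ j := smooth_mxZ oD (sV j) (smooth_mx_partial oD j sF).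
rewrite (eq_bigr (fun i => \sum_j
   ((X 0 i * partial i (fun v => V v 0 j) u)%:C *: partial_mx j F u
    + (X 0 i * V u 0 j)%:C *: partial_mx i (partial_mx j F) u))); last first.
  move=> i _; rewrite /diff_mx (partial_mx_sum oD _ _ sZ Du) scaler_sumr.
  apply: eq_bigr => j _.
  rewrite (partial_mxZ oD _ (sV j) (smooth_mx_partial oD j sF) Du).
  by rewrite scalerDr !scalerA -!rmorphM.
under eq_bigr do rewrite big_split.
rewrite big_split /= exchange_big /=; congr (_ + _).
apply: eq_bigr => j _; rewrite -scaler_suml mxE -rmorph_sum; congr (_ *: _).
Qed.

Lemma diff_mx_bracket F V W u : smooth_mx_on D F -> smooth_vec V ->
  smooth_vec W -> D u ->
  diff_mx (fun v => diff_mx F v (W v)) u (V u) -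
  diff_mx (fun v => diff_mx F v (V v)) u (W u) =
  diff_mx F u (dvec (V u) W u - dvec (W u) V u).
Proof.
move=> sF sV sW Du; rewrite !diff_mx_diff // diff_mxBr opprD addrACA.
rewrite [X in _ + (X - _)]exchange_big /= -[RHS]addr0; congr (_ + _).
rewrite -sumrB big1 // => i _; rewrite -sumrB big1 // => j _.
by rewrite mulrC (partial_mxC oD _ _ sF Du) subrr.
Qed.

Lemma dir_bracket h V W u : smooth_on D h -> smooth_vec V -> smooth_vec W ->
  D u ->
  dir (V u) (fun v => dir (W v) h v) u - dir (W u) (fun v => dir (V v) h v) u =
  dir (dvec (V u) W u - dvec (W u) V u) h u.
Proof.
move=> sh sV sW Du.
have E A B : smooth_vec A -> smooth_vec B ->
   dir (A u) (fun v => dir (B v) h v) u = dir (dvec (A u) B u) h u +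
     \sum_i \sum_j A u 0 i * B u 0 j * partial i (partial j h) u.
  move=> sA sB; rewrite {1}/dir.
  have sM j := smoothM oD (sB j) (smooth_partial j sh).
  rewrite (eq_bigr (fun i => \sum_j
     (A u 0 i * partial i (fun v => B v 0 j) u * partial j h u
      + A u 0 i * B u 0 j * partial i (partial j h) u))); last first.
    move=> i _; rewrite /dir (partial_sum oD _ _ _ sM Du) mulr_sumr.
    apply: eq_bigr => j _.
    by rewrite (partialM _ (sB j) (smooth_partial j sh) Du) mulrDr !mulrA.
  under eq_bigr do rewrite big_split.
  rewrite big_split /= exchange_big /=; congr (_ + _).
  by apply: eq_bigr => j _; rewrite -mulr_suml mxE.
rewrite (E _ _ sV sW) (E _ _ sW sV) opprD addrACA.
rewrite [X in _ + (X - _)]exchange_big /= -[RHS]addr0; congr (_ + _).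
  by rewrite /dir -sumrB; apply: eq_bigr => i _; rewrite !mxE mulrBl.
rewrite -sumrB big1 // => i _; rewrite -sumrB big1 // => j _.
by rewrite mulrC (partialC oD _ _ sh Du) [W u 0 _ * _]mulrC mulrC subrr.
Qed.

End Directional.

(** * Hypersurfaces in local coordinates *)

Section DetSmooth.
Context {R : realType} {n : nat}.
Variable D : set 'rV[R]_n.
Hypothesis oD : open D.

Lemma smooth_det p (G : 'rV[R]_n -> 'M[R]_p) :
  (forall a b, smooth_on D (fun v => G v a b)) ->
  smooth_on D (fun v => \det (G v)).
Proof.
move=> sG; apply: (smooth_sum oD) => s _; apply: (smoothM oD).
  exact: smooth_cst.
by apply: (smooth_prod oD) => k _; exact: sG.
Qed.

Lemma smooth_invmx p (G : 'rV[R]_n -> 'M[R]_p) :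
  (forall a b, smooth_on D (fun v => G v a b)) ->
  (forall v, D v -> G v \in unitmx) ->
  forall a b, smooth_on D (fun v => invmx (G v) a b).
Proof.
move=> sG uG a b.
have det0 v : D v -> \det (G v) != 0.
  by move=> Dv; have := uG v Dv; rewrite unitmxE unitfE.
have sadj : smooth_on D (fun v => (-1) ^+ (b + a) * \det (row' b (col' a (G v)))).
  apply: (smoothM oD); first exact: smooth_cst.
  apply: smooth_det => c d.
  by apply: (smooth_ext oD _ (sG (lift b c) (lift a d))) => v _; rewrite !mxE.
apply: (smooth_ext oD _ (smoothM oD (smoothV oD (smooth_det sG) det0) sadj)).
by move=> v Dv; rewrite /invmx uG // !mxE /cofactor.
Qed.

End DetSmooth.

Section LocalHypersurface.
Context {R : realType} {m n : nat}.
Local Notation mxfun := ('rV[R]_n -> 'M[R[i]]_m.+1).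

(** What a single chart provides. It is inherited by open subsets of the domain,
    so the argument can be restricted to the open set where A xi and xi are
    independent. *)
Record local_hypersurface (D : set 'rV[R]_n) (F N : mxfun) : Prop :=
  LocalHypersurface {
    lh_open : open D;
    lh_dim : n.+1 = m.*2;
    lh_smooth : smooth_mx_on D F;
    lh_smooth_normal : smooth_mx_on D N;
    lh_CP : forall u, D u -> CP (F u);
    lh_immersion : forall u X, D u -> diff_mx F u X = 0 -> X = 0;
    lh_normal_tangent : forall u, D u -> tangentCP (F u) (N u);
    lh_normal_unit : forall u, D u -> gFS (N u) (N u) = 1;
    lh_normal_orth : forall u X, D u -> gFS (N u) (diff_mx F u X) = 0 }.

Variables (D : set 'rV[R]_n) (F N : mxfun).
Hypothesis hyp : local_hypersurface D F N.
Let oD := lh_open hyp.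
Let sF := lh_smooth hyp.
Let sN := lh_smooth_normal hyp.
Let NN := lh_normal_unit hyp.
Let NF := lh_normal_orth hyp.

Implicit Types (u X Y Z W : 'rV[R]_n) (V : 'rV[R]_n -> 'rV[R]_n).
Local Notation g := (metric F).
Local Notation dF := (diff_mx F).
Local Notation A := (Defs.shape F N).
Local Notation xi := (xi F N).
Local Notation eta := (eta F N).
Local Notation phi := (phi F).
Local Notation tc := (tangent_coord F).

Let hF u : D u -> (F u) ^t* = F u. Proof. by case/(lh_CP hyp). Qed.
Let PP u : D u -> F u *m F u = F u. Proof. by case/(lh_CP hyp). Qed.

Lemma tangent_diff u X : D u -> tangentCP (F u) (dF u X).
Proof.
move=> Du; split; first exact: (diff_mx_adjoint oD _ sF Du hF).
by rewrite -(diff_mxM oD _ sF sF Du); exact: (diff_mx_ext oD _ PP Du).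
Qed.

Lemma metricE u X Y : g u X Y = gFS (dF u X) (dF u Y).
Proof.
rewrite /metric /diff_mx gFS_suml mxE.
under eq_bigr do rewrite mxE mulr_suml.
rewrite exchange_big /=; apply: eq_bigr => i _.
rewrite gFSZl gFS_sumr mulr_sumr; apply: eq_bigr => j _.
by rewrite gFSZr !mxE; ring.
Qed.

Lemma metricC u X Y : g u X Y = g u Y X.
Proof. by rewrite !metricE gFSC. Qed.

Lemma metric_linear u a X Y Z : g u (a *: X + Y) Z = a * g u X Z + g u Y Z.
Proof. by rewrite !metricE diff_mx_linear gFSDl gFSZl. Qed.

Lemma metric_ge0 u X : D u -> 0 <= g u X X.
Proof. by move=> Du; rewrite metricE gFS_ge0 //; case: (tangent_diff X Du). Qed.

Lemma metric_eq0 u X : D u -> g u X X = 0 -> X = 0.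
Proof.
move=> Du; rewrite metricE => gX; apply: (lh_immersion hyp Du).
by apply: gFS_eq0 => //; case: (tangent_diff X Du).
Qed.

Lemma metric_inj u X Y : D u -> (forall Z, g u X Z = g u Y Z) -> X = Y.
Proof.
move=> Du XY; apply/eqP; rewrite -subr_eq0; apply/eqP; apply: (metric_eq0 Du).
have := metric_linear u (-1) Y X (X - Y); rewrite scaleN1r addrC => ->.
by rewrite XY; ring.
Qed.

Lemma gram_unit u : D u -> gram F u \in unitmx.
Proof.
move=> Du; rewrite -row_free_unit -kermx_eq0; apply/eqP/row_matrixP => r.
rewrite row0; apply: (metric_eq0 Du).
by rewrite /metric (sub_kermxP (row_sub r _)) mul0mx mxE.
Qed.

Lemma tangent_coordP u (Z : 'M[R[i]]_m.+1) Y : D u -> g u (tc u Z) Y = gFS Z (dF u Y).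
Proof.
move=> Du; rewrite /metric /tangent_coord mulmxKV ?gram_unit //.
rewrite mxE /diff_mx gFS_sumr; apply: eq_bigr => i _.
by rewrite gFSZr !mxE mulrC.
Qed.

(** The coordinate vectors and N are 2 m independent tangent vectors of CP^m, so
    tangentCP_complete applies to the difference of the two sides. *)
Lemma tangent_decomp u (Z : 'M[R[i]]_m.+1) : D u -> tangentCP (F u) Z ->
  Z = dF u (tc u Z) + (gFS Z (N u))%:C *: N u.
Proof.
move=> Du tZ; have [hN oN] := lh_normal_tangent hyp Du.
pose T (k : 'I_n.+1) := if unlift ord0 k is Some j then partial_mx j F u else N u.
have T0 : T ord0 = N u by rewrite /T unlift_none.
have TS j : T (lift ord0 j) = partial_mx j F u by rewrite /T liftK.
have sumT (c : 'I_n.+1 -> R) : \sum_k (c k)%:C *: T k =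
    (c ord0)%:C *: N u + dF u (\row_j c (lift ord0 j)).
  rewrite big_ord_recl T0 /diff_mx; congr (_ + _); apply: eq_bigr => j _.
  by rewrite TS mxE.
apply/eqP; rewrite -subr_eq0; apply/eqP.
set c := gFS Z (N u); set t := tc u Z.
have [ht ot] := tangent_diff t Du; have [hZ oZ] := tZ.
apply: (tangentCP_complete (T := T) (lh_CP hyp Du) (lh_dim hyp)).
- move=> k; rewrite /T; case: unliftP => [j _|_].
    by rewrite -diff_mx_delta; exact: tangent_diff.
  by split.
- move=> a; rewrite sumT => S0.
  have a0 : a ord0 = 0.
    have := congr1 (gFS (N u)) S0.
    by rewrite gFSDr gFSZr (NF _ Du) (NN Du) gFS0r addr0 mulr1.
  move: S0; rewrite a0 scale0r add0r => /(lh_immersion hyp Du)/rowP r0 k.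
  by case: (unliftP ord0 k) => [j ->|->]; [have := r0 j; rewrite !mxE|].
- split; last first.
    exact: (oddCPD oZ (oddCPN (oddCPD ot (oddCPZ c%:C oN)))).
  rewrite adjointD adjointN adjointD adjointZ hZ ht hN.
  by rewrite conj_real.
- move=> k; case: (unliftP ord0 k) => [j ->|->].
    rewrite TS -diff_mx_delta gFSBr gFSDr gFSZr [gFS _ (N u)]gFSC (NF _ Du).
    rewrite mulr0 addr0 -metricE metricC tangent_coordP // gFSC; exact: subrr.
  rewrite T0 gFSBr gFSDr gFSZr (NF _ Du) (NN Du) mulr1 add0r gFSC.
  exact: subrr.
Qed.

Let oN u : D u -> oddCP (F u) (N u).
Proof. by move=> Du; have [] := lh_normal_tangent hyp Du. Qed.
Let odF u X : D u -> oddCP (F u) (dF u X).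
Proof. by move=> Du; have [] := tangent_diff X Du. Qed.

Lemma Jcp_tangent u (Z : 'M[R[i]]_m.+1) : D u -> tangentCP (F u) Z -> tangentCP (F u) (Jcp (F u) Z).
Proof.
move=> Du [hZ oZ]; split; first exact: (Jcp_herm (hF Du) hZ).
exact: (Jcp_odd (PP Du) oZ).
Qed.

Lemma Jcp_JcpE u (Z : 'M[R[i]]_m.+1) : D u -> tangentCP (F u) Z -> Jcp (F u) (Jcp (F u) Z) = - Z.
Proof.
move=> Du [hZ oZ]; rewrite /Jcp -scalemxAl -scalemxAr -scalerBr scalerA.
have -> : (0 +i* 1) * (0 +i* 1) = -1 :> R[i].
  by apply: complex_ext; rewrite ?Re_mul ?Im_mul /= !(mulr0, mul0r, mulr1, subr0, add0r, addr0, sub0r, oppr0).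
rewrite scaleN1r mulmxBl mulmxBr !mulmxA -[Z *m F u *m F u]mulmxA !PP //.
rewrite (oddPXP (PP Du) oZ) subr0 sub0r opprK.
by congr (- _); exact: oZ.
Qed.

Lemma gFS_Jcp_self u (Z : 'M[R[i]]_m.+1) : D u -> tangentCP (F u) Z -> gFS (Jcp (F u) Z) Z = 0.
Proof.
move=> Du tZ; have := gFS_JcpC (F u) Z Z; rewrite [gFS Z _]gFSC => /eqP.
by rewrite -addr_eq0 -mulr2n mulrn_eq0 /= => /eqP.
Qed.

Lemma diff_xi u : D u -> dF u (xi u) = - Jcp (F u) (N u).
Proof.
move=> Du; have tN := lh_normal_tangent hyp Du; have tJ := Jcp_tangent Du tN.
have tJN : tangentCP (F u) (- Jcp (F u) (N u)).
  case: tJ => hJ oJ; split; first by rewrite adjointN hJ.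
  exact: (oddCPN oJ).
rewrite [RHS](tangent_decomp Du tJN) gFSNl gFS_Jcp_self //.
by rewrite oppr0 scale0r addr0.
Qed.

Lemma etaE u X : D u -> eta u X = gFS (Jcp (F u) (dF u X)) (N u).
Proof.
move=> Du; rewrite /Defs.eta metricE diff_xi // gFSNr.
by rewrite gFS_JcpC.
Qed.

Lemma diff_phi u X : D u ->
  dF u (phi u X) = Jcp (F u) (dF u X) - (eta u X)%:C *: N u.
Proof.
move=> Du; have tJ := Jcp_tangent Du (tangent_diff X Du).
by rewrite [in RHS](tangent_decomp Du tJ) -etaE // addrK.
Qed.

Lemma eta_xi u : D u -> eta u (xi u) = 1.
Proof.
move=> Du; rewrite etaE // diff_xi // JcpN.
by rewrite (Jcp_JcpE Du (lh_normal_tangent hyp Du)) opprK NN.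
Qed.

Lemma metric_phi u X Y : D u -> g u (phi u X) Y = gFS (Jcp (F u) (dF u X)) (dF u Y).
Proof. by move=> Du; rewrite /Defs.phi tangent_coordP. Qed.

Lemma phi_skew u X Y : D u -> g u (phi u X) Y = - g u X (phi u Y).
Proof.
move=> Du; apply: (etrans (metric_phi X Y Du)).
apply: (etrans (gFS_JcpC _ _ _)).
congr (- _); apply: (etrans (gFSC _ _)).
exact: (etrans (esym (metric_phi Y X Du)) (metricC _ _ _)).
Qed.

Lemma phi_xi u : D u -> phi u (xi u) = 0.
Proof.
move=> Du; apply: (lh_immersion hyp Du); rewrite diff_phi // eta_xi //.
rewrite diff_xi // JcpN (Jcp_JcpE Du (lh_normal_tangent hyp Du)) opprK.
by rewrite scale1r subrr.
Qed.

Lemma phi_phi u X : D u -> phi u (phi u X) = - X + eta u X *: xi u.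
Proof.
move=> Du; have ex : eta u (phi u X) = 0.
  by rewrite /Defs.eta phi_skew // phi_xi // metricC -[0](scale0r 0)
     -[0 *: 0]addr0 metric_linear metricE diff_mx0r !gFS0l mulr0 addr0 oppr0.
apply/eqP; rewrite -subr_eq0; apply/eqP; apply: (lh_immersion hyp Du).
rewrite diff_mxBr diff_mxDr diff_mxNr diff_mxZr diff_xi // diff_phi // ex.
rewrite scale0r subr0 diff_phi // JcpD JcpN JcpZ.
rewrite (Jcp_JcpE Du (tangent_diff X Du)) -scalerN; exact: subrr.
Qed.

Lemma shapeP u X Y : D u -> g u (A u X) Y = - gFS (diff_mx N u X) (dF u Y).
Proof.
move=> Du; rewrite tangent_coordP // gFSNl /nablaCP; congr (- _).
by rewrite (gFS_projCP (PP Du) _ (odF Y Du)).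
Qed.

(** Differentiating <N, dF Y> = 0 moves the derivative from N to dF. The second
    derivatives of F are symmetric, hence so is the shape operator. *)
Lemma shape_second u X Y : D u ->
  g u (A u X) Y = \sum_i \sum_j X 0 i * Y 0 j * gFS (N u) (partial_mx i (partial_mx j F) u).
Proof.
move=> Du; rewrite shapeP //.
have sc (l : 'I_n) : smooth_on D (fun v => (fun=> Y) v 0 l) by exact: smooth_cst.
have E := diff_mx_diff oD X sF sc Du.
have := dir_gFS oD X sN (smooth_mx_diff oD sF sc) Du.
rewrite (dir_ext oD X (g := fun=> 0) _ Du) => [|v Dv]; last exact: NF.
rewrite dir_cst E => /esym/eqP; rewrite addr_eq0 => /eqP ->.
rewrite opprK gFSDr NF // add0r gFS_sumr; apply: eq_bigr => i _.
by rewrite gFS_sumr; apply: eq_bigr => j _; rewrite gFSZr.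
Qed.

Lemma shape_sym u X Y : D u -> g u (A u X) Y = g u X (A u Y).
Proof.
move=> Du; apply: etrans (metricC u (A u Y) X).
apply: (etrans (shape_second X Y Du)); apply: etrans (esym (shape_second Y X Du)).
rewrite exchange_big /=; apply: eq_bigr => i _; apply: eq_bigr => j _.
by rewrite (partial_mxC oD _ _ sF Du) [Y 0 i * _]mulrC.
Qed.

End LocalHypersurface.

(** * The Levi-Civita connection *)

Section Connection.
Context {R : realType} {m n : nat}.
Local Notation mxfun := ('rV[R]_n -> 'M[R[i]]_m.+1).
Variables (D : set 'rV[R]_n) (F N : mxfun).
Hypothesis hyp : local_hypersurface D F N.
Let oD := lh_open hyp.
Let sF := lh_smooth hyp.
Let sN := lh_smooth_normal hyp.
Let NN := lh_normal_unit hyp.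
Let NF := lh_normal_orth hyp.

Implicit Types (u X Y Z : 'rV[R]_n) (V W : 'rV[R]_n -> 'rV[R]_n).
Local Notation g := (metric F).
Local Notation dF := (diff_mx F).
Local Notation A := (Defs.shape F N).
Local Notation xi := (xi F N).
Local Notation eta := (eta F N).
Local Notation phi := (phi F).
Local Notation tc := (tangent_coord F).

Let hF u : D u -> (F u) ^t* = F u. Proof. by case/(lh_CP hyp). Qed.
Let PP u : D u -> F u *m F u = F u. Proof. by case/(lh_CP hyp). Qed.
Let oN u : D u -> oddCP (F u) (N u).
Proof. by move=> Du; have [] := lh_normal_tangent hyp Du. Qed.
Let odF u X : D u -> oddCP (F u) (dF u X).
Proof. by move=> Du; have [] := tangent_diff hyp X Du. Qed.
Let tdF u X : D u -> tangentCP (F u) (dF u X).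
Proof. by move=> Du; exact: (tangent_diff hyp X Du). Qed.

Definition nabla X V u : 'rV[R]_n := \sum_i X 0 i *: cov F i V u.

Lemma smooth_gram i j : smooth_on D (fun v => gram F v i j).
Proof.
have s := smooth_gFS oD (smooth_mx_partial oD i sF) (smooth_mx_partial oD j sF).
by apply: (smooth_ext oD _ s) => v _; rewrite mxE.
Qed.

Lemma smooth_tangent_coord (Z : mxfun) : smooth_mx_on D Z ->
  smooth_vec D (fun v => tc v (Z v)).
Proof.
move=> sZ l.
have sG := smooth_invmx oD smooth_gram (fun v Dv => gram_unit hyp Dv).
have s : smooth_on D (fun v => \sum_k gFS (Z v) (partial_mx k F v) *
    invmx (gram F v) k l).
  apply: (smooth_sum oD) => k _; apply: (smoothM oD _ (sG k l)).
  exact: (smooth_gFS oD sZ (smooth_mx_partial oD k sF)).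
apply: (smooth_ext oD _ s) => v _.
by rewrite [RHS]mxE; apply: eq_bigr => k _; rewrite mxE.
Qed.

Lemma smooth_metric V W : smooth_vec D V -> smooth_vec D W ->
  smooth_on D (fun v => g v (V v) (W v)).
Proof.
move=> sV sW.
have s := smooth_gFS oD (smooth_mx_diff oD sF sV) (smooth_mx_diff oD sF sW).
by apply: (smooth_ext oD _ s) => v _; rewrite metricE.
Qed.

Lemma smooth_Jcp (T : mxfun) : smooth_mx_on D T ->
  smooth_mx_on D (fun v => Jcp (F v) (T v)).
Proof.
move=> sT; apply: (smooth_mxcZ oD).
exact: (smooth_mxB oD (smooth_mxM oD sT sF) (smooth_mxM oD sF sT)).
Qed.

Lemma smooth_xi : smooth_vec D xi.
Proof. exact: (smooth_tangent_coord (smooth_mxN oD (smooth_Jcp sN))). Qed.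

Lemma smooth_phi V : smooth_vec D V -> smooth_vec D (fun v => phi v (V v)).
Proof.
by move=> sV; exact: (smooth_tangent_coord (smooth_Jcp (smooth_mx_diff oD sF sV))).
Qed.

Lemma smooth_projCP (Z : mxfun) : smooth_mx_on D Z ->
  smooth_mx_on D (fun v => projCP (F v) (Z v)).
Proof.
move=> sZ; apply: (smooth_mxB oD).
  exact: (smooth_mxD oD (smooth_mxM oD sF sZ) (smooth_mxM oD sZ sF)).
exact: (smooth_mxcZ oD _ (smooth_mxM oD (smooth_mxM oD sF sZ) sF)).
Qed.

Lemma smooth_shape V : smooth_vec D V -> smooth_vec D (fun v => A v (V v)).
Proof.
move=> sV; apply: smooth_tangent_coord; apply: (smooth_mxN oD).
exact: (smooth_projCP (smooth_mx_diff oD sN sV)).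
Qed.

Lemma smooth_vecD V W : smooth_vec D V -> smooth_vec D W ->
  smooth_vec D (fun v => V v + W v).
Proof.
move=> sV sW l; apply: (smooth_ext oD _ (smoothD oD (sV l) (sW l))) => v _.
by rewrite mxE.
Qed.

Lemma smooth_vecZ h V : smooth_on D h -> smooth_vec D V ->
  smooth_vec D (fun v => h v *: V v).
Proof.
move=> sh sV l; apply: (smooth_ext oD _ (smoothM oD sh (sV l))) => v _.
by rewrite mxE.
Qed.

Lemma smooth_vec_cst X : smooth_vec D (fun=> X).
Proof. by move=> l; exact: smooth_cst. Qed.

(** Koszul: the three derivatives of the Gram matrix combine, by the symmetry of
    second derivatives, to the tangential part of a second derivative of F. *)
Lemma christoffelP i j u Y : D u ->
  g u (christoffel F i j u) Y = gFS (partial_mx i (partial_mx j F) u) (dF u Y).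
Proof.
move=> Du; rewrite /metric /christoffel mulmxKV ?(gram_unit hyp) //.
pose F1 a := partial_mx a F u; pose F2 a b := partial_mx a (partial_mx b F) u.
have F2C a b : F2 a b = F2 b a by exact: (partial_mxC oD a b sF Du).
have dgram a b c : partial a (fun v => gram F v b c) u =
   gFS (F2 a b) (F1 c) + gFS (F1 b) (F2 a c).
  apply: etrans (partial_gFS oD a (smooth_mx_partial oD b sF)
              (smooth_mx_partial oD c sF) Du).
  by apply: eq_partial => v; rewrite mxE.
rewrite mxE {1}/diff_mx gFS_sumr; apply: eq_bigr => l _.
rewrite gFSZr !mxE mulrC; congr (_ * _).
rewrite (dgram i j l) (dgram j i l) (dgram l i j).
(* Only the symmetry of F2 is used from here on. *)
rewrite -/(F1 l) -/(F2 i j); clearbody F1 F2.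
have half (a b c : R) : (a + b + (a + c) - (b + c)) / 2 = a by field.
rewrite (F2C j i) (F2C l i) (F2C l j) (gFSC (F2 i l)).
exact: half.
Qed.

Lemma smooth_christoffel i j : smooth_vec D (christoffel F i j).
Proof.
have s := smooth_tangent_coord (smooth_mx_partial oD i (smooth_mx_partial oD j sF)).
move=> l; apply: (smooth_ext oD _ (s l)) => v Dv; congr (fun_of_matrix _ 0 l).
apply: (metric_inj hyp Dv) => Y.
by rewrite (tangent_coordP hyp) // christoffelP.
Qed.

Lemma metricZ u a X Y : g u (a *: X) Y = a * g u X Y.
Proof. by rewrite !metricE diff_mxZr gFSZl. Qed.

Lemma metricD u X Y Z : g u (X + Y) Z = g u X Z + g u Y Z.
Proof. by rewrite !metricE diff_mxDr gFSDl. Qed.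

Lemma metric_sum u (I : Type) (r : seq I) (V : I -> 'rV[R]_n) Y :
  g u (\sum_(k <- r) V k) Y = \sum_(k <- r) g u (V k) Y.
Proof.
elim: r => [|k r IH]; first by rewrite !big_nil metricE diff_mx0r gFS0l.
by rewrite !big_cons metricD IH.
Qed.

Lemma covP i V u Y : smooth_vec D V -> D u ->
  g u (cov F i V u) Y =
  gFS (partial_mx i (fun v => dF v (V v)) u) (dF u Y).
Proof.
move=> sV Du; rewrite /cov metricD metric_sum.
under eq_bigr do rewrite metricZ (christoffelP _ _ _ Du) -gFSZl.
rewrite metricE -gFS_suml -gFSDl; congr gFS.
rewrite -[RHS]diff_mx_delta (diff_mx_diff oD _ sF sV Du); congr (diff_mx _ _ _ + _).
  apply/rowP => l; rewrite !mxE /dir (bigD1 i) //= big1 ?addr0 => [|j ji].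
    by rewrite mxE !eqxx mul1r.
  by rewrite mxE eqxx (negbTE ji) mul0r.
rewrite [RHS](bigD1 i) //= [X in _ + X]big1 ?addr0 => [|k ki].
  by apply: eq_bigr => j _; rewrite mxE !eqxx mul1r.
by apply: big1 => j _; rewrite mxE eqxx (negbTE ki) mul0r scale0r.
Qed.

(** The covariant derivative is the tangential part of the derivative in the
    space of Hermitian matrices. All rules for the connection follow from this
    and the Leibniz rule for diff_mx. *)
Lemma nabP X V u Y : smooth_vec D V -> D u ->
  g u (nabla X V u) Y = gFS (diff_mx (fun v => dF v (V v)) u X) (dF u Y).
Proof.
move=> sV Du; rewrite /nabla metric_sum /diff_mx gFS_suml; apply: eq_bigr => i _.
by rewrite metricZ (covP _ _ sV Du) gFSZl.
Qed.

Lemma nab_metric X V W u : smooth_vec D V -> smooth_vec D W -> D u ->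
  dir X (fun v => g v (V v) (W v)) u =
  g u (nabla X V u) (W u) + g u (V u) (nabla X W u).
Proof.
move=> sV sW Du; rewrite (dir_ext oD X (fun v _ => metricE F v (V v) (W v)) Du).
rewrite (dir_gFS oD X (smooth_mx_diff oD sF sV) (smooth_mx_diff oD sF sW) Du).
congr (_ + _); first by rewrite (nabP _ _ sV Du).
apply/esym; apply: (etrans (metricC _ _ _ _)).
by rewrite (nabP _ _ sW Du); exact: gFSC.
Qed.

Lemma nab_ext X V W u : (forall v, D v -> V v = W v) -> D u ->
  nabla X V u = nabla X W u.
Proof.
move=> VW Du; apply: eq_bigr => i _; apply: (congr1 (fun Z => X 0 i *: Z)).
rewrite /cov (VW _ Du); apply: (congr1 (fun Z => Z + _)).
apply/rowP => l; rewrite !mxE.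
by apply: (partial_ext oD _ _ Du) => v Dv; rewrite VW.
Qed.

Lemma nabD X V W u : smooth_vec D V -> smooth_vec D W -> D u ->
  nabla X (fun v => V v + W v) u = nabla X V u + nabla X W u.
Proof.
move=> sV sW Du; apply: (metric_inj hyp Du) => Y.
rewrite metricD (nabP X Y sV Du) (nabP X Y sW Du) (nabP X Y (smooth_vecD sV sW) Du).
rewrite -gFSDl -(diff_mxD _ (smooth_mx_diff oD sF sV) (smooth_mx_diff oD sF sW) Du).
apply: (congr1 (gFS^~ (dF u Y))).
apply: (diff_mx_ext oD _ _ Du) => v _; exact: diff_mxDr.
Qed.

Lemma nabZ X h V u : smooth_on D h -> smooth_vec D V -> D u ->
  nabla X (fun v => h v *: V v) u = dir X h u *: V u + h u *: nabla X V u.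
Proof.
move=> sh sV Du; apply: (metric_inj hyp Du) => Y.
rewrite metricD !metricZ (nabP X Y sV Du) (nabP X Y (smooth_vecZ sh sV) Du).
rewrite metricE -!gFSZl -gFSDl -(diff_mxZ oD _ sh (smooth_mx_diff oD sF sV) Du).
apply: (congr1 (gFS^~ (dF u Y))).
apply: (diff_mx_ext oD _ _ Du) => v _; exact: diff_mxZr.
Qed.

Lemma nab_torsion V W u : smooth_vec D V -> smooth_vec D W -> D u ->
  nabla (V u) W u - nabla (W u) V u = dvec (V u) W u - dvec (W u) V u.
Proof.
move=> sV sW Du; apply: (metric_inj hyp Du) => Y.
rewrite -scaleN1r addrC metric_linear (nabP _ Y sV Du) (nabP _ Y sW Du).
rewrite mulN1r addrC -gFSBl.
by rewrite (diff_mx_bracket oD sF sV sW Du) -metricE.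
Qed.

(** Differentiating T P + P T = T along the hypersurface determines the part of
    the derivative of T that is normal to CP^m. *)
Lemma tangent_field_diff (T : mxfun) u X : smooth_mx_on D T -> D u ->
  (forall v, D v -> tangentCP (F v) (T v)) ->
  tangentCP (F u) (diff_mx T u X - sigmaCP (F u) (dF u X) (T u)).
Proof.
move=> sT Du tT; have [hT oT] := tT u Du; have [hX oX] := tdF X Du.
split.
  rewrite adjointD adjointN (diff_mx_adjoint oD _ sT Du (fun v Dv => (tT v Dv).1)).
  by rewrite (sigmaCP_herm (hF Du) hX hT).
set Z := diff_mx T u X; set E := dF u X *m T u + T u *m dF u X.
have EE : evenCP (F u) E.
  exact: (evenCPD (oddM_even oX oT) (oddM_even oT oX)).
have ZE : Z *m F u + F u *m Z + E = Z.
  have := diff_mx_ext oD X (fun v Dv => (tT v Dv).2) Du.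
  rewrite (diff_mxD _ (smooth_mxM oD sT sF) (smooth_mxM oD sF sT) Du).
  rewrite (diff_mxM oD _ sT sF Du) (diff_mxM oD _ sF sT Du) -/Z => dT; rewrite -[RHS]dT.
  have add4 (a b c d : 'M[R[i]]_m.+1) : a + b + (d + c) = a + c + (d + b).
    by rewrite [d + c]addrC addrACA [d + b]addrC.
  exact: add4.
exact: (odd_sub_even (PP Du) EE ZE).
Qed.

(** Weingarten. There is no component along N because N has constant length. *)
Lemma normal_diff X u : D u ->
  diff_mx N u X = - dF u (A u X) + sigmaCP (F u) (dF u X) (N u).
Proof.
move=> Du; apply/eqP; rewrite -subr_eq; apply/eqP.
have tT := tangent_field_diff X sN Du (lh_normal_tangent hyp).
have eS := sigma_even (PP Du) (odF X Du) (oN Du).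
rewrite (tangent_decomp hyp Du tT) gFSBl (gFS_even_odd (PP Du) eS (oN Du)).
have -> : gFS (diff_mx N u X) (N u) = 0.
  have := dir_gFS oD X sN sN Du; rewrite (dir_ext oD X NN Du) dir_cst.
  by rewrite [gFS (N u) _]gFSC => /esym/eqP; rewrite -mulr2n mulrn_eq0 => /eqP.
rewrite subr0 scale0r addr0 -diff_mxNr; congr (dF u _).
apply: (metric_inj hyp Du) => Y; rewrite (tangent_coordP hyp) // gFSBl.
rewrite (gFS_even_odd (PP Du) eS (odF Y Du)) subr0.
by rewrite -scaleN1r metricZ (shapeP hyp) // mulN1r opprK.
Qed.

(** Gauss formula for the hypersurface in the space of Hermitian matrices: the
    normal part splits into the part in CP^m and the part normal to CP^m. *)
Lemma field_diff X V u : smooth_vec D V -> D u ->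
  diff_mx (fun v => dF v (V v)) u X =
  dF u (nabla X V u) + (g u (A u X) (V u))%:C *: N u
  + sigmaCP (F u) (dF u X) (dF u (V u)).
Proof.
move=> sV Du; apply/eqP; rewrite -subr_eq; apply/eqP.
have sdV := smooth_mx_diff oD sF sV.
have tT := tangent_field_diff X sdV Du (fun v Dv => tdF (V v) Dv).
have eS := sigma_even (PP Du) (odF X Du) (odF (V u) Du).
rewrite (tangent_decomp hyp Du tT) gFSBl (gFS_even_odd (PP Du) eS (oN Du)) subr0.
congr (dF u _ + _%:C *: _).
  apply: (metric_inj hyp Du) => Y; rewrite (tangent_coordP hyp) // gFSBl.
  by rewrite (gFS_even_odd (PP Du) eS (odF Y Du)) subr0 (nabP _ _ sV Du).
have := dir_gFS oD X sdV sN Du.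
rewrite (dir_ext oD X (g := fun=> 0) _ Du) => [|v Dv]; last first.
  by rewrite gFSC (NF (V v) Dv).
rewrite dir_cst (shapeP hyp) // [gFS (dF u _) _]gFSC => /esym/eqP.
by rewrite addr_eq0 => /eqP ->.
Qed.

(** J is parallel on CP^m: the derivative of P in J contributes commutators of
    tangent vectors, which are even and hence normal. S is the even part of the
    derivative of T, which J annihilates. *)
Lemma Jcp_diff (T S : mxfun) u X Y : smooth_mx_on D T -> D u ->
  (forall v, D v -> oddCP (F v) (T v)) -> evenCP (F u) (S u) ->
  gFS (diff_mx (fun v => Jcp (F v) (T v)) u X) (dF u Y) =
  gFS (Jcp (F u) (diff_mx T u X - S u)) (dF u Y).
Proof.
move=> sT Du oT eS.
have E : diff_mx (fun v => Jcp (F v) (T v)) u X =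
   Jcp (F u) (diff_mx T u X) + (0 +i* 1) *: (T u *m dF u X - dF u X *m T u).
  rewrite (diff_mxcZ oD _ _ (smooth_mxB oD (smooth_mxM oD sT sF) (smooth_mxM oD sF sT)) Du).
  rewrite (diff_mxB oD _ (smooth_mxM oD sT sF) (smooth_mxM oD sF sT) Du).
  rewrite (diff_mxM oD _ sT sF Du) (diff_mxM oD _ sF sT Du) /Jcp -scalerDr.
  congr (_ *: _); rewrite [dF u X *m T u + _]addrC opprD addrACA //.
have ev : evenCP (F u) ((0 +i* 1) *: (T u *m dF u X - dF u X *m T u)).
  have e1 := oddM_even (oT u Du) (odF X Du).
  have e2 := oddM_even (odF X Du) (oT u Du).
  exact: (evenCPZ _ (evenCPD e1 (evenCPN e2))).
rewrite E gFSDl (gFS_even_odd (PP Du) ev (odF Y Du)) addr0 JcpD JcpN.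
by rewrite (Jcp_even eS) subr0.
Qed.

End Connection.

(** * Structure equations of a hypersurface *)

Section StructureEquations.
Context {R : realType} {m n : nat}.
Local Notation mxfun := ('rV[R]_n -> 'M[R[i]]_m.+1).
Variables (D : set 'rV[R]_n) (F N : mxfun).
Hypothesis hyp : local_hypersurface D F N.
Let oD := lh_open hyp.
Let sF := lh_smooth hyp.
Let sN := lh_smooth_normal hyp.
Let NF := lh_normal_orth hyp.

Implicit Types (u X Y Z : 'rV[R]_n) (V W : 'rV[R]_n -> 'rV[R]_n).
Local Notation g := (metric F).
Local Notation dF := (diff_mx F).
Local Notation A := (Defs.shape F N).
Local Notation xi := (xi F N).
Local Notation eta := (eta F N).
Local Notation phi := (phi F).
Local Notation nab := (nabla F).

Let PP u : D u -> F u *m F u = F u. Proof. by case/(lh_CP hyp). Qed.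
Let oN u : D u -> oddCP (F u) (N u).
Proof. by move=> Du; have [] := lh_normal_tangent hyp Du. Qed.
Let odF u X : D u -> oddCP (F u) (dF u X).
Proof. by move=> Du; have [] := tangent_diff hyp X Du. Qed.
Let tdF u X : D u -> tangentCP (F u) (dF u X).
Proof. by move=> Du; exact: (tangent_diff hyp X Du). Qed.

Lemma metricB u X Y Z : g u (X - Y) Z = g u X Z - g u Y Z.
Proof. by rewrite !metricE diff_mxBr gFSBl. Qed.

Lemma metric_comb1 u a b X Y Z (W : 'rV[R]_n) :
  g u (X + a *: Y - b *: Z) W = g u X W + a * g u Y W - b * g u Z W.
Proof.
by rewrite !metricE diff_mxBr diff_mxDr !diff_mxZr gFSBl gFSDl !gFSZl.
Qed.

Lemma metric_comb2 u a b c X Y Z (W : 'rV[R]_n) :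
  g u (a *: X - b *: Y - c *: Z) W = a * g u X W - b * g u Y W - c * g u Z W.
Proof. by rewrite !metricE !diff_mxBr !diff_mxZr !gFSBl !gFSZl. Qed.

Lemma metric_comb3 u X X' Y Y' (W : 'rV[R]_n) :
  g u (X - X' - (Y - Y')) W = g u X W - g u X' W - (g u Y W - g u Y' W).
Proof. by rewrite !metricE !diff_mxBr !gFSBl. Qed.

Lemma gFS_Jcp_normal u Y : D u -> gFS (Jcp (F u) (N u)) (dF u Y) = - eta u Y.
Proof.
move=> Du; have tN := lh_normal_tangent hyp Du.
rewrite gFS_JcpC (etaE hyp) //; congr (- _).
exact: gFSC.
Qed.

Lemma nab_xi X u : D u -> nab X xi u = phi u (A u X).
Proof.
move=> Du; apply: (metric_inj hyp Du) => Y.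
apply: (etrans (nabP hyp X Y (smooth_xi hyp) Du)).
have E := diff_mx_ext oD X (fun v Dv => diff_xi hyp Dv) Du.
have eS := sigma_even (PP Du) (odF X Du) (oN Du).
rewrite E (diff_mxN oD _ (smooth_Jcp hyp sN) Du) gFSNl.
rewrite (Jcp_diff hyp (S := fun=> sigmaCP (F u) (dF u X) (N u)) X Y sN Du oN eS).
rewrite (normal_diff hyp X Du) addrK JcpN gFSNl opprK.
exact: esym (metric_phi hyp _ _ Du).
Qed.

Lemma nab_phi X V u : smooth_vec D V -> D u ->
  nab X (fun v => phi v (V v)) u =
  phi u (nab X V u) + eta u (V u) *: A u X - g u (A u X) (V u) *: xi u.
Proof.
move=> sV Du; apply: (metric_inj hyp Du) => Y.
apply: (etrans (nabP hyp X Y (smooth_phi hyp sV) Du)).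
have sdV := smooth_mx_diff oD sF sV.
have seta := smooth_metric hyp sV (smooth_xi hyp).
have E := diff_mx_ext oD X (fun v Dv => diff_phi hyp (V v) Dv) Du.
have eS := sigma_even (PP Du) (odF X Du) (odF (V u) Du).
rewrite E (diff_mxB oD _ (smooth_Jcp hyp sdV) (smooth_mxZ oD seta sN) Du) gFSBl.
rewrite (Jcp_diff hyp (S := fun=> sigmaCP (F u) (dF u X) (dF u (V u))) X Y sdV Du
   (fun v Dv => odF (V v) Dv) eS).
rewrite (field_diff hyp X sV Du) addrK JcpD JcpZ gFSDl gFSZl.
rewrite (gFS_Jcp_normal _ Du) -(metric_phi hyp _ _ Du).
rewrite (diff_mxZ oD _ seta sN Du) gFSDl !gFSZl (NF _ Du) mulr0 add0r.
have NX : gFS (diff_mx N u X) (dF u Y) = - g u (A u X) Y.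
  by apply/esym; apply: (canLR opprK); exact: (shapeP hyp X Y Du).
rewrite NX.
have exi : g u (xi u) Y = eta u Y := metricC F u (xi u) Y.
have C := metric_comb1 u (eta u (V u)) (g u (A u X) (V u))
  (phi u (nab X V u)) (A u X) (xi u) Y.
apply/esym; apply: (etrans C).
have alg (a b c d d' e : R) : d' = d ->
    a + e * b - c * d' = a + c * - d - e * - b by move=> ->; ring.
exact: (alg _ _ _ _ _ _ exi).
Qed.

(** The field dF (A W) is minus the derivative of N along W, up to its even part
    sigmaCP. The second term comes from differentiating the orthogonality of
    that even part to tangent vectors. *)
Lemma nab_shape X W u Z : smooth_vec D W -> D u ->
  g u (nab X (fun v => A v (W v)) u) Z =
  - gFS (diff_mx (fun v => diff_mx N v (W v)) u X) (dF u Z)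
  - gFS (sigmaCP (F u) (dF u (W u)) (N u)) (sigmaCP (F u) (dF u X) (dF u Z)).
Proof.
move=> sW Du; have sAW := smooth_shape hyp sW.
apply: (etrans (nabP hyp X Z sAW Du)).
have sdA := smooth_mx_diff oD sF sAW; have sdN := smooth_mx_diff oD sN sW.
have sG := smooth_mxD oD sdA sdN.
have sZ := smooth_mx_diff oD sF (smooth_vec_cst (D := D) Z).
(* The sum is the even part of the derivative of N along W. *)
have GE v : D v -> dF v (A v (W v)) + diff_mx N v (W v) =
    sigmaCP (F v) (dF v (W v)) (N v).
  by move=> Dv; rewrite (normal_diff hyp _ Dv) addNKr.
have := dir_gFS oD X sG sZ Du.
rewrite (dir_ext oD X (g := fun=> 0) _ Du) => [|v Dv]; last first.
  rewrite (GE v Dv).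
  exact: (gFS_even_odd (PP Dv) (sigma_even (PP Dv) (odF _ Dv) (oN Dv)) (odF _ Dv)).
have eS := sigma_even (PP Du) (odF (W u) Du) (oN Du).
have -> : diff_mx (fun v => dF v (A v (W v)) + diff_mx N v (W v)) u X =
  diff_mx (fun v => dF v (A v (W v))) u X + diff_mx (fun v => diff_mx N v (W v)) u X.
  exact: (diff_mxD _ sdA sdN Du).
rewrite gFSDl => E0.
have E1 : gFS (dF u (A u (W u)) + diff_mx N u (W u))
     (diff_mx (fun v => dF v Z) u X) =
  gFS (sigmaCP (F u) (dF u (W u)) (N u)) (sigmaCP (F u) (dF u X) (dF u Z)).
  apply: (etrans (congr2 gFS (GE u Du)
    (field_diff hyp X (smooth_vec_cst (D := D) Z) Du))).
  rewrite !gFSDr gFSZr (gFS_even_odd (PP Du) eS (odF _ Du)).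
  by rewrite (gFS_even_odd (PP Du) eS (oN Du)) mulr0 !add0r.
move: E0; rewrite dir_cst E1.
have alg (a b c : R) : 0 = a + b + c -> a = - b - c by move=> ?; lra.
exact: alg.
Qed.

Lemma shape_lin u a X Y : D u -> A u (a *: X + Y) = a *: A u X + A u Y.
Proof.
move=> Du; apply: (metric_inj hyp Du) => Z.
apply: (etrans (shapeP hyp _ _ Du)); apply/esym.
apply: (etrans (metric_linear F u a (A u X) (A u Y) Z)).
apply: (etrans (congr2 (fun p q => a * p + q) (shapeP hyp X Z Du)
  (shapeP hyp Y Z Du))).
rewrite diff_mx_linear gFSDl gFSZl; ring.
Qed.

(** In nab_shape the second derivatives of N are symmetric up to the bracket of
    V and W, and the terms in sigmaCP form the left-hand side of
    curvature_identity with N as one of its arguments. *)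
Lemma codazzi V W u : smooth_vec D V -> smooth_vec D W -> D u ->
  nab (V u) (fun v => A v (W v)) u - A u (nab (V u) W u)
  - (nab (W u) (fun v => A v (V v)) u - A u (nab (W u) V u)) =
  eta u (V u) *: phi u (W u) - eta u (W u) *: phi u (V u)
  - (2 * g u (phi u (V u)) (W u)) *: xi u.
Proof.
move=> sV sW Du; apply: (metric_inj hyp Du) => Z.
have tN := lh_normal_tangent hyp Du.
have exi : g u (xi u) Z = eta u Z := metricC F u (xi u) Z.
have br : g u (A u (nab (V u) W u)) Z - g u (A u (nab (W u) V u)) Z =
   gFS (diff_mx (fun v => diff_mx N v (V v)) u (W u)) (dF u Z)
   - gFS (diff_mx (fun v => diff_mx N v (W v)) u (V u)) (dF u Z).
  apply: (etrans (congr2 (fun p q => p - q) (shapeP hyp (nab (V u) W u) Z Du)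
    (shapeP hyp (nab (W u) V u) Z Du))).
  have B : gFS (diff_mx N u (nab (W u) V u)) (dF u Z)
      - gFS (diff_mx N u (nab (V u) W u)) (dF u Z) =
      gFS (diff_mx (fun v => diff_mx N v (V v)) u (W u)) (dF u Z)
      - gFS (diff_mx (fun v => diff_mx N v (W v)) u (V u)) (dF u Z).
    rewrite -[LHS]gFSBl -[RHS]gFSBl -diff_mxBr; apply: (congr1 (gFS^~ (dF u Z))).
    rewrite (nab_torsion hyp sW sV Du).
    exact: (esym (diff_mx_bracket oD sN sW sV Du)).
  apply: etrans B; have alg (a b : R) : - a - - b = b - a by ring.
  exact: alg.
have K := curvature_identity_CP (lh_CP hyp Du) (tdF (W u) Du) (tdF (V u) Du) tN (tdF Z Du).
have V0 : gFS (dF u (V u)) (N u) = 0 by rewrite gFSC (NF _ Du).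
have W0 : gFS (dF u (W u)) (N u) = 0 by rewrite gFSC (NF _ Du).
have sk : gFS (Jcp (F u) (dF u (W u))) (dF u (V u)) = - g u (phi u (V u)) (W u).
  apply: (etrans (gFS_JcpC _ _ _)); congr (- _); apply: (etrans (gFSC _ _)).
  exact: (esym (metric_phi hyp (V u) (W u) Du)).
apply: (etrans (metric_comb3 _ _ _ _ _ _)).
apply/esym; apply: (etrans (metric_comb2 _ _ _ _ _ _ _ _)); apply/esym.
have alg (a b c d e f p q r s x y w1 w2 jy jx jxw jyw jxy jzw h k l o t : R) :
   e - f = x * w1 - y * w2 + jy * jxw - jx * jyw - 2 * jxy * jzw ->
   x = 0 -> y = 0 -> c - d = b - a ->
   p = jy -> q = jx -> k = jxw -> l = jyw -> jxy = - r -> jzw = - s -> t = s ->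
   h = - a - f -> o = - b - e ->
   h - c - (o - d) = p * k - q * l - 2 * r * t.
  move=> K0 x0 y0 H -> -> -> -> H1 H2 -> -> ->; rewrite x0 y0 H1 H2 in K0.
  have -> : - a - f - c - (- b - e - d) = e - f + (b - a - (c - d)) by ring.
  by rewrite H K0; ring.
exact: (alg _ _ _ _ _ _ _ _ _ _ _ _ _ _ _ _ _ _ _ _ _ _ _ _ _ K V0 W0 br
  (etaE hyp (V u) Du) (etaE hyp (W u) Du) (metric_phi hyp (W u) Z Du)
  (metric_phi hyp (V u) Z Du) sk (gFS_Jcp_normal Z Du) exi
  (nab_shape (V u) Z sW Du) (nab_shape (W u) Z sV Du)).
Qed.

Lemma nab0 X u : D u -> nab X (fun=> 0) u = 0.
Proof.
move=> Du; apply: (metric_inj hyp Du) => Y.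
apply: (etrans (nabP hyp X Y (smooth_vec_cst (D := D) 0) Du)).
have -> : (fun v => dF v (0 : 'rV[R]_n)) = (fun=> 0).
  by apply/funext => v; exact: diff_mx0r.
rewrite metricE diff_mx0r /diff_mx big1 // => i _.
have -> : partial_mx i (fun=> 0) u = 0 :> 'M[R[i]]_m.+1.
  by apply/matrixP => a b; rewrite partial_mxE [RHS]mxE -[RHS](cpartial_cst i 0 u);
     apply: eq_cpartial => v; rewrite mxE.
by rewrite scaler0.
Qed.

Lemma smooth_vec_sum (I : Type) (r : seq I) (c : I -> R)
    (V : I -> 'rV[R]_n -> 'rV[R]_n) :
  (forall k, smooth_vec D (V k)) ->
  smooth_vec D (fun v => \sum_(k <- r) c k *: V k v).
Proof.
move=> sV l.
have s : smooth_on D (fun v => \sum_(k <- r) c k * V k v 0 l).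
  apply: (smooth_sum oD) => k _.
  by apply: (smoothM oD _ (sV k l)); exact: smooth_cst.
apply: (smooth_ext oD _ s) => v _; rewrite summxE.
by apply: eq_bigr => k _; rewrite mxE.
Qed.

Lemma nab_sum X (I : Type) (r : seq I) (c : I -> R)
    (V : I -> 'rV[R]_n -> 'rV[R]_n) u :
  (forall k, smooth_vec D (V k)) -> D u ->
  nab X (fun v => \sum_(k <- r) c k *: V k v) u =
  \sum_(k <- r) c k *: nab X (V k) u.
Proof.
move=> sV Du; elim: r => [|k r IH].
  rewrite big_nil -[RHS](nab0 X Du); apply: (nab_ext hyp _ _ Du) => v _.
  by rewrite big_nil.
rewrite big_cons -IH.
have sk : smooth_vec D (fun v => c k *: V k v).
  by apply: (smooth_vecZ hyp _ (sV k)); exact: smooth_cst.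
have sr := smooth_vec_sum r c sV.
have ck : nab X (fun v => c k *: V k v) u = c k *: nab X (V k) u.
  apply: (etrans (nabZ hyp X (@smooth_cst R n D (c k)) (sV k) Du)).
  by rewrite dir_cst scale0r add0r.
rewrite -ck -(nabD hyp X sk sr Du); apply: (nab_ext hyp _ _ Du) => v _.
by rewrite big_cons.
Qed.

Lemma nab_cst Y Z v :
  nab Y (fun=> Z) v =
  \sum_(p : 'I_n * 'I_n) (Y 0 p.1 * Z 0 p.2) *: christoffel F p.1 p.2 v.
Proof.
rewrite /nabla -(pair_bigA _ (fun i j => (Y 0 i * Z 0 j) *: christoffel F i j v)).
apply: eq_bigr => i _; rewrite /cov.
have -> : \row_l partial i (fun=> Z 0 l) v = 0.
  by apply/rowP => l; rewrite !mxE partial_cst.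
by rewrite add0r scaler_sumr; apply: eq_bigr => j _; rewrite scalerA.
Qed.

Lemma nab_nab_cst X Y Z u : D u ->
  nab X (fun v => nab Y (fun=> Z) v) u =
  \sum_i \sum_j \sum_l (X 0 i * Y 0 j * Z 0 l) *: cov F i (christoffel F j l) u.
Proof.
move=> Du; rewrite (nab_ext hyp X (fun v _ => nab_cst Y Z v) Du).
rewrite (nab_sum _ _ _ (fun p => smooth_christoffel hyp p.1 p.2) Du).
rewrite /nabla.
rewrite -(pair_bigA _ (fun j l => (Y 0 j * Z 0 l) *:
   \sum_i X 0 i *: cov F i (christoffel F j l) u)) /=.
rewrite [RHS]exchange_big /=; apply: eq_bigr => j _.
rewrite [RHS]exchange_big /=; apply: eq_bigr => l _.
rewrite scaler_sumr; apply: eq_bigr => i _; rewrite scalerA; congr (_ *: _).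
by rewrite mulrC mulrA.
Qed.

Lemma curvE X Y Z u : D u ->
  curv F u X Y Z = nab X (fun v => nab Y (fun=> Z) v) u
                 - nab Y (fun v => nab X (fun=> Z) v) u.
Proof.
move=> Du; rewrite (nab_nab_cst X Y Z Du) (nab_nab_cst Y X Z Du) /curv.
rewrite [X in _ - X]exchange_big /= -sumrB; apply: eq_bigr => i _.
rewrite -sumrB; apply: eq_bigr => j _; rewrite -sumrB; apply: eq_bigr => l _.
by rewrite scalerBr [Y 0 j * _]mulrC.
Qed.

(** The even part of a second derivative of F is sigmaCP. It is orthogonal to
    tangent vectors, and the last term comes from differentiating this
    orthogonality. *)
Lemma gauss_half X Y Z (W : 'rV[R]_n) u : D u ->
  g u (nab X (fun v => nab Y (fun=> Z) v) u) W =
  gFS (diff_mx (fun v => diff_mx (fun w => dF w Z) v Y) u X) (dF u W)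
  + g u (A u Y) Z * g u (A u X) W
  + gFS (sigmaCP (F u) (dF u Y) (dF u Z)) (sigmaCP (F u) (dF u X) (dF u W)).
Proof.
move=> Du; have sc T := smooth_vec_cst (D := D) T.
have sdc T := smooth_mx_diff oD sF (sc T).
have snab : smooth_vec D (fun v => nab Y (fun=> Z) v).
  have s := smooth_vec_sum (index_enum _) (fun p => Y 0 p.1 * Z 0 p.2)
    (fun p => smooth_christoffel hyp p.1 p.2).
  by move=> l; apply: (smooth_ext oD _ (s l)) => v _; rewrite nab_cst.
apply: (etrans (nabP hyp X W snab Du)).
pose h v := g v (A v Y) Z.
have sh : smooth_on D h := smooth_metric hyp (smooth_shape hyp (sc Y)) (sc Z).
have s1 := smooth_mx_diff oD (sdc Z) (sc Y).
have s2 := smooth_mx_diff oD sF snab.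
have s3 := smooth_mxZ oD sh sN.
(* G is the even part of a second derivative of F, see field_diff. *)
pose G v := diff_mx (fun w => dF w Z) v Y - dF v (nab Y (fun=> Z) v)
   - (h v)%:C *: N v.
have sG : smooth_mx_on D G := smooth_mxB oD (smooth_mxB oD s1 s2) s3.
have GE v : D v -> G v = sigmaCP (F v) (dF v Y) (dF v Z).
  move=> Dv; rewrite /G (field_diff hyp Y (sc Z) Dv) -/(h v) -addrA -opprD.
  by rewrite addrAC subrr add0r.
have eS := sigma_even (PP Du) (odF Y Du) (odF Z Du).
have := dir_gFS oD X sG (sdc W) Du.
rewrite (dir_ext oD X (g := fun=> 0) _ Du) => [|v Dv]; last first.
  rewrite (GE v Dv).
  exact: (gFS_even_odd (PP Dv) (sigma_even (PP Dv) (odF _ Dv) (odF _ Dv)) (odF _ Dv)).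
rewrite dir_cst.
have -> : gFS (G u) (diff_mx (fun v => dF v W) u X) =
   gFS (sigmaCP (F u) (dF u Y) (dF u Z)) (sigmaCP (F u) (dF u X) (dF u W)).
  apply: (etrans (congr2 gFS (GE u Du) (field_diff hyp X (sc W) Du))).
  rewrite !gFSDr gFSZr (gFS_even_odd (PP Du) eS (odF _ Du)).
  by rewrite (gFS_even_odd (PP Du) eS (oN Du)) mulr0 !add0r.
have -> : gFS (diff_mx G u X) (dF u W) =
   gFS (diff_mx (fun v => diff_mx (fun w => dF w Z) v Y) u X) (dF u W)
   - gFS (diff_mx (fun v => dF v (nab Y (fun=> Z) v)) u X) (dF u W)
   - h u * gFS (diff_mx N u X) (dF u W).
  rewrite (diff_mxB oD _ (smooth_mxB oD s1 s2) s3 Du) (diff_mxB oD _ s1 s2 Du).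
  rewrite (diff_mxZ oD _ sh sN Du) !gFSBl gFSDl !gFSZl (NF _ Du).
  by rewrite mulr0 add0r.
have alg (a b c d e f : R) : f = - e -> 0 = a - b - c * e + d -> b = a + c * f + d.
  by move=> -> E0; rewrite mulrN; lra.
exact: (alg _ _ _ _ _ _ (shapeP hyp X W Du)).
Qed.

Lemma gauss X Y Z (W : 'rV[R]_n) u : D u ->
  g u (curv F u X Y Z) W =
  g u (A u Y) Z * g u (A u X) W - g u (A u X) Z * g u (A u Y) W
  + (gFS (sigmaCP (F u) (dF u Y) (dF u Z)) (sigmaCP (F u) (dF u X) (dF u W))
   - gFS (sigmaCP (F u) (dF u X) (dF u Z)) (sigmaCP (F u) (dF u Y) (dF u W))).
Proof.
move=> Du; rewrite (curvE X Y Z Du).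
apply: (etrans (metricB _ _ _ _)).
have sc T := smooth_vec_cst (D := D) T.
have := diff_mx_bracket oD (smooth_mx_diff oD sF (sc Z)) (sc X) (sc Y) Du.
have dc S T : dvec S (fun=> T) u = 0.
  by apply/rowP => l; rewrite !mxE dir_cst.
rewrite !dc subrr diff_mx0r => B0.
have B : gFS (diff_mx (fun v => diff_mx (fun w => dF w Z) v Y) u X) (dF u W) =
  gFS (diff_mx (fun v => diff_mx (fun w => dF w Z) v X) u Y) (dF u W).
  by apply: (congr1 (gFS^~ (dF u W))); apply/eqP; rewrite -subr_eq0; apply/eqP.
have alg (h1 h2 a b c d e f : R) : h1 = a + c + e -> h2 = b + d + f -> a = b ->
   h1 - h2 = c - d + (e - f) by move=> -> -> ->; ring.
exact: (alg _ _ _ _ _ _ _ _ (gauss_half X Y Z W Du) (gauss_half Y X Z W Du) B).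
Qed.

(** In the Gauss equation with xi as second and third argument, the terms of
    curvature_identity that contain J vanish, as J xi = N is normal. *)
Lemma structure_jacobiE X u : D u ->
  structure_jacobi F N u X =
  X - eta u X *: xi u + g u (A u (xi u)) (xi u) *: A u X
  - g u (A u (xi u)) X *: A u (xi u).
Proof.
move=> Du; apply: (metric_inj hyp Du) => W.
apply: (etrans (gauss X (xi u) (xi u) W Du)).
apply/esym; apply: (etrans (metric_comb1 _ _ _ _ _ _ _)).
have C : g u (X - eta u X *: xi u) W = g u X W - eta u X * g u (xi u) W.
  apply: (etrans (metricB u _ _ _)); congr (_ - _); exact: (metricZ F u _ _ _).
have tN := lh_normal_tangent hyp Du.
have K := curvature_identity_CP (lh_CP hyp Du) (tdF X Du) (tdF (xi u) Du)
   (tdF (xi u) Du) (tdF W Du).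
have Jxi : Jcp (F u) (dF u (xi u)) = N u.
  by rewrite (diff_xi hyp Du) JcpN (Jcp_JcpE hyp Du tN) opprK.
have xx : gFS (dF u (xi u)) (dF u (xi u)) = 1.
  by rewrite -metricE; exact: (eta_xi hyp Du).
have sk : g u (A u X) (xi u) = g u (A u (xi u)) X.
  exact: (etrans (shape_sym hyp _ _ Du) (metricC F u _ _)).
rewrite Jxi (NF _ Du) (NF _ Du) in K.
have alg (a b c d e f k w x y z p q r s t v : R) :
   k = x * y - r * t + 0 * p - q * 0 - 2 * s * 0 ->
   a = z - b * c -> z = y -> x = 1 -> b = r -> c = t -> d = e ->
   a + f * w - e * v = f * w - d * v + k.
  by move=> -> -> -> -> -> -> ->; ring.
exact: (alg _ _ _ _ _ _ _ _ _ _ _ _ _ _ _ _ _ K C (metricE F u X W) xx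
  (metricE F u X (xi u)) (metricE F u (xi u) W) sk).
Qed.

End StructureEquations.

(** * The torsion condition at a point *)

Section PointwiseAlgebra.
Variables (R : realFieldType) (E : lmodType R).

(** The tangent space of a hypersurface at one point: an almost contact metric
    structure and the shape operator. *)
Record shape_structure (g : E -> E -> R) (A phi : E -> E) (xi : E) : Prop :=
  ShapeStructure {
    ss_sym : forall X Y, g X Y = g Y X;
    ss_linear : forall a X Y Z, g (a *: X + Y) Z = a * g X Z + g Y Z;
    ss_ge0 : forall X, 0 <= g X X;
    ss_eq0 : forall X, g X X = 0 -> X = 0;
    ss_shape_linear : forall a X Y, A (a *: X + Y) = a *: A X + A Y;
    ss_shape_sym : forall X Y, g (A X) Y = g X (A Y);
    ss_phi_linear : forall a X Y, phi (a *: X + Y) = a *: phi X + phi Y;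
    ss_phi_skew : forall X Y, g (phi X) Y = - g X (phi Y);
    ss_phi_xi : phi xi = 0;
    ss_phi_phi : forall X, phi (phi X) = - X + g X xi *: xi;
    ss_xi_unit : g xi xi = 1 }.

Variables (g : E -> E -> R) (A phi : E -> E) (xi : E).
Hypothesis ss : shape_structure g A phi xi.

Lemma linear_additive (f : E -> E) :
  (forall a X Y, f (a *: X + Y) = a *: f X + f Y) ->
  [/\ f 0 = 0, forall X Y, f (X + Y) = f X + f Y,
      forall a X, f (a *: X) = a *: f X, forall X, f (- X) = - f X &
      forall X Y, f (X - Y) = f X - f Y].
Proof.
move=> lin; have f0 : f 0 = 0.
  have := lin 1 0 0; rewrite !scale1r add0r => /esym/eqP.
  by rewrite -subr_eq0 addrK => /eqP.
have fD X Y : f (X + Y) = f X + f Y by have := lin 1 X Y; rewrite !scale1r.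
have fZ a X : f (a *: X) = a *: f X by rewrite -[_ *: X]addr0 lin f0 addr0.
have fN X : f (- X) = - f X by rewrite -scaleN1r fZ scaleN1r.
by split=> // X Y; rewrite fD fN.
Qed.

Lemma gC X Y : g X Y = g Y X. Proof. exact: ss_sym ss X Y. Qed.
Lemma g0l Z : g 0 Z = 0.
Proof.
have := ss_linear ss 1 0 0 Z; rewrite scale1r add0r mul1r => /esym/eqP.
by rewrite -subr_eq0 addrK => /eqP.
Qed.
Lemma gDl X Y Z : g (X + Y) Z = g X Z + g Y Z.
Proof. by have := ss_linear ss 1 X Y Z; rewrite scale1r mul1r. Qed.
Lemma gZl a X Z : g (a *: X) Z = a * g X Z.
Proof. by have := ss_linear ss a X 0 Z; rewrite addr0 g0l addr0. Qed.
Lemma gNl X Z : g (- X) Z = - g X Z.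
Proof. by rewrite -scaleN1r gZl mulN1r. Qed.
Lemma g0r Z : g Z 0 = 0. Proof. by rewrite gC g0l. Qed.
Lemma gDr X Y Z : g Z (X + Y) = g Z X + g Z Y.
Proof. by rewrite gC gDl !(gC Z). Qed.
Lemma gZr a X Z : g Z (a *: X) = a * g Z X.
Proof. by rewrite gC gZl gC. Qed.
Lemma gNr X Z : g Z (- X) = - g Z X.
Proof. by rewrite gC gNl gC. Qed.
Definition gE := (gDl, gDr, gZl, gZr, gNl, gNr, g0l, g0r).

Lemma g_inj X Y : (forall Z, g X Z = g Y Z) -> X = Y.
Proof.
move=> XY; apply/eqP; rewrite -subr_eq0; apply/eqP; apply: (ss_eq0 ss).
by rewrite gDl gNl XY subrr.
Qed.

Let A_lin := linear_additive (ss_shape_linear ss).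
Let phi_lin := linear_additive (ss_phi_linear ss).

Lemma shape0 : A 0 = 0. Proof. by case: A_lin. Qed.
Lemma shapeD X Y : A (X + Y) = A X + A Y. Proof. by case: A_lin. Qed.
Lemma shapeZ a X : A (a *: X) = a *: A X. Proof. by case: A_lin. Qed.
Lemma shapeN X : A (- X) = - A X. Proof. by case: A_lin. Qed.
Lemma phi0 : phi 0 = 0. Proof. by case: phi_lin. Qed.
Lemma phiD X Y : phi (X + Y) = phi X + phi Y. Proof. by case: phi_lin. Qed.
Lemma phiZ a X : phi (a *: X) = a *: phi X. Proof. by case: phi_lin. Qed.
Lemma phiN X : phi (- X) = - phi X. Proof. by case: phi_lin. Qed.

Lemma g_shape X Y : g (A X) Y = g X (A Y). Proof. exact: ss_shape_sym ss X Y. Qed.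
Lemma g_phi X Y : g (phi X) Y = - g X (phi Y). Proof. exact: ss_phi_skew ss X Y. Qed.
Lemma g_phi_xi X : g (phi X) xi = 0.
Proof. by rewrite g_phi (ss_phi_xi ss) g0r oppr0. Qed.
Lemma g_xi_phi X : g xi (phi X) = 0. Proof. by rewrite gC g_phi_xi. Qed.
Lemma g_phi_self X : g (phi X) X = 0.
Proof. by have := g_phi X X; rewrite (gC X) => H; lra. Qed.
Lemma g_self_phi X : g X (phi X) = 0. Proof. by rewrite gC g_phi_self. Qed.
Lemma g_phi_phi X Y : g (phi X) (phi Y) = g X Y - g X xi * g Y xi.
Proof. by rewrite g_phi (ss_phi_phi ss) !gE; ring. Qed.

Definition alpha := g (A xi) xi.
(** The component of A xi orthogonal to xi, i.e. beta U in the usual notation A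
    xi = alpha xi + beta U. Working with this vector instead of beta and the
    unit vector U avoids dividing by beta. It is locked, so that rewriting with
    bilinearity does not expand it. *)
Definition wvec := locked (A xi - alpha *: xi).
(** This is beta phi U, as phi xi = 0. *)
Definition pvec := phi (A xi).
Definition beta_sqr := g wvec wvec.

(** The structure Jacobi operator in the form given by the Gauss equation. *)
Definition Rxi := locked (fun X =>
  X - g X xi *: xi + alpha *: A X - g (A xi) X *: A xi).

Lemma RxiE X :
  Rxi X = X - g X xi *: xi + alpha *: A X - g (A xi) X *: A xi.
Proof. by rewrite /Rxi -lock. Qed.

Lemma wvecE : wvec = A xi - alpha *: xi.
Proof. by rewrite /wvec -lock. Qed.

Lemma shape_xi : A xi = alpha *: xi + wvec.
Proof. by rewrite wvecE addrC subrK. Qed.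

Lemma g_wvec_xi : g wvec xi = 0.
Proof. by rewrite wvecE !gE (ss_xi_unit ss) /alpha; ring. Qed.

Lemma pvecE : pvec = phi wvec.
Proof. by rewrite wvecE phiD phiN phiZ (ss_phi_xi ss) scaler0 oppr0 addr0. Qed.

Lemma g_pvec_xi : g pvec xi = 0. Proof. exact: g_phi_xi. Qed.
Lemma g_pvec_wvec : g pvec wvec = 0. Proof. by rewrite pvecE g_phi_self. Qed.
Lemma g_pvec_pvec : g pvec pvec = beta_sqr.
Proof. by rewrite pvecE g_phi_phi g_wvec_xi mul0r subr0. Qed.

Lemma phi_pvec : phi pvec = - wvec.
Proof. by rewrite pvecE (ss_phi_phi ss) g_wvec_xi scale0r addr0. Qed.

Lemma g_pvec_Axi : g pvec (A xi) = 0. Proof. exact: g_phi_self. Qed.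
Lemma pvec_def : phi (A xi) = pvec. Proof. by []. Qed.

Lemma g_Axi Y : g (A xi) Y = alpha * g xi Y + g wvec Y.
Proof. by rewrite {1}shape_xi !gE. Qed.

Lemma g_Axi_wvec : g (A xi) wvec = beta_sqr.
Proof. by rewrite g_Axi (gC xi) g_wvec_xi mulr0 add0r. Qed.

Lemma g_Rxi X Z : g (Rxi X) Z =
  g X Z - g X xi * g xi Z + alpha * g (A X) Z - g (A xi) X * g (A xi) Z.
Proof. by rewrite RxiE !gE. Qed.

Lemma Rxi_sym X Z : g (Rxi X) Z = g X (Rxi Z).
Proof.
rewrite g_Rxi gC [g X (Rxi Z)]gC g_Rxi (g_shape X) (gC X (A Z)) (gC xi Z) (gC Z X).
by rewrite (gC xi X); ring.
Qed.

Lemma Rxi_xi : Rxi xi = 0.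
Proof.
apply: g_inj => Z; rewrite g_Rxi (ss_xi_unit ss) g0l -/alpha; ring.
Qed.

Lemma g_Rxi_xi X : g (Rxi X) xi = 0.
Proof. by rewrite Rxi_sym Rxi_xi g0r. Qed.

Definition torsion_op k X Y :=
  (g (phi (A X)) Y *: xi - g Y xi *: phi (A X) - (k * g X xi) *: phi Y)
  - (g (phi (A Y)) X *: xi - g X xi *: phi (A Y) - (k * g Y xi) *: phi X).

Variable k : R.
Hypothesis skew : forall X Y,
  torsion_op k X (Rxi Y) - Rxi (torsion_op k X Y) =
  - (torsion_op k Y (Rxi X) - Rxi (torsion_op k Y X)).
Hypothesis k_alpha : k * alpha != 1.
Hypothesis non_hopf : wvec != 0.

Lemma beta_sqr_gt0 : 0 < beta_sqr.
Proof.
rewrite lt_def (ss_ge0 ss) andbT; apply/eqP => b0.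
by move/eqP: non_hopf; apply; exact: (ss_eq0 ss).
Qed.

(** As the torsion is antisymmetric, the terms of the skew-symmetry condition in
    which R_xi acts last cancel. *)
Lemma torsion_Rxi X Y Z :
  g (torsion_op k X (Rxi Y)) Z + g (torsion_op k Y (Rxi X)) Z = 0.
Proof.
have Tanti U V : torsion_op k U V = - torsion_op k V U.
  by rewrite /torsion_op [RHS]opprB.
have RN U : Rxi (- U) = - Rxi U.
  by apply: g_inj => V; rewrite gNl !g_Rxi shapeN !gE; ring.
have := skew X Y; rewrite (Tanti Y X) RN.
move: (torsion_op k X (Rxi Y)) (Rxi (torsion_op k X Y)) (torsion_op k Y (Rxi X)).
move=> a b c.
by rewrite opprK opprD => E1; rewrite (addIr _ E1) gNl addNr.
Qed.

Lemma g_torsion X Y Z : g (torsion_op k X Y) Z =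
  g (phi (A X)) Y * g xi Z - g Y xi * g (phi (A X)) Z - k * g X xi * g (phi Y) Z
  - (g (phi (A Y)) X * g xi Z - g X xi * g (phi (A Y)) Z
     - k * g Y xi * g (phi X) Z).
Proof. by rewrite /torsion_op !gE. Qed.

(** The case where one argument is xi, which R_xi annihilates. *)
Lemma torsion_xi Y Z :
  g pvec (Rxi Y) * g xi Z - k * g (phi (Rxi Y)) Z + g (phi (A (Rxi Y))) Z = 0.
Proof.
have := torsion_Rxi xi Y Z; rewrite Rxi_xi !g_torsion g_Rxi_xi (ss_xi_unit ss).
rewrite !shape0 !phi0 !gE g_phi_xi pvec_def => H; lra.
Qed.

Lemma g_pvec_Rxi Y : g pvec (Rxi Y) = 0.
Proof.
have := torsion_xi Y xi; rewrite !g_phi_xi (ss_xi_unit ss) => H; lra.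
Qed.

Lemma phi_shape_Rxi Y : phi (A (Rxi Y)) = k *: phi (Rxi Y).
Proof.
apply: g_inj => Z; have := torsion_xi Y Z; rewrite g_pvec_Rxi gZl => H; lra.
Qed.

Lemma Rxi_pvec : Rxi pvec = 0.
Proof. by apply: g_inj => Z; rewrite Rxi_sym g0l g_pvec_Rxi. Qed.

Lemma g_Axi_pvec : g (A xi) pvec = 0. Proof. by rewrite gC g_pvec_Axi. Qed.

Lemma pvec_shape : pvec + alpha *: A pvec = 0.
Proof.
have := Rxi_pvec; rewrite RxiE g_pvec_xi g_Axi_pvec !scale0r !subr0.
by [].
Qed.

(** Otherwise pvec_shape makes pvec vanish, but pvec has the same length as
    wvec. *)
Lemma alpha_neq0 : alpha != 0.
Proof.
apply/eqP => a0; have := pvec_shape; rewrite a0 scale0r addr0 => p0.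
by have := beta_sqr_gt0; rewrite -g_pvec_pvec p0 g0l ltxx.
Qed.

Lemma shape_pvec : A pvec = - alpha^-1 *: pvec.
Proof.
have /eqP := pvec_shape; rewrite addr_eq0 => /eqP p_shape.
by rewrite {2}p_shape scaleNr scalerN opprK scalerA mulVf ?alpha_neq0 // scale1r.
Qed.

(** The xi-component of torsion_Rxi. It says that phi A + A phi commutes with
    R_xi. *)
Lemma commutation X Y :
  g (phi (A X)) (Rxi Y) - k * g (phi (Rxi Y)) X
  + (g (phi (A Y)) (Rxi X) - k * g (phi (Rxi X)) Y) = 0.
Proof.
have := torsion_Rxi X Y xi; rewrite !g_torsion !g_Rxi_xi !g_phi_xi (ss_xi_unit ss).
by rewrite !phi_shape_Rxi !gE => H; lra.
Qed.

(** For X = pvec, which lies in the kernel of R_xi, commutation gives (1/alpha -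
    k) <wvec, R_xi Y> = 0. *)
Lemma g_wvec_Rxi Y : g wvec (Rxi Y) = 0.
Proof.
have := commutation pvec Y; rewrite Rxi_pvec phi0 !gE shape_pvec phiZ phi_pvec.
rewrite !gE [g (phi (Rxi Y)) pvec]g_phi phi_pvec !gE (gC (Rxi Y)) => H.
have {H} : (alpha^-1 - k) * g wvec (Rxi Y) = 0 by lra.
move/eqP; rewrite mulf_eq0 subr_eq0 => /orP[/eqP ka|/eqP //].
by move: k_alpha; rewrite -ka mulVf ?alpha_neq0 // eqxx.
Qed.

Lemma g_Axi_Rxi Y : g (A xi) (Rxi Y) = 0.
Proof. by rewrite g_Axi (gC xi) g_Rxi_xi g_wvec_Rxi mulr0 addr0. Qed.

(** Apply phi to phi_shape_Rxi; R_xi Y is orthogonal to xi and, by g_wvec_Rxi,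
    to A xi. *)
Lemma shape_Rxi Y : A (Rxi Y) = k *: Rxi Y.
Proof.
have := congr1 phi (phi_shape_Rxi Y).
rewrite phiZ !(ss_phi_phi ss) g_shape g_Rxi_xi (gC (Rxi Y)) g_Axi_Rxi !scale0r.
by rewrite !addr0 scalerN => /oppr_inj.
Qed.

Lemma Rxi_wvec : Rxi wvec = 0.
Proof. by apply: g_inj => Z; rewrite Rxi_sym g0l g_wvec_Rxi. Qed.

Lemma shape_wvec : A wvec = beta_sqr *: xi + ((beta_sqr - 1) / alpha) *: wvec.
Proof.
have := Rxi_wvec; rewrite RxiE g_wvec_xi g_Axi_wvec scale0r subr0 shape_xi.
move=> H; apply: g_inj => Z; have := congr1 (g^~ Z) H; rewrite !gE => {}H.
apply: (mulfI alpha_neq0).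
have -> : alpha * (beta_sqr * g xi Z + (beta_sqr - 1) / alpha * g wvec Z) =
    alpha * beta_sqr * g xi Z + (beta_sqr - 1) * g wvec Z by field; exact: alpha_neq0.
by lra.
Qed.

(** Since phi A + A phi commutes with R_xi, it preserves the image of R_xi,
    where A = k. For Z in that image this gives A (A (phi Z)) = k^2 phi Z. Also
    R_xi (phi Z) lies in the image, and the two facts combine to (1 - k alpha)
    (A (phi Z) - k phi Z) = 0. *)
Lemma shape_phi_Rxi Y : A (phi (Rxi Y)) = k *: phi (Rxi Y).
Proof.
set Z := Rxi Y; pose B X := phi (A X) + A (phi X).
have BZ : B Z = Rxi (B Y).
  apply: g_inj => X; rewrite Rxi_sym /B !gE g_shape (g_shape (phi Y)) !shape_Rxi.
  rewrite phiZ !gE; have := commutation X Y; rewrite -/Z (g_phi (A X)).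
  by rewrite (gC (A X)) (g_phi (Rxi X)) (gC (Rxi X) (phi Y)) => H; lra.
have AB : A (B Z) = k *: B Z by rewrite BZ shape_Rxi.
have AS := shape_Rxi (phi Z).
have SZ : Rxi (phi Z) = phi Z + alpha *: A (phi Z).
  rewrite RxiE g_phi_xi (gC (A xi)) g_phi pvec_def gC g_pvec_Rxi oppr0.
  by rewrite !scale0r !subr0.
rewrite SZ shapeD shapeZ in AS.
rewrite /B shape_Rxi phiZ shapeD shapeZ scalerDr in AB.
have AA : A (A (phi Z)) = k *: (k *: phi Z).
  by apply: (addrI (k *: A (phi Z))); rewrite AB addrC.
apply: g_inj => X; have := congr1 (g^~ X) AS; rewrite AA !gE => H.
have {H} : (1 - k * alpha) * (g (A (phi Z)) X - k * g (phi Z) X) = 0.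
  by move: H; lra.
move/eqP; rewrite mulf_eq0 !subr_eq0 => /orP[/eqP ka|/eqP //].
by move: k_alpha; rewrite -ka eqxx.
Qed.

Lemma Rxi_Rxi X : Rxi (Rxi X) = (1 + k * alpha) *: Rxi X.
Proof.
rewrite RxiE g_Rxi_xi g_Axi_Rxi shape_Rxi !scale0r !subr0 scalerA.
by rewrite scalerDl scale1r mulrC.
Qed.

(** By Rxi_Rxi, R_xi would otherwise square to zero, but it is self-adjoint. *)
Lemma one_k_alpha X : Rxi X != 0 -> 1 + k * alpha != 0.
Proof.
apply: contra_neq => ka; apply: (ss_eq0 ss).
by rewrite Rxi_sym Rxi_Rxi ka scale0r g0r.
Qed.

End PointwiseAlgebra.

(** * Excluding non-Hopf points *)

Section DifferentialPart.
Variables (R : realFieldType) (E : lmodType R) (T : Type) (D : T -> Prop).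

(** The rules of calculus on a hypersurface of CP^m: d and nab are the
    derivative of functions and the Levi-Civita connection, sc and sv stand for
    smooth functions and vector fields. *)
Record hypersurface_calculus (g : T -> E -> E -> R) (A phi : T -> E -> E)
    (xi : T -> E) (d : E -> (T -> R) -> T -> R) (nab : E -> (T -> E) -> T -> E)
    (sc : (T -> R) -> Prop) (sv : (T -> E) -> Prop) : Prop :=
  HypersurfaceCalculus {
    hc_point : forall u, D u -> shape_structure (g u) (A u) (phi u) (xi u);
    hc_sc_ext : forall f h, (forall v, D v -> f v = h v) -> sc f -> sc h;
    hc_sc_cst : forall c, sc (fun=> c);
    hc_sc_add : forall f h, sc f -> sc h -> sc (fun v => f v + h v);
    hc_sc_mul : forall f h, sc f -> sc h -> sc (fun v => f v * h v);
    hc_sc_inv : forall f, sc f -> (forall v, D v -> f v != 0) -> sc (fun v => (f v)^-1);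
    hc_sv_ext : forall V W, (forall v, D v -> V v = W v) -> sv V -> sv W;
    hc_sv_cst : forall X, sv (fun=> X);
    hc_sv_add : forall V W, sv V -> sv W -> sv (fun v => V v + W v);
    hc_sv_scale : forall f V, sc f -> sv V -> sv (fun v => f v *: V v);
    hc_sv_xi : sv xi;
    hc_sv_shape : forall V, sv V -> sv (fun v => A v (V v));
    hc_sv_phi : forall V, sv V -> sv (fun v => phi v (V v));
    hc_sc_metric : forall V W, sv V -> sv W -> sc (fun v => g v (V v) (W v));
    hc_d_ext : forall X f h u, (forall v, D v -> f v = h v) -> D u ->
      d X f u = d X h u;
    hc_d_cst : forall X c u, d X (fun=> c) u = 0;
    hc_d_add : forall X f h u, sc f -> sc h -> D u ->
      d X (fun v => f v + h v) u = d X f u + d X h u;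
    hc_d_mul : forall X f h u, sc f -> sc h -> D u ->
      d X (fun v => f v * h v) u = d X f u * h u + f u * d X h u;
    hc_d_scale : forall a X f u, d (a *: X) f u = a * d X f u;
    hc_d_bracket : forall V W f u, sv V -> sv W -> sc f -> D u ->
      d (V u) (fun v => d (W v) f v) u - d (W u) (fun v => d (V v) f v) u =
      d (nab (V u) W u - nab (W u) V u) f u;
    hc_nab_ext : forall X V W u, (forall v, D v -> V v = W v) -> D u ->
      nab X V u = nab X W u;
    hc_nab_add : forall X V W u, sv V -> sv W -> D u ->
      nab X (fun v => V v + W v) u = nab X V u + nab X W u;
    hc_nab_scale : forall X f V u, sc f -> sv V -> D u ->
      nab X (fun v => f v *: V v) u = d X f u *: V u + f u *: nab X V u;
    hc_nab_metric : forall X V W u, sv V -> sv W -> D u ->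
      d X (fun v => g v (V v) (W v)) u =
      g u (nab X V u) (W u) + g u (V u) (nab X W u);
    hc_nab_xi : forall X u, D u -> nab X xi u = phi u (A u X);
    hc_nab_phi : forall X V u, sv V -> D u ->
      nab X (fun v => phi v (V v)) u = phi u (nab X V u)
        + g u (V u) (xi u) *: A u X - g u (A u X) (V u) *: xi u;
    hc_codazzi : forall V W u, sv V -> sv W -> D u ->
      nab (V u) (fun v => A v (W v)) u - A u (nab (V u) W u)
      - (nab (W u) (fun v => A v (V v)) u - A u (nab (W u) V u)) =
      g u (V u) (xi u) *: phi u (W u) - g u (W u) (xi u) *: phi u (V u)
      - (2 * g u (phi u (V u)) (W u)) *: xi u }.

Variables (g : T -> E -> E -> R) (A phi : T -> E -> E)
  (xi : T -> E) (d : E -> (T -> R) -> T -> R) (nab : E -> (T -> E) -> T -> E)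
  (sc : (T -> R) -> Prop) (sv : (T -> E) -> Prop).
Hypothesis hc : hypersurface_calculus g A phi xi d nab sc sv.

Implicit Types (u v : T) (X Y Z : E) (V W : T -> E) (f h : T -> R).

Let pt u (Du : D u) := hc_point hc Du.

Definition al u := alpha (g u) (A u) (xi u).
Definition Wf u := wvec (g u) (A u) (xi u).
Definition Pf u := pvec (A u) (phi u) (xi u).
Definition bf u := beta_sqr (g u) (A u) (xi u).

Lemma sc_opp f : sc f -> sc (fun v => - f v).
Proof.
move=> sf; apply: (hc_sc_ext hc _ (hc_sc_mul hc (hc_sc_cst hc (-1)) sf)) => v _.
by rewrite mulN1r.
Qed.

Lemma sc_al : sc al.
Proof. exact: (hc_sc_metric hc (hc_sv_shape hc (hc_sv_xi hc)) (hc_sv_xi hc)). Qed.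

Lemma sv_Wf : sv Wf.
Proof.
have s := hc_sv_add hc (hc_sv_shape hc (hc_sv_xi hc)) (hc_sv_scale hc (sc_opp sc_al) (hc_sv_xi hc)).
by apply: (hc_sv_ext hc _ s) => v _; rewrite /Wf wvecE scaleNr.
Qed.

Lemma sv_Pf : sv Pf.
Proof. exact: (hc_sv_phi hc (hc_sv_shape hc (hc_sv_xi hc))). Qed.

Lemma sc_bf : sc bf.
Proof. exact: (hc_sc_metric hc sv_Wf sv_Wf). Qed.

Lemma codazzi_test V W u Z : sv V -> sv W -> D u ->
  g u (nab (V u) (fun v => A v (W v)) u) Z - g u (nab (V u) W u) (A u Z)
  - (g u (nab (W u) (fun v => A v (V v)) u) Z - g u (nab (W u) V u) (A u Z)) =
  g u (V u) (xi u) * g u (phi u (W u)) Z - g u (W u) (xi u) * g u (phi u (V u)) Z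
  - 2 * g u (phi u (V u)) (W u) * g u (xi u) Z.
Proof.
move=> sV sW Du; have := congr1 ((g u)^~ Z) (hc_codazzi hc sV sW Du).
by rewrite !(gE (pt Du)) !(g_shape (pt Du)).
Qed.

Lemma nab_comb1 X V f V1 u Z : sc f -> sv V1 -> D u ->
  (forall v, D v -> V v = f v *: V1 v) ->
  g u (nab X V u) Z = d X f u * g u (V1 u) Z + f u * g u (nab X V1 u) Z.
Proof.
move=> sf sV Du VE; rewrite (hc_nab_ext hc X VE Du) (hc_nab_scale hc X sf sV Du).
by rewrite !(gE (pt Du)).
Qed.

Lemma nab_comb2 X V f1 V1 f2 V2 u Z : sc f1 -> sv V1 -> sc f2 -> sv V2 -> D u ->
  (forall v, D v -> V v = f1 v *: V1 v + f2 v *: V2 v) ->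
  g u (nab X V u) Z =
  d X f1 u * g u (V1 u) Z + f1 u * g u (nab X V1 u) Z +
  (d X f2 u * g u (V2 u) Z + f2 u * g u (nab X V2 u) Z).
Proof.
move=> s1 sV1 s2 sV2 Du VE; rewrite (hc_nab_ext hc X VE Du).
rewrite (hc_nab_add hc X (hc_sv_scale hc s1 sV1) (hc_sv_scale hc s2 sV2) Du).
rewrite (hc_nab_scale hc X s1 sV1 Du) (hc_nab_scale hc X s2 sV2 Du).
by rewrite !(gE (pt Du)).
Qed.

Lemma nab_orth X V W c u : sv V -> sv W -> D u ->
  (forall v, D v -> g v (V v) (W v) = c) ->
  g u (nab X V u) (W u) = - g u (V u) (nab X W u).
Proof.
move=> sV sW Du gc; have := hc_nab_metric hc X sV sW Du.
by rewrite (hc_d_ext hc X gc Du) (hc_d_cst hc) => H; lra.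
Qed.

Lemma nab_norm X V u : sv V -> D u ->
  g u (nab X V u) (V u) = d X (fun v => g v (V v) (V v)) u / 2.
Proof.
move=> sV Du; rewrite (hc_nab_metric hc X sV sV Du).
by rewrite (gC (pt Du) (V u)); lra.
Qed.

Lemma nab_orth_xi X V u : sv V -> D u ->
  (forall v, D v -> g v (V v) (xi v) = 0) ->
  g u (nab X V u) (xi u) = - g u (V u) (phi u (A u X)).
Proof.
move=> sV Du V0; rewrite (nab_orth X sV (hc_sv_xi hc) Du V0).
by rewrite (hc_nab_xi hc X Du).
Qed.

Variable k : R.
Hypothesis k_neq0 : k != 0.
Hypothesis skew : forall u, D u -> forall X Y,
  torsion_op (g u) (A u) (phi u) (xi u) k X (Rxi (g u) (A u) (xi u) Y)
  - Rxi (g u) (A u) (xi u) (torsion_op (g u) (A u) (phi u) (xi u) k X Y) =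
  - (torsion_op (g u) (A u) (phi u) (xi u) k Y (Rxi (g u) (A u) (xi u) X)
     - Rxi (g u) (A u) (xi u) (torsion_op (g u) (A u) (phi u) (xi u) k Y X)).
Hypothesis k_al : forall u, D u -> k * al u != 1.
Hypothesis non_hopf : forall u, D u -> Wf u != 0.

Let al0 u (Du : D u) : al u != 0 := alpha_neq0 (pt Du) (skew Du) (non_hopf Du).
Let b0 u (Du : D u) : 0 < bf u := beta_sqr_gt0 (pt Du) (non_hopf Du).

Let AxiE u (Du : D u) : A u (xi u) = al u *: xi u + Wf u.
Proof. exact: shape_xi. Qed.
Let AWE u (Du : D u) :
  A u (Wf u) = bf u *: xi u + ((bf u - 1) / al u) *: Wf u.
Proof. exact: (shape_wvec (pt Du) (skew Du) (k_al Du) (non_hopf Du)). Qed.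
Let APE u (Du : D u) : A u (Pf u) = - (al u)^-1 *: Pf u.
Proof. exact: (shape_pvec (pt Du) (skew Du) (non_hopf Du)). Qed.
Let phiW u (Du : D u) : phi u (Wf u) = Pf u.
Proof. by rewrite /Pf (pvecE (pt Du)). Qed.
Let phiP u (Du : D u) : phi u (Pf u) = - Wf u.
Proof. exact: (phi_pvec (pt Du)). Qed.

Let gWxi u (Du : D u) : g u (Wf u) (xi u) = 0 := g_wvec_xi (pt Du).
Let gPxi u (Du : D u) : g u (Pf u) (xi u) = 0 := g_pvec_xi (pt Du).
Let gPW u (Du : D u) : g u (Pf u) (Wf u) = 0 := g_pvec_wvec (pt Du).
Let gPP u (Du : D u) : g u (Pf u) (Pf u) = bf u := g_pvec_pvec (pt Du).
Let gWW u : g u (Wf u) (Wf u) = bf u. Proof. by []. Qed.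
Let gxx u (Du : D u) : g u (xi u) (xi u) = 1 := ss_xi_unit (pt Du).
Let gxW u (Du : D u) : g u (xi u) (Wf u) = 0.
Proof. by rewrite (gC (pt Du)) gWxi. Qed.
Let gxP u (Du : D u) : g u (xi u) (Pf u) = 0.
Proof. by rewrite (gC (pt Du)) gPxi. Qed.
Let gWP u (Du : D u) : g u (Wf u) (Pf u) = 0.
Proof. by rewrite (gC (pt Du)) gPW. Qed.

Let gamma u := (bf u - 1) / al u.
Lemma sc_gamma : sc gamma.
Proof.
exact: (hc_sc_mul hc (hc_sc_add hc sc_bf (hc_sc_cst hc (-1)))
   (hc_sc_inv hc sc_al (fun v Dv => al0 Dv))).
Qed.

Section Eigenfield.
Variables (X : T -> E) (mu : T -> R).
Hypothesis sX : sv X.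
Hypothesis smu : sc mu.
Hypothesis Xxi : forall v, D v -> g v (X v) (xi v) = 0.
Hypothesis XW : forall v, D v -> g v (X v) (Wf v) = 0.
Hypothesis XP : forall v, D v -> g v (X v) (Pf v) = 0.
Hypothesis AX : forall v, D v -> A v (X v) = mu v *: X v.
Hypothesis AphiX : forall v, D v -> A v (phi v (X v)) = mu v *: phi v (X v).

Let gphiXX u (Du : D u) : g u (phi u (X u)) (phi u (X u)) = g u (X u) (X u).
Proof. by rewrite (g_phi_phi (pt Du)) Xxi // mul0r subr0. Qed.

(** Codazzi equation for X and xi, tested on phi X. The derivative of xi along X
    is phi A X = mu phi X, and the unknown derivatives of X along xi cancel
    because phi X belongs to the same eigenvalue as X. *)
Lemma eigen_xi u : D u ->
  al u * mu u * g u (X u) (X u) + g u (nab (X u) Wf u) (phi u (X u))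
  - mu u ^+ 2 * g u (X u) (X u) = - g u (X u) (X u).
Proof.
move=> Du; have := codazzi_test (phi u (X u)) sX (hc_sv_xi hc) Du.
have E1 v : D v -> A v (xi v) = al v *: xi v + 1 *: Wf v.
  by move=> Dv; rewrite scale1r; exact: AxiE.
rewrite (nab_comb2 (X u) (phi u (X u)) sc_al (hc_sv_xi hc) (hc_sc_cst hc 1) sv_Wf Du E1).
rewrite (nab_comb1 (xi u) (phi u (X u)) smu sX Du AX).
rewrite (hc_d_cst hc) (hc_nab_xi hc _ Du) AX // (phiZ (pt Du)) AphiX //.
rewrite (ss_phi_xi (pt Du)) !(gE (pt Du)) !(g_xi_phi (pt Du)).
rewrite (g_self_phi (pt Du)) (g_phi_xi (pt Du)) gphiXX // gxx //.
by move=> H; lra.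
Qed.

(** Codazzi equation for X and wvec, tested on phi X. *)
Lemma eigen_wvec u : D u ->
  bf u * mu u * g u (X u) (X u)
  + (gamma u - mu u) * g u (nab (X u) Wf u) (phi u (X u)) = 0.
Proof.
move=> Du; have := codazzi_test (phi u (X u)) sX sv_Wf Du.
rewrite (nab_comb2 (X u) (phi u (X u)) sc_bf (hc_sv_xi hc) sc_gamma sv_Wf Du AWE).
rewrite (nab_comb1 (Wf u) (phi u (X u)) smu sX Du AX).
rewrite (hc_nab_xi hc _ Du) AX // (phiZ (pt Du)) AphiX //.
have WpX : g u (Wf u) (phi u (X u)) = 0.
  by rewrite (gC (pt Du)) (g_phi (pt Du)) phiW // XP // oppr0.
rewrite !(gE (pt Du)) !(g_xi_phi (pt Du)) WpX Xxi // gWxi //.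
rewrite (g_self_phi (pt Du)) gphiXX //.
by move=> H; lra.
Qed.

(** Codazzi equation for X and pvec, tested on X. By nab_phi the derivative of
    pvec = phi wvec is phi of that of wvec; the eigenvalue of pvec is -1/alpha. *)
Lemma eigen_pvec u : D u -> (forall Y, d Y mu u = 0) ->
  ((al u)^-1 + mu u) * g u (nab (X u) Wf u) (phi u (X u)) = 0.
Proof.
move=> Du dmu; have := codazzi_test (X u) sX sv_Pf Du.
have sl := sc_opp (hc_sc_inv hc sc_al (fun v Dv => al0 Dv)).
rewrite (nab_comb1 (X u) (X u) sl sv_Pf Du APE).
rewrite (nab_comb1 (Pf u) (X u) smu sX Du AX) dmu.
have E1 : g u (nab (X u) Pf u) (X u) = - g u (nab (X u) Wf u) (phi u (X u)).
  have phiWE v : D v -> Pf v = phi v (Wf v) by move=> Dv; rewrite phiW.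
  rewrite (hc_nab_ext hc _ phiWE Du) (hc_nab_phi hc _ sv_Wf Du) gWxi //.
  by rewrite !(gE (pt Du)) (gC (pt Du) (xi u)) Xxi // (g_phi (pt Du)); ring.
rewrite AX // !(gE (pt Du)) E1 (gC (pt Du) (Pf u)) XP // (gC (pt Du) (xi u)).
rewrite Xxi // gPxi // => H; lra.
Qed.

End Eigenfield.

(** The fields R_xi X are eigenfields for the constant k, and k differs from the
    eigenvalue -1/alpha of pvec by one_k_alpha. So eigen_pvec gives <nab_Y wvec,
    phi Y> = 0 for Y = R_xi X, and eigen_wvec becomes beta^2 k |Y|^2 = 0. *)
Lemma Rxi_eq0 u X : D u -> Rxi (g u) (A u) (xi u) X = 0.
Proof.
move=> Du; apply/eqP; apply: contraT => S0.
(* The constant field X is turned into a smooth field in the image of R_xi. *)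
pose Y v := Rxi (g v) (A v) (xi v) X.
have sX := hc_sv_cst hc X.
have sY : sv Y.
  have s1 := hc_sv_add hc sX (hc_sv_scale hc (sc_opp (hc_sc_metric hc sX (hc_sv_xi hc))) (hc_sv_xi hc)).
  have s2 := hc_sv_add hc s1 (hc_sv_scale hc sc_al (hc_sv_shape hc sX)).
  have sA := hc_sv_shape hc (hc_sv_xi hc).
  have s3 := hc_sv_add hc s2 (hc_sv_scale hc (sc_opp (hc_sc_metric hc sA sX)) sA).
  by apply: (hc_sv_ext hc _ s3) => v _; rewrite /Y RxiE !scaleNr.
have Yxi v : D v -> g v (Y v) (xi v) = 0 by move=> Dv; exact: (g_Rxi_xi (pt Dv)).
have YW v : D v -> g v (Y v) (Wf v) = 0.
  move=> Dv; rewrite (gC (pt Dv)).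
  exact: (g_wvec_Rxi (pt Dv) (skew Dv) (k_al Dv) (non_hopf Dv)).
have YP v : D v -> g v (Y v) (Pf v) = 0.
  by move=> Dv; rewrite (gC (pt Dv)); exact: (g_pvec_Rxi (pt Dv) (skew Dv)).
have AY v : D v -> A v (Y v) = k *: Y v.
  by move=> Dv; exact: (shape_Rxi (pt Dv) (skew Dv) (k_al Dv) (non_hopf Dv)).
have AphiY v : D v -> A v (phi v (Y v)) = k *: phi v (Y v).
  by move=> Dv; exact: (shape_phi_Rxi (pt Dv) (skew Dv) (k_al Dv) (non_hopf Dv)).
have scK := hc_sc_cst hc k.
have H3 := eigen_pvec sY scK Yxi YP AY Du (fun Z => hc_d_cst hc Z k u).
have H2 := eigen_wvec sY scK Yxi YP AY AphiY Du.
have ka := one_k_alpha (pt Du) (skew Du) (k_al Du) (non_hopf Du) S0.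
have a0 : g u (nab (Y u) Wf u) (phi u (Y u)) = 0.
  move/eqP: H3; rewrite mulf_eq0 => /orP[/eqP kl|/eqP //]; exfalso.
  move/eqP: ka; apply; rewrite -/(al u).
  have -> : 1 + k * al u = al u * ((al u)^-1 + k) by field; exact: al0.
  by rewrite kl mulr0.
move/eqP: H2; rewrite a0 mulr0 addr0 !mulf_eq0 (gt_eqF (b0 Du)) (negbTE k_neq0) /=.
by move=> /eqP/(ss_eq0 (pt Du)) Y0; move: S0; rewrite -/(Y u) Y0 eqxx.
Qed.

(** This is R_xi X = 0 solved for A X. *)
Lemma eigen_complement u X : D u -> g u X (xi u) = 0 -> g u X (Wf u) = 0 ->
  A u X = - (al u)^-1 *: X.
Proof.
move=> Du Xxi XW; have := Rxi_eq0 X Du; rewrite RxiE Xxi (g_Axi (pt Du)).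
rewrite -/(al u) -/(Wf u) (gC (pt Du) (xi u)) Xxi (gC (pt Du) (Wf u)) XW.
rewrite mulr0 addr0 !scale0r !subr0 => /eqP; rewrite addr_eq0 => /eqP E1.
by rewrite {2}E1 scaleNr scalerN opprK scalerA mulVf ?al0 // scale1r.
Qed.

(** Subtracting components turns any vector into a smooth field orthogonal to
    xi, wvec and pvec, without a choice of local frame. *)
Definition proj X v := locked (X + (- g v X (xi v)) *: xi v
  + (- (g v X (Wf v) * (bf v)^-1)) *: Wf v
  + (- (g v X (Pf v) * (bf v)^-1)) *: Pf v).

Lemma projE X v : proj X v = X + (- g v X (xi v)) *: xi v
  + (- (g v X (Wf v) * (bf v)^-1)) *: Wf v
  + (- (g v X (Pf v) * (bf v)^-1)) *: Pf v.
Proof. by rewrite /proj -lock. Qed.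

Lemma sv_proj X : sv (proj X).
Proof.
have sX := hc_sv_cst hc X.
have sb := hc_sc_inv hc sc_bf (fun v Dv => lt0r_neq0 (b0 Dv)).
have s1 := hc_sv_add hc sX (hc_sv_scale hc (sc_opp (hc_sc_metric hc sX (hc_sv_xi hc))) (hc_sv_xi hc)).
have s2 := hc_sv_add hc s1
  (hc_sv_scale hc (sc_opp (hc_sc_mul hc (hc_sc_metric hc sX sv_Wf) sb)) sv_Wf).
have s3 := hc_sv_add hc s2
  (hc_sv_scale hc (sc_opp (hc_sc_mul hc (hc_sc_metric hc sX sv_Pf) sb)) sv_Pf).
by apply: (hc_sv_ext hc _ s3) => v _; rewrite projE.
Qed.

Lemma proj_xi X v : D v -> g v (proj X v) (xi v) = 0.
Proof.
by move=> Dv; rewrite projE !(gE (pt Dv)) gxx // gWxi // gPxi //; ring.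
Qed.

Lemma proj_Wf X v : D v -> g v (proj X v) (Wf v) = 0.
Proof.
move=> Dv; rewrite projE !(gE (pt Dv)) gxW // gPW // gWW.
by field; exact: lt0r_neq0 (b0 Dv).
Qed.

Lemma proj_Pf X v : D v -> g v (proj X v) (Pf v) = 0.
Proof.
move=> Dv; rewrite projE !(gE (pt Dv)) gxP // gWP // gPP //.
by field; exact: lt0r_neq0 (b0 Dv).
Qed.

Lemma shape_proj X v : D v -> A v (proj X v) = - (al v)^-1 *: proj X v.
Proof.
by move=> Dv; apply: eigen_complement => //; [exact: proj_xi|exact: proj_Wf].
Qed.

Lemma shape_phi_proj X v : D v ->
  A v (phi v (proj X v)) = - (al v)^-1 *: phi v (proj X v).
Proof.
move=> Dv; apply: eigen_complement => //; first exact: (g_phi_xi (pt Dv)).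
by rewrite (g_phi (pt Dv)) phiW // proj_Pf // oppr0.
Qed.

Hypothesis enough_room : forall u X1 X2 X3, D u ->
  exists X, [/\ X != 0, g u X X1 = 0, g u X X2 = 0 & g u X X3 = 0].

(** For a field X orthogonal to xi, wvec and pvec, the eigenvalue is mu =
    -1/alpha by eigen_complement. Then eigen_xi gives <nab_X wvec, phi X> = mu^2
    |X|^2, and eigen_wvec becomes beta^2 mu (1 - mu^2) |X|^2 = 0. *)
Lemma alpha_sqr u : D u -> al u * al u = 1.
Proof.
move=> Du; have [X [X0 X1 X2 X3]] := enough_room (xi u) (Wf u) (Pf u) Du.
have pX : proj X u = X.
  by rewrite projE X1 X2 X3 !mul0r !oppr0 !scale0r !addr0.
have N0 : g u X X != 0 by apply: contra_neq X0; exact: (ss_eq0 (pt Du)).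
have sl : sc (fun v => - (al v)^-1) := sc_opp (hc_sc_inv hc sc_al (fun v Dv => al0 Dv)).
have H1 := eigen_xi (sv_proj X) sl (proj_xi X) (shape_proj X)
  (shape_phi_proj X) Du.
have H2 := eigen_wvec (sv_proj X) sl (proj_xi X) (proj_Pf X) (shape_proj X)
  (shape_phi_proj X) Du.
move: H1 H2; rewrite pX /gamma.
set a := g u (nab _ _ _) _; set N := g u X X in N0 *.
have an := al0 Du; have bn := lt0r_neq0 (b0 Du).
have -> : al u * - (al u)^-1 * N = - N by field.
move=> H1.
have {H1} -> : a = (al u)^-1 ^+ 2 * N by rewrite sqrrN in H1; lra.
have -> : bf u * - (al u)^-1 * N +
  ((bf u - 1) / al u - - (al u)^-1) * ((al u)^-1 ^+ 2 * N) =
  bf u * N * (al u)^-1 ^+ 3 * (1 - al u * al u) by field.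
move/eqP; rewrite !mulf_eq0 (negbTE bn) (negbTE N0) !invr_eq0 (negbTE an) /=.
by rewrite subr_eq0 => /eqP.
Qed.

Let inv_al u (Du : D u) : (al u)^-1 = al u.
Proof.
have an := al0 Du; apply: (mulfI an); rewrite alpha_sqr // mulfV //.
Qed.

Lemma d_al X u : D u -> d X al u = 0.
Proof.
move=> Du; have := hc_d_mul hc X sc_al sc_al Du.
rewrite (hc_d_ext hc X alpha_sqr Du) (hc_d_cst hc) => H.
have : al u * d X al u = 0 by lra.
by move/eqP; rewrite mulf_eq0 (negbTE (al0 Du)) => /eqP.
Qed.

Let AWE' u (Du : D u) :
  A u (Wf u) = bf u *: xi u + (al u * (bf u - 1)) *: Wf u.
Proof. by rewrite AWE // inv_al // [_ * al u]mulrC. Qed.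

Let APE' u (Du : D u) : A u (Pf u) = (- al u) *: Pf u.
Proof. by rewrite APE // inv_al. Qed.

Let AprojE X u (Du : D u) : A u (proj X u) = (- al u) *: proj X u.
Proof. by rewrite shape_proj // inv_al. Qed.

Let AxiE' u : D u -> A u (xi u) = al u *: xi u + 1 *: Wf u.
Proof. by move=> Du; rewrite scale1r AxiE. Qed.

Let phiAW u (Du : D u) : phi u (A u (Wf u)) = (al u * (bf u - 1)) *: Pf u.
Proof.
rewrite AWE' // (phiD (pt Du)) !(phiZ (pt Du)) (ss_phi_xi (pt Du)) phiW //.
by rewrite scaler0 add0r.
Qed.

Let phiAP u (Du : D u) : phi u (A u (Pf u)) = al u *: Wf u.
Proof. by rewrite APE' // (phiZ (pt Du)) phiP // scalerN scaleNr opprK. Qed.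

Let phiAxi u : phi u (A u (xi u)) = Pf u. Proof. by []. Qed.

Let scN := sc_opp sc_al.
Let sc_g : sc (fun v => al v * (bf v - 1)).
Proof. exact: (hc_sc_mul hc sc_al (hc_sc_add hc sc_bf (hc_sc_cst hc (-1)))). Qed.

(** Codazzi equation for X = proj X0 and xi, tested on xi. Together with d_xi_b
    and nab_xi_W_P it determines the derivative of wvec along xi. *)
Lemma nab_xi_wvec_proj X u : D u -> g u (proj X u) (nab (xi u) Wf u) = 0.
Proof.
move=> Du; have sX := sv_proj X.
have := codazzi_test (xi u) sX (hc_sv_xi hc) Du.
rewrite (nab_comb2 (proj X u) (xi u) sc_al (hc_sv_xi hc) (hc_sc_cst hc 1) sv_Wf Du AxiE').
rewrite (nab_comb1 (xi u) (xi u) scN sX Du (fun v Dv => AprojE X Dv)).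
rewrite (nab_orth_xi _ sv_Wf Du gWxi) (nab_orth_xi _ sX Du (proj_xi X)).
rewrite !(hc_nab_xi hc _ Du) phiAxi !(g_phi_xi (pt Du)) AxiE // AprojE //.
rewrite (phiZ (pt Du)) !(gE (pt Du)) !(g_phi_xi (pt Du)) gxx // gWxi // proj_xi //.
rewrite (g_phi (pt Du) (proj X u)) phiW // proj_Pf //.
rewrite (gC (pt Du) (Wf u) (phi u _)) (g_phi (pt Du) (proj X u)) phiW // proj_Pf //.
rewrite (d_al _ Du) (hc_d_cst hc) (nab_orth_xi _ sX Du (proj_xi X)) phiAxi proj_Pf //.
rewrite (nab_orth _ sX sv_Wf Du (proj_Wf X)) => H; lra.
Qed.

Let nab_WW X u (Du : D u) : g u (nab X Wf u) (Wf u) = d X bf u / 2.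
Proof. exact: (nab_norm X sv_Wf Du). Qed.

(** Codazzi equation for xi and wvec, tested on xi. *)
Lemma d_xi_b u : D u -> d (xi u) bf u = 0.
Proof.
move=> Du; have := codazzi_test (xi u) (hc_sv_xi hc) sv_Wf Du.
rewrite (nab_comb2 (xi u) (xi u) sc_bf (hc_sv_xi hc) sc_g sv_Wf Du AWE').
rewrite (nab_comb2 (Wf u) (xi u) sc_al (hc_sv_xi hc) (hc_sc_cst hc 1) sv_Wf Du AxiE').
rewrite !(nab_orth_xi _ sv_Wf Du gWxi) !(hc_nab_xi hc _ Du) phiAxi phiAW //.
rewrite AxiE // !(gE (pt Du)) (nab_orth_xi _ sv_Wf Du gWxi) nab_WW //.
rewrite phiAxi (ss_phi_xi (pt Du)) !(gE (pt Du)) !(g_phi_xi (pt Du)).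
rewrite ?gxx // ?gWxi // ?gPxi // ?gWP // ?gPW // (d_al _ Du) (hc_d_cst hc) => H.
by lra.
Qed.

Let d_gamma X u (Du : D u) : d X (fun v => al v * (bf v - 1)) u = al u * d X bf u.
Proof.
rewrite (hc_d_mul hc X sc_al (hc_sc_add hc sc_bf (hc_sc_cst hc (-1))) Du) d_al // mul0r.
by rewrite add0r (hc_d_add hc X sc_bf (hc_sc_cst hc (-1)) Du) (hc_d_cst hc) addr0.
Qed.

(** Codazzi equation for xi and wvec, tested on wvec. *)
Lemma d_W_b u : D u -> d (Wf u) bf u = 0.
Proof.
move=> Du; have := codazzi_test (Wf u) (hc_sv_xi hc) sv_Wf Du.
rewrite (nab_comb2 (xi u) (Wf u) sc_bf (hc_sv_xi hc) sc_g sv_Wf Du AWE').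
rewrite (nab_comb2 (Wf u) (Wf u) sc_al (hc_sv_xi hc) (hc_sc_cst hc 1) sv_Wf Du AxiE').
rewrite !(hc_nab_xi hc _ Du) phiAxi phiAW // !nab_WW //.
rewrite AWE' // !(gE (pt Du)) (nab_orth_xi _ sv_Wf Du gWxi) nab_WW //.
rewrite phiAxi (ss_phi_xi (pt Du)) phiW // !(gE (pt Du)).
rewrite ?gxx // ?gWxi // ?gPxi // ?gWP // ?gPW // ?gxW // ?gxP //.
rewrite (d_al _ Du) (hc_d_cst hc) d_gamma // (d_xi_b Du) => H.
by lra.
Qed.

(** Codazzi equation for xi and pvec, tested on xi. *)
Lemma nab_xi_W_P u : D u -> g u (nab (xi u) Wf u) (Pf u) = - 4 * al u * bf u.
Proof.
move=> Du; have := codazzi_test (xi u) (hc_sv_xi hc) sv_Pf Du.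
rewrite (nab_comb1 (xi u) (xi u) scN sv_Pf Du APE').
rewrite (nab_comb2 (Pf u) (xi u) sc_al (hc_sv_xi hc) (hc_sc_cst hc 1) sv_Wf Du AxiE').
rewrite !(hc_nab_xi hc _ Du) phiAP // AxiE // !(gE (pt Du)).
rewrite !(nab_orth_xi _ sv_Wf Du gWxi) !(nab_orth_xi _ sv_Pf Du gPxi).
rewrite (nab_orth _ sv_Pf sv_Wf Du gPW) ?phiAxi ?phiAP // ?phiP // (ss_phi_xi (pt Du)).
rewrite (gC (pt Du) (Pf u) (nab _ _ _)) !(gE (pt Du)).
rewrite ?gxx // ?gWxi // ?gPxi // ?gWP // ?gPW // ?gxW // ?gxP // ?gPP // gWW.
rewrite (d_al _ Du) (hc_d_cst hc) => H.
by lra.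
Qed.

(** Codazzi equation for xi and pvec, tested on wvec. *)
Lemma d_P_b u : D u -> d (Pf u) bf u = - 2 * bf u * (2 * bf u + 1).
Proof.
move=> Du; have := codazzi_test (Wf u) (hc_sv_xi hc) sv_Pf Du.
rewrite (nab_comb1 (xi u) (Wf u) scN sv_Pf Du APE').
rewrite (nab_comb2 (Pf u) (Wf u) sc_al (hc_sv_xi hc) (hc_sc_cst hc 1) sv_Wf Du AxiE').
rewrite !(hc_nab_xi hc _ Du) phiAP // AWE' // !(gE (pt Du)) nab_WW //.
rewrite !(nab_orth_xi _ sv_Pf Du gPxi).
rewrite (nab_orth _ sv_Pf sv_Wf Du gPW) ?phiAxi ?phiAP // ?phiP // (ss_phi_xi (pt Du)).
rewrite (gC (pt Du) (Pf u) (nab _ _ _)) (nab_xi_W_P Du) !(gE (pt Du)).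
rewrite ?gxx // ?gWxi // ?gPxi // ?gWP // ?gPW // ?gxW // ?gxP // ?gPP // ?gWW.
rewrite (hc_d_cst hc) => H.
have aa := alpha_sqr Du.
have H1 : al u * al u * bf u = bf u by rewrite aa mul1r.
have H2 : al u * al u * bf u * bf u = bf u * bf u by rewrite aa mul1r.
by lra.
Qed.

(** The bracket of xi and wvec is -alpha (beta^2 + 3) pvec. As beta^2 is
    constant along xi and wvec it is constant along their bracket, whereas d_P_b
    says that its derivative along pvec is negative. *)
Theorem no_skew_non_hopf u : D u -> False.
Proof.
move=> Du.
have br := hc_d_bracket hc (hc_sv_xi hc) sv_Wf sc_bf Du.
rewrite (hc_d_ext hc _ d_W_b Du) (hc_d_ext hc _ d_xi_b Du) !(hc_d_cst hc) subrr in br.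
set Z := nab _ _ _ - nab _ _ _ in br.
have ZE : Z = nab (xi u) Wf u - (al u * (bf u - 1)) *: Pf u.
  by rewrite /Z (hc_nab_xi hc _ Du) phiAW.
clearbody Z.
have bn := lt0r_neq0 (b0 Du).
have Zxi : g u Z (xi u) = 0.
  rewrite ZE !(gE (pt Du)) (nab_orth_xi _ sv_Wf Du gWxi) phiAxi gWP // gPxi //.
  by ring.
have ZW : g u Z (Wf u) = 0.
  by rewrite ZE !(gE (pt Du)) nab_WW // (d_xi_b Du) gPW //; ring.
have ZP : g u Z (Pf u) = - al u * bf u * (bf u + 3).
  by rewrite ZE !(gE (pt Du)) (nab_xi_W_P Du) gPP //; ring.
have pZ : proj Z u = 0.
  apply: (ss_eq0 (pt Du)); rewrite [X in g u _ X]projE Zxi ZW !(gE (pt Du)).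
  rewrite proj_xi // proj_Wf //.
  have -> : g u (proj Z u) Z = 0.
    by rewrite {2}ZE !(gE (pt Du)) nab_xi_wvec_proj // proj_Pf //; ring.
  by rewrite proj_Pf //; ring.
have {}ZE : Z = (- (al u * (bf u + 3))) *: Pf u.
  have := projE Z u; rewrite pZ Zxi ZW ZP mul0r !oppr0 !scale0r !addr0.
  move=> /esym/eqP; rewrite addr_eq0 => /eqP ->; rewrite -scaleNr; congr (_ *: _).
  by field.
rewrite ZE (hc_d_scale hc) (d_P_b Du) in br.
have bp := b0 Du.
have : al u * (bf u * ((bf u + 3) * (2 * bf u + 1))) = 0 by lra.
move/eqP; rewrite !mulf_eq0 (negbTE (al0 Du)) (negbTE bn) /=.
by move=> /orP[] /eqP; lra.
Qed.

End DifferentialPart.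

(** * Back to charts *)

Section Instance.
Context {R : realType} {m n : nat}.
Local Notation mxfun := ('rV[R]_n -> 'M[R[i]]_m.+1).
Variables (D : set 'rV[R]_n) (F N : mxfun).
Hypothesis hyp : local_hypersurface D F N.
Let oD := lh_open hyp.

Implicit Types (u X Y Z : 'rV[R]_n) (V : 'rV[R]_n -> 'rV[R]_n).
Local Notation g := (metric F).
Local Notation A := (Defs.shape F N).
Local Notation xi := (xi F N).
Local Notation phi := (phi F).

Lemma phi_linear u a X Y : D u -> phi u (a *: X + Y) = a *: phi u X + phi u Y.
Proof.
move=> Du; apply: (metric_inj hyp Du) => Z.
apply: (etrans (metric_phi hyp _ _ Du)); apply/esym.
apply: (etrans (metric_linear F u a (phi u X) (phi u Y) Z)).
apply: (etrans (congr2 (fun p q => a * p + q) (metric_phi hyp X Z Du)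
  (metric_phi hyp Y Z Du))).
by rewrite diff_mx_linear JcpD JcpZ gFSDl gFSZl.
Qed.

Lemma local_shape_structure u : D u -> shape_structure (g u) (A u) (phi u) (xi u).
Proof.
move=> Du; split.
- exact: metricC.
- exact: metric_linear.
- by move=> X; exact: (metric_ge0 hyp X Du).
- by move=> X; exact: (metric_eq0 hyp Du).
- by move=> a X Y; exact: (shape_lin hyp a X Y Du).
- by move=> X Y; exact: (shape_sym hyp X Y Du).
- by move=> a X Y; exact: phi_linear.
- by move=> X Y; exact: (phi_skew hyp X Y Du).
- exact: (phi_xi hyp Du).
- by move=> X; exact: (phi_phi hyp X Du).
- exact: (eta_xi hyp Du).
Qed.

Lemma local_calculus : hypersurface_calculus D g A phi xi (@dir R n)
  (nabla F) (smooth_on D) (smooth_vec D).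
Proof.
split.
- exact: local_shape_structure.
- by move=> f h fh; exact: (smooth_ext oD fh).
- by move=> c; exact: smooth_cst.
- by move=> f h sf sh; exact: (smoothD oD sf sh).
- by move=> f h sf sh; exact: (smoothM oD sf sh).
- by move=> f sf f0; exact: (smoothV oD sf f0).
- move=> V W VW sV l; apply: (smooth_ext oD _ (sV l)) => v Dv.
  by rewrite VW.
- exact: smooth_vec_cst.
- by move=> V W sV sW; exact: (smooth_vecD hyp sV sW).
- by move=> f V sf sV; exact: (smooth_vecZ hyp sf sV).
- exact: (smooth_xi hyp).
- by move=> V sV; exact: (smooth_shape hyp sV).
- by move=> V sV; exact: (smooth_phi hyp sV).
- by move=> V W sV sW; exact: (smooth_metric hyp sV sW).
- by move=> X f h u fh Du; exact: (dir_ext oD X fh Du).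
- by move=> X c u; exact: dir_cst.
- by move=> X f h u sf sh Du; exact: (dirD X sf sh Du).
- by move=> X f h u sf sh Du; exact: (dirM X sf sh Du).
- move=> a X f u; rewrite /dir mulr_sumr; apply: eq_bigr => i _.
  by rewrite mxE mulrA.
- move=> V W f u sV sW sf Du; rewrite (nab_torsion hyp sV sW Du).
  exact: (dir_bracket oD sf sV sW Du).
- by move=> X V W u VW Du; exact: (nab_ext hyp X VW Du).
- by move=> X V W u sV sW Du; exact: (nabD hyp X sV sW Du).
- by move=> X f V u sf sV Du; exact: (nabZ hyp X sf sV Du).
- by move=> X V W u sV sW Du; exact: (nab_metric hyp X sV sW Du).
- by move=> X u Du; exact: (nab_xi hyp X Du).
- by move=> X V u sV Du; exact: (nab_phi hyp X sV Du).
- by move=> V W u sV sW Du; exact: (codazzi hyp sV sW Du).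
Qed.

Lemma RxiE_local u X : D u ->
  structure_jacobi F N u X = Rxi (g u) (A u) (xi u) X.
Proof. by move=> Du; rewrite RxiE; exact: (structure_jacobiE hyp X Du). Qed.

(** Three linear conditions on n > 3 coordinates. *)
Lemma exists_orthogonal u X1 X2 X3 : (3 < n)%N ->
  exists X, [/\ X != 0, g u X X1 = 0, g u X X2 = 0 & g u X X3 = 0].
Proof.
move=> n3; pose col X := gram F u *m X^T.
pose M : 'M[R]_(n, 1 + (1 + 1)) := row_mx (col X1) (row_mx (col X2) (col X3)).
have kM : kermx M != 0.
  rewrite kermx_eq0 /row_free; apply: contraTneq (rank_leq_col M) => ->.
  by rewrite -ltnNge.
have XM : nz_row (kermx M) *m M = 0 by apply/sub_kermxP; exact: nz_row_sub.
exists (nz_row (kermx M)); rewrite nz_row_eq0; move: XM.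
rewrite /M !mul_mx_row -row_mx0 => /eq_row_mx[X10]; rewrite -row_mx0.
move=> /eq_row_mx[X20 X30].
by split; rewrite // /metric -mulmxA ?(X10, X20, X30) mxE.
Qed.

End Instance.

Lemma local_hypersurface_sub (R : realType) (m n : nat) (D D' : set 'rV[R]_n)
    (F N : 'rV[R]_n -> 'M[R[i]]_m.+1) :
  open D' -> (D' `<=` D)%classic -> local_hypersurface D F N -> local_hypersurface D' F N.
Proof.
move=> oD' sub [oD dm sF sN cF iF tN NN NF]; split=> //.
- by move=> a b; have [s1 s2] := sF a b; split; exact: (smooth_sub sub).
- by move=> a b; have [s1 s2] := sN a b; split; exact: (smooth_sub sub).
- by move=> u /sub; exact: cF.
- by move=> u X /sub; exact: iF.
- by move=> u /sub; exact: tN.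
- by move=> u /sub; exact: NN.
- by move=> u X /sub; exact: NF.
Qed.

Lemma open_neq0 (R : realType) (n : nat) (D : set 'rV[R]_n) (b : 'rV[R]_n -> R) :
  open D -> smooth_on D b -> open [set u | D u /\ b u != 0]%classic.
Proof.
move=> oD sb; rewrite openE => u [Du bu]; rewrite /interior.
apply: filterI; first exact: open_nbhs_nbhs.
have cb := smooth_continuous sb Du.
exact: (cb _ (open_nbhs_nbhs (conj (open_neq (y := 0)) bu))).
Qed.

Theorem theorem4 (R : realType) (m : nat) (hm : (3 <= m)%N) :
  ~ exists (M : topologicalType) (f : M -> 'M[R[i]]_m.+1)
      (atlas : set (hchart R m M)) (k : R),
    [/\ real_hypersurface f atlas,
        ~ hopf f atlas,
        k != 0,
        forall c u, atlas c -> dom c u -> k * chart_alpha f c u != 1 &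
        RxiT_skew f k atlas].
Proof.
move=> [M [f [atlas [k [[_ _ _ charts _] nhopf k0 kalpha skew]]]]].
apply: nhopf => c u ac Du.
have [[oD _ _ _] [sF cF iF] [sN nN]] := charts c ac.
set F := f \o par c in sF cF iF; set N := nrm c in sN nN.
have hyp : local_hypersurface (dom c) F N.
  split=> //.
  - by rewrite /hdim prednK // double_gt0 (leq_trans _ hm).
  - by move=> v Dv; have [] := nN v Dv.
  - by move=> v Dv; have [] := nN v Dv.
  - by move=> v X Dv; have [_ _] := nN v Dv; exact.
pose W v := wvec (metric F v) (Defs.shape F N v) (xi F N v).
pose b v := beta_sqr (metric F v) (Defs.shape F N v) (xi F N v).
have sb : smooth_on (dom c) b := sc_bf (local_calculus hyp).
(* Either A xi is a multiple of xi at u, or the contradiction is reached on the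
   neighbourhood D of u where A xi and xi are independent. *)
have [Wu|Wu] := eqVneq (W u) 0.
  exists (alpha (metric F u) (Defs.shape F N u) (xi F N u)).
  by have := shape_xi (metric F u) (Defs.shape F N u) (xi F N u);
     rewrite -/(W u) Wu addr0.
exfalso.
pose D := [set v | dom c v /\ b v != 0]%classic.
have oD' : open D := open_neq0 oD sb.
have hyp' : local_hypersurface D F N.
  by apply: (local_hypersurface_sub oD' _ hyp) => v [].
have pt v (Dv : D v) := local_shape_structure hyp' Dv.
apply: (no_skew_non_hopf (local_calculus hyp') (k := k) k0 _ _ _ _ (u := u)).
- move=> v Dv X Y; have [dv _] := Dv.
  pose T := torsion_op (metric F v) (Defs.shape F N v) (phi F v) (xi F N v) k.
  have transport (S : 'rV[R]_(hdim m) -> 'rV[R]_(hdim m)) :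
      (forall Z, structure_jacobi F N v Z = S Z) ->
      T X (S Y) - S (T X Y) = - (T Y (S X) - S (T Y X)).
    by move=> /funext <-; exact: (skew c v X Y ac dv).
  exact: (transport _ (fun Z => RxiE_local hyp' Z Dv)).
- by move=> v [dv _]; exact: (kalpha c v ac dv).
- move=> v [dv bv]; apply: contra_neq bv => W0.
  have {}W0 : W v = 0 := W0.
  exact: (etrans (congr2 (metric F v) W0 W0) (g0l (local_shape_structure hyp dv) _)).
- move=> v X1 X2 X3 _; apply: exists_orthogonal.
  (* The hypersurface has dimension 2 m - 1, which exceeds 3. *)
  by rewrite /hdim; lia.
- split=> //; exact: lt0r_neq0 (beta_sqr_gt0 (local_shape_structure hyp Du) Wu).
Qed.
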